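(* Suppose that the Dezin problem with parameter $\lambda\neq 0$ and right-hand side $F$ (as described in the context) has a solution. Then this solution is unique if and only if $\delta_k := e^{-\lambda_k\alpha}-\lambda \neq 0$ for all $k\in\mathbb{N}$.
   Context: Let $0<\rho<1$, $\alpha>0$, $\beta>0$, $\lambda\in\mathbb{R}$ with $\lambda\neq 0$, and let $\Omega\subset\mathbb{R}^N$ be an (arbitrary) bounded domain with sufficiently smooth boundary $\partial\Omega$. The Caputo derivative is $D_t^\rho f(t)=\frac{1}{\Gamma(1-\rho)}\int_0^t \frac{f'(\tau)}{(t-\tau)^{\rho}}\,d\tau$, $t>0$. $\Delta$ is the Laplace operator in $x$. $\{v_k\}_{k\ge1}$ is a complete orthonormal system in $L_2(\Omega)$ of eigenfunctions of the Dirichlet problem $-\Delta v=\lambda v$ in $\Omega$, $v|_{\partial\Omega}=0$, with eigenvalues $0<\lambda_1\le\lambda_2\le\dots$ (repeated according to multiplicity; the eigenvalues $\lambda_k$ are not to be confused with the parameter $\lambda$). Dezin problem: given a continuous function $F(x,t)$, find $u(x,t)$ such that $D_t^\rho u-\Delta u=F(x,t)$ for $x\in\Omega$, $0<t\le\beta$; $u_t+\Delta u=F(x,t)$ for $x\in\Omega$, $-\alpha<t<0$; $u(x,t)|_{\partial\Omega}=0$ for $t\in[-\alpha,\beta]$; $\lim_{t\to+0}u(x,t)=\lim_{t\to-0}u(x,t)$ for $x\in\Omega$; $u(x,-\alpha)=\lambda u(x,0)$ for $x\in\Omega$. A (classical) solution is a function $u$ satisfying all these conditions and such that: $u$ is absolutely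 continuous in $t$ on $[0,\beta]$ (the paper writes $u\in AC(\overline\Omega\times[0,\beta])$); $u\in C(\overline\Omega\times[-\alpha,\beta])$; $\Delta u\in C(\overline\Omega\times((-\alpha,0)\cup(0,\beta]))$; $D_t^\rho u\in C(\overline\Omega\times(0,\beta])$; $u_t\in C(\overline\Omega\times(-\alpha,0))$. *)

(* Defs.v *)
From HB Require Import structures.
From mathcomp Require Import all_boot all_order all_algebra.
From mathcomp Require Import all_classical all_reals all_analysis.
Set Implicit Arguments.
Unset Strict Implicit.
Unset Printing Implicit Defensive.
Import Order.TTheory GRing.Theory Num.Theory.
Import numFieldNormedType.Exports.
Local Open Scope classical_set_scope.
Local Open Scope ring_scope.

Definition measure_rV_display : measure_display.
Proof. exact: default_measure_display. Qed.

Section measurable_rV.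
Context {R : realType} (n : nat).

Definition rV_coord (i : 'I_n) (x : 'rV[R]_n) : measurableTypeR R := x ord0 i.

Let rV_set0 : g_sigma_preimage rV_coord set0.
Proof. exact: sigma_algebra0. Qed.

Let rV_setC A : g_sigma_preimage rV_coord A -> g_sigma_preimage rV_coord (~` A).
Proof. exact: sigma_algebraC. Qed.

Let rV_bigcup (F : (set 'rV[R]_n)^nat) :
  (forall i, g_sigma_preimage rV_coord (F i)) ->
  g_sigma_preimage rV_coord (\bigcup_i (F i)).
Proof. exact: sigma_algebra_bigcup. Qed.

HB.instance Definition _ := @isMeasurable.Build measure_rV_display
  'rV[R]_n (g_sigma_preimage rV_coord) rV_set0 rV_setC rV_bigcup.

Lemma measurable_rV_coord i : measurable_fun [set: 'rV[R]_n] (rV_coord i).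
Proof.
move=> _ Y mY; rewrite setTI; apply: sub_sigma_algebra.
rewrite -bigcup_seq/=; exists i => /=; first by rewrite mem_index_enum.
by exists Y => //; rewrite setTI.
Qed.

Lemma measurable_fun_rV d (T : measurableType d) (f : T -> 'rV[R]_n) :
  (forall i, measurable_fun [set: T] (rV_coord i \o f)) ->
  measurable_fun [set: T] f.
Proof.
move=> mf _ A mA; rewrite setTI.
have : <<s \big[setU/set0]_(i < n)
    preimage_set_system setT (rV_coord i) measurable >> `<=`
  image_set_system setT f measurable.
  apply: smallest_sub.
    by apply: sigma_algebra_image; exact: sigma_algebra_measurable.
  rewrite -bigcup_seq => B [i _] [C mC <-].
  by rewrite /image_set_system/= !setTI; have := mf i measurableT C mC;
    rewrite setTI.
by move=> /(_ A mA); rewrite /image_set_system/= setTI.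
Qed.

End measurable_rV.

Section rV_cons.
Context {R : realType} (n : nat).

Definition rV_cons (p : measurableTypeR R * 'rV[R]_n) : 'rV[R]_n.+1 :=
  row_mx (p.1 : R)%:M p.2.

Definition rV_uncons (x : 'rV[R]_n.+1) : measurableTypeR R * 'rV[R]_n :=
  (x ord0 ord0, \row_j x ord0 (lift ord0 j)).

Lemma rV_cons0 p : rV_cons p ord0 ord0 = p.1.
Proof.
have := row_mxEl (p.1 : R)%:M p.2 ord0 (ord0 : 'I_1).
rewrite [RHS]mxE => E; apply: (etrans _ E); rewrite /rV_cons.
by congr (row_mx _ _ _ _); exact: val_inj.
Qed.

Lemma rV_consS p j : rV_cons p ord0 (lift ord0 j) = p.2 ord0 j.
Proof.
have := row_mxEr (p.1 : R)%:M p.2 ord0 j => <-; rewrite /rV_cons.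
by congr (row_mx _ _ _ _); exact: val_inj.
Qed.

Lemma rV_consK : cancel rV_cons rV_uncons.
Proof.
move=> [a y]; rewrite /rV_uncons rV_cons0; congr (_, _).
by apply/rowP => j; rewrite mxE rV_consS.
Qed.

Lemma measurable_rV_cons : measurable_fun setT rV_cons.
Proof.
apply: measurable_fun_rV => i.
have [j ->|->] := unliftP ord0 i; last first.
  rewrite (_ : _ \o _ = fst); first exact: measurable_fst.
  by apply/funext => p; exact: rV_cons0.
rewrite (_ : _ \o _ = rV_coord j \o snd); last first.
  by apply/funext => p; exact: rV_consS.
by apply: measurableT_comp; [exact: measurable_rV_coord|exact: measurable_snd].
Qed.

Lemma measurable_rV_uncons : measurable_fun setT rV_uncons.
Proof.
apply/measurable_fun_pair => /=; first exact: (measurable_rV_coord ord0).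
apply: measurable_fun_rV => j.
rewrite (_ : _ \o _ = rV_coord (lift ord0 j)); first exact: measurable_rV_coord.
by apply/funext => x; rewrite /= /rV_coord mxE.
Qed.

End rV_cons.

Section prod_rV.
Local Open Scope ereal_scope.
Context {R : realType} (n : nat).
Variable mu : {sigma_finite_measure set 'rV[R]_n -> \bar R}.

Definition prod_rV : set 'rV[R]_n.+1 -> \bar R :=
  pushforward (lebesgue_measure \x mu) (@rV_cons R n).

Let m : {measure set 'rV[R]_n.+1 -> \bar R} :=
  measure_function_pushforward__canonical__measure_function_Measure
    (lebesgue_measure \x mu) (@measurable_rV_cons R n).

Let prod_rV0 : prod_rV set0 = 0. Proof. exact: (measure0 m). Qed.

Let prod_rV_ge0 A : 0 <= prod_rV A. Proof. exact: (measure_ge0 m). Qed.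

Let prod_rV_sigma_additive : semi_sigma_additive prod_rV.
Proof. exact: (@measure_semi_sigma_additive _ _ _ m). Qed.

HB.instance Definition _ := isMeasure.Build _ _ _ prod_rV
  prod_rV0 prod_rV_ge0 prod_rV_sigma_additive.

Let prod_rV_sigma_finite : sigma_finite setT prod_rV.
Proof.
have /sigma_finiteP[F [TF ndF Foo]] := sigma_finiteT (@lebesgue_measure R).
have /sigma_finiteP[G [TG ndG Goo]] := sigma_finiteT mu.
exists (fun k => @rV_uncons R n @^-1` (F k `*` G k)).
  apply/esym; rewrite -subTset => x _.
  have : [set: R] (rV_uncons x).1 by [].
  rewrite TF => -[i _ Fi].
  have : [set: 'rV[R]_n] (rV_uncons x).2 by [].
  rewrite TG => -[j _ Gj].
  exists (maxn i j) => //; split.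
    by move: Fi; exact/subsetPset/ndF/leq_maxl.
  by move: Gj; exact/subsetPset/ndG/leq_maxr.
move=> k; have [mF lF] := Foo k; have [mG lG] := Goo k; split.
  rewrite -[X in measurable X]setTI.
  by apply: measurable_rV_uncons => //; exact: measurableX.
rewrite /prod_rV /pushforward -comp_preimage.
rewrite (_ : _ \o _ = id); last by apply/funext; exact: rV_consK.
by rewrite preimage_id product_measure1E// lte_mul_pinfty// ge0_fin_numE.
Qed.

HB.instance Definition _ := Measure_isSigmaFinite.Build _ _ _ prod_rV
  prod_rV_sigma_finite.

End prod_rV.

Fixpoint lebesgue_rV {R : realType} n :
    {sigma_finite_measure set 'rV[R]_n -> \bar R} :=
  match n with
  | 0 => \d_(0 : 'rV[R]_0)
  | k.+1 => prod_rV (lebesgue_rV k)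
  end.

Lemma lebesgue_rV_box {R : realType} n (a b : 'I_n -> R) :
  (forall i, a i <= b i) ->
  lebesgue_rV n [set x | forall i, a i <= x ord0 i <= b i] =
  (\prod_(i < n) (b i - a i))%:E.
Proof.
elim: n a b => [|n IH] a b ab.
  rewrite /= diracE big_ord0 mem_set//; by case.
pose B := [set x : 'rV[R]_n |
  forall i, a (lift ord0 i) <= x ord0 i <= b (lift ord0 i)].
have consB : @rV_cons R n @^-1` [set x | forall i, a i <= x ord0 i <= b i] =
    `[a ord0, b ord0] `*` B.
  apply/seteqP; split => -[x y]/=.
    move=> h; split => /=.
      by rewrite in_itv/=; have := h ord0; rewrite rV_cons0.
    by move=> i; have := h (lift ord0 i); rewrite rV_consS.
  move=> [/=]; rewrite in_itv/= => h0 h i.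
  by have [j ->|->] := unliftP ord0 i; rewrite ?rV_cons0 ?rV_consS//; exact: h.
have mB : measurable B.
  rewrite (_ : B = \bigcap_(i in [set: 'I_n])
      (rV_coord i @^-1` `[a (lift ord0 i), b (lift ord0 i)])).
    apply: fin_bigcap_measurable; first exact: finite_finset.
    move=> i _; have := @measurable_rV_coord R n i measurableT.
    by move=> /(_ _ (measurable_itv `[a (lift ord0 i), b (lift ord0 i)])); rewrite setTI.
  apply/seteqP; split => x h i; first by move=> _; rewrite /= in_itv/=; exact: h.
  by have := h i I; rewrite /= in_itv/=.
transitivity ((lebesgue_measure \x lebesgue_rV n)%E
  (@rV_cons R n @^-1` [set x | forall i, a i <= x ord0 i <= b i])) => //.
rewrite consB product_measure1E//= IH// big_ord_recl EFinM.
congr (_ * _)%E; apply: etrans (lebesgue_measure_itv `[a ord0, b ord0]) _.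
rewrite /= lte_fin; have [//|ba] := ltP (a ord0) (b ord0).
by rewrite (@le_anti _ _ (a ord0) (b ord0)) ?ab// subrr.
Qed.

Section domains.
Context {R : realType} (N : nat).
Implicit Types (Omega U : set 'rV[R]_N) (f : 'rV[R]_N -> R) (x : 'rV[R]_N).

Definition bounded_domain Omega :=
  [/\ open Omega, connected Omega, Omega !=set0 & bounded_set Omega].

(* The topological boundary, for open Omega only. *)
Definition bnd Omega : set 'rV[R]_N := closure Omega `\` Omega.

Definition evec (i : 'I_N) : 'rV[R]_N := delta_mx ord0 i.

Definition partial (i : 'I_N) f : 'rV[R]_N -> R := fun x => 'D_(evec i) f x.

Fixpoint Ck (k : nat) U f : Prop :=
  (forall x, U x -> {for x, continuous f}) /\
  match k with
  | 0 => True
  | k'.+1 => forall i, (forall x, U x -> derivable f x (evec i)) /\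
                       Ck k' U (partial i f)
  end.

(* Near each boundary point, Omega is the region phi < 0 for some C^k function
   phi with nonzero gradient at that point. *)
Definition Ck_boundary (k : nat) Omega :=
  forall p, bnd Omega p ->
  exists (U : set 'rV[R]_N) (phi : 'rV[R]_N -> R),
    [/\ open_nbhs p U, Ck k U phi, exists i, partial i phi p != 0 &
        forall x, U x -> (Omega x <-> phi x < 0)].

(* 'D_v is a total operator, so the existence of the derivatives entering the
   Laplacian is recorded separately. *)
Definition has_laplacian f x :=
  forall i, (\forall y \near x, derivable f y (evec i)) /\
            derivable (partial i f) x (evec i).

Definition laplacian f x : R := \sum_(i < N) partial i (partial i f) x.

End domains.

Section L2.
Context {R : realType} (N : nat).
Implicit Types (Omega : set 'rV[R]_N) (f g : 'rV[R]_N -> R).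

Definition L2 Omega f :=
  measurable_fun Omega (f : 'rV[R]_N -> measurableTypeR R) /\
  (lebesgue_rV N).-integrable Omega (fun x => (f x ^+ 2)%:E).

Definition L2_dot Omega f g : R := \int[lebesgue_rV N]_(x in Omega) (f x * g x).

(* Complete means total: only the null class is orthogonal to all v k. *)
Definition complete_orthonormal_system Omega (v : nat -> 'rV[R]_N -> R) :=
  [/\ forall k, L2 Omega (v k),
      forall j k, L2_dot Omega (v j) (v k) = (j == k)%:R &
      forall f, L2 Omega f -> (forall k, L2_dot Omega f (v k) = 0) ->
        {ae lebesgue_rV N, forall x, Omega x -> f x = 0}].

Definition dirichlet_eigenfunction Omega (mu : R) (v : 'rV[R]_N -> R) :=
  [/\ {within closure Omega, continuous v},
      Ck 2 Omega v,
      forall x, Omega x -> - laplacian v x = mu * v x,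
      forall x, bnd Omega x -> v x = 0 &
      exists2 x, Omega x & v x != 0].

End L2.

Section caputo.
Context {R : realType}.
Implicit Types (rho s t : R) (f : R -> R).

Definition Gamma s : R :=
  \int[lebesgue_measure]_(x in `]0, +oo[) (x `^ (s - 1) * expR (- x)).

Definition abs_continuous (a b : R) f :=
  forall e : R, 0 < e -> exists2 d : R, 0 < d &
  forall (n : nat) (l r : 'I_n -> R),
    (forall i, a <= l i /\ l i <= r i /\ r i <= b) ->
    trivIset setT (fun i => `]l i, r i[%classic) ->
    \sum_(i < n) (r i - l i) < d ->
    \sum_(i < n) `|f (r i) - f (l i)| < e.

(* derive1 is total; an absolutely continuous f is differentiable almost
   everywhere, so the values of derive1 f elsewhere do not affect integrals. *)
Definition caputo_integrand rho f t : R -> R :=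
  fun tau => derive1 f tau / (t - tau) `^ rho.

Definition has_caputo rho f t :=
  lebesgue_measure.-integrable `]0, t[
    (fun tau => (caputo_integrand rho f t tau)%:E).

Definition caputo rho f t : R :=
  (Gamma (1 - rho))^-1 *
  \int[lebesgue_measure]_(tau in `]0, t[) caputo_integrand rho f t tau.

End caputo.

Section dezin.
Context {R : realType} (N : nat).
Variables (rho alpha beta : R) (Omega : set 'rV[R]_N).
Implicit Types (u F : 'rV[R]_N -> R -> R).

Definition nonzero_times : set R := `]- alpha, 0[ `|` `]0, beta].

(* The Laplacian is an operator on functions on the open set Omega, so its
   belonging to C(closure Omega x T) means that it extends continuously. *)
Definition dezin_regular u :=
  [/\ {within closure Omega `*` `[- alpha, beta],
        continuous (fun p => u p.1 p.2)},
      forall x, closure Omega x -> abs_continuous 0 beta (u x),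
      [/\ forall x t, Omega x -> nonzero_times t ->
            has_laplacian (fun y => u y t) x &
          exists2 g : 'rV[R]_N * R -> R,
            {within closure Omega `*` nonzero_times, continuous g} &
            forall x t, Omega x -> nonzero_times t ->
              g (x, t) = laplacian (fun y => u y t) x],
      [/\ forall x t, closure Omega x -> 0 < t <= beta ->
            has_caputo rho (u x) t &
          {within closure Omega `*` `]0, beta],
            continuous (fun p => caputo rho (u p.1) p.2)}] &
      [/\ forall x t, closure Omega x -> - alpha < t < 0 ->
            derivable (u x) t 1 &
          {within closure Omega `*` `]- alpha, 0[,
            continuous (fun p => derive1 (u p.1) p.2)}]].

Definition dezin_solution (lambda : R) F u :=
  dezin_regular u /\
  [/\ forall x t, Omega x -> 0 < t <= beta ->
        caputo rho (u x) t - laplacian (fun y => u y t) x = F x t,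
      forall x t, Omega x -> - alpha < t < 0 ->
        derive1 (u x) t + laplacian (fun y => u y t) x = F x t,
      forall x t, bnd Omega x -> - alpha <= t <= beta -> u x t = 0,
      forall x, Omega x -> exists l : R,
        u x t @[t --> 0^'+] --> l /\ u x t @[t --> 0^'-] --> l &
      forall x, Omega x -> u x (- alpha) = lambda * u x 0].

(* Only the values on closure Omega x [-alpha, beta] are meaningful. *)
Definition dezin_unique (lambda : R) F :=
  forall u w, dezin_solution lambda F u -> dezin_solution lambda F w ->
  forall x t, closure Omega x -> - alpha <= t <= beta -> u x t = w x t.

End dezin.

(* Main.v *)
(* If no delta_k vanishes, let z be the difference of two solutions.  For t < 0 the Fourier
   coefficients T_k of z satisfy T_k' = lambda_k T_k by Green's identity, so
   T_k(0) = e^(lambda_k alpha) T_k(-alpha); together with T_k(-alpha) = lambda T_k(0) this gives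
   delta_k T_k(0) = 0, and by completeness z = 0 on [-alpha, 0].  For t > 0 the function z solves
   the homogeneous fractional diffusion equation with zero initial and boundary values, and
   vanishes by a maximum principle, because the Caputo derivative of an absolutely continuous
   function is nonnegative where it attains its maximum over the past.  The pure second
   derivatives of z are only known to exist pointwise, and Green's identity is reached through
   difference quotients of sup-convolutions of z.  Conversely, if delta_k = 0, then
   e^(lambda_k t) v_k for t < 0, continued by E_rho(- lambda_k t^rho) v_k with E_rho the
   Mittag-Leffler function, is a nontrivial solution of the homogeneous problem. *)
From HB Require Import structures.
Require Import Defs.
From mathcomp Require Import all_boot all_order all_algebra.
From mathcomp Require Import all_classical all_reals all_analysis.
From mathcomp Require Import measurable_realfun ring lra.
Set Implicit Arguments.
Unset Strict Implicit.
Unset Printing Implicit Defensive.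
Import Order.TTheory GRing.Theory Num.Theory.
Import numFieldNormedType.Exports.
Local Open Scope classical_set_scope.
Local Open Scope ring_scope.

(** * Difference quotients *)

(** Only the sum of the pure second derivatives of a solution is known to extend continuously;
    nothing bounds or integrates each of them, so integration by parts does not apply to the
    solution itself. The symmetric second difference, in contrast, is self-adjoint for Lebesgue
    measure without any regularity, and it converges pointwise; what is missing is domination. A
    sup-convolution bounds the discrete Laplacian from below uniformly in the step, and comparison
    at the maximising point carries over the pointwise limit. A Fatou-type argument then gives one
    inequality, and the same inequality for the negative of the eigenfunction gives the other. For
    positive times, absolute continuity is known for each [x] separately, which does not allow the
    Caputo derivative to be exchanged with a space integral; a maximum principle evaluates the
    equation at a single point and avoids the exchange. The Mittag-Leffler coefficients are defined
    by the recursion that the Caputo derivative forces, through the Beta-type integrals [frac_beta];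
    of Gamma only its positivity at [1 - rho] enters. *)

Section second_difference.
Context {R : realType}.
Implicit Types (f g : R -> R).

(** Mean value theorem for [f s + f (- s) - c * s ^+ 2]. The first derivative is compared with its
    linear part at 0 only, so a second derivative existing at that single point is enough. *)
Lemma second_difference_bound f (c M h : R) : 0 < h ->
  (forall s : R, `|s| <= h -> derivable f s 1) ->
  (forall s : R, `|s| <= h -> `|derive1 f s - derive1 f 0 - c * s| <= M * `|s|) ->
  `|f h + f (- h) - 2 * f 0 - c * h ^+ 2| <= 2 * M * h ^+ 2.
Proof.
move=> h0 df Hf.
pose r := fun s : R => f s + f (- s) - c * s ^+ 2.
have dr (s : R) : `|s| <= h ->
    is_derive s 1 r (derive1 f s - derive1 f (- s) - 2 * c * s).
  move=> sh.
  have d1 : is_derive s 1 f (derive1 f s).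
    by rewrite derive1E; apply/derivableP; exact: df.
  have d2 : is_derive (- s) 1 f (derive1 f (- s)).
    by rewrite derive1E; apply/derivableP; apply: df; rewrite normrN.
  have d3 : is_derive s 1 (f \o -%R) (- derive1 f (- s)).
    rewrite -mulrN1; apply: (@is_derive1_comp _ f -%R) => //.
  rewrite (_ : r = f + (f \o -%R) - (c \*: (@GRing.exp R)^~ 2)); last first.
    by apply/funext => x; rewrite !fctE.
  apply: is_derive_eq.
  rewrite /GRing.scale /=; ring.
have M0 : 0 <= M.
  have := Hf h; rewrite ger0_norm ?(ltW h0)// lexx => /(_ isT) H.
  by rewrite -(pmulr_lge0 _ h0) (le_trans _ H)// normr_ge0.
have [|||x xh E] := @MVT_segment _ r
  (fun s => derive1 f s - derive1 f (- s) - 2 * c * s) 0 h.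
- exact: ltW.
- move=> s; rewrite in_itv/= => /andP[s0 sh]; apply: dr.
  by rewrite gtr0_norm// ltW.
- apply: derivable_within_continuous => s; rewrite in_itv/= => /andP[s0 sh].
  by have [] := dr s _; rewrite ?ger0_norm.
move: xh; rewrite in_itv/= => /andP[x0 xh].
have -> : f h + f (- h) - 2 * f 0 - c * h ^+ 2 = r h - r 0.
  by rewrite /r oppr0; ring.
rewrite E normrM subr0 (gtr0_norm h0).
have b1 := Hf x; have b2 := Hf (- x).
rewrite normrN in b2; rewrite ger0_norm// in b1 b2.
have {}b1 := b1 xh; have {}b2 := b2 xh.
have : `|derive1 f x - derive1 f (- x) - 2 * c * x| <= 2 * M * x.
  have -> : derive1 f x - derive1 f (- x) - 2 * c * x =
    (derive1 f x - derive1 f 0 - c * x) - (derive1 f (- x) - derive1 f 0 - c * - x).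
    by ring.
  by rewrite (le_trans (ler_normB _ _))//; lra.
move=> H; rewrite expr2 mulrA ler_pM2r// (le_trans H)// ler_wpM2l//.
by rewrite mulr_ge0.
Qed.

End second_difference.

Section discrete_laplacian.
Context {R : realType} (N : nat).
Implicit Types (f : 'rV[R]_N -> R) (x : 'rV[R]_N) (h : R).

(** The symmetric quotient is used because translation invariance alone makes it self-adjoint
    ([tame_dlap_by_parts]). *)
Definition diff2 h i f x : R :=
  (f (x + h *: evec i) + f (x - h *: evec i) - 2 * f x) / h ^+ 2.

Definition dlap h f x : R := \sum_(i < N) diff2 h i f x.

Let line f x i (s : R) : R := f (x + s *: evec i).

Let line_quot f x i (s : R) :
  (fun h : R => h^-1 *: (line f x i (h *: (1 : R) + s) - line f x i s)) =
  (fun h : R => h^-1 *: (f (h *: evec i + (x + s *: evec i)) - f (x + s *: evec i))).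
Proof.
apply/funext => h; rewrite /line (_ : h *: (1 : R) = h); last exact: mulr1.
by rewrite scalerDl addrCA.
Qed.

Let derivable_line f x i (s : R) :
  derivable f (x + s *: evec i) (evec i) <-> derivable (line f x i) s 1.
Proof. by rewrite /derivable line_quot. Qed.

Let derive1_line f x i (s : R) :
  derive1 (line f x i) s = partial i f (x + s *: evec i).
Proof. by rewrite derive1E /partial /derive line_quot. Qed.

Lemma diff2_near f x i (c M h : R) : 0 < h ->
  (forall s : R, `|s| <= h -> derivable f (x + s *: evec i) (evec i)) ->
  (forall s : R, `|s| <= h ->
    `|partial i f (x + s *: evec i) - partial i f x - c * s| <= M * `|s|) ->
  `|diff2 h i f x - c| <= 2 * M.
Proof.
move=> h0 df Hf.
have h20 : 0 < h ^+ 2 by rewrite exprn_gt0.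
have := @second_difference_bound _ (line f x i) c M h h0.
have dl (s : R) : `|s| <= h -> derivable (line f x i) s 1.
  by move=> /df /derivable_line.
move=> /(_ dl) H.
have -> : diff2 h i f x - c =
  (line f x i h + line f x i (- h) - 2 * line f x i 0 - c * h ^+ 2) / h ^+ 2.
  rewrite /diff2 /line scale0r addr0 scaleNr [RHS]mulrBl mulfK//.
  by rewrite gt_eqF.
rewrite normrM normfV (gtr0_norm h20) ler_pdivrMr//; apply: H => s sh.
by rewrite !derive1_line scale0r addr0; exact: Hf.
Qed.

Lemma rV_norm_leP x (c : R) : 0 <= c ->
  (`|x| <= c <-> forall i, `|x ord0 i| <= c).
Proof.
move=> c0; rewrite [`|x|]mx_normrE; split.
  by move=> /bigmax_leP[_ H] i; exact: (H (ord0, i)).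
by move=> H; apply/bigmax_leP; split => // -[i j] _ /=; rewrite (ord1 i).
Qed.

Lemma rV_coord_le_norm x i : `|x ord0 i| <= `|x|.
Proof. by have [H _] := @rV_norm_leP x `|x| (normr_ge0 _); exact: H. Qed.

Lemma evec_norm i (s : R) : `|s *: evec i : 'rV[R]_N| <= `|s|.
Proof.
apply/rV_norm_leP => // j; rewrite !mxE eqxx/=.
by case: eqP => _; rewrite ?mulr1 ?mulr0 ?normr0.
Qed.

Lemma nbhs_evec x (P : set 'rV[R]_N) : nbhs x P ->
  exists2 r : R, 0 < r & forall i (s : R), `|s| <= r -> P (x + s *: evec i).
Proof.
move=> /nbhs_ballP[r /= r0 H]; exists (r / 2); first by rewrite divr_gt0.
move=> i s sr; apply: H; rewrite -ball_normE/= opprD addrA subrr add0r normrN.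
by rewrite (le_lt_trans (evec_norm _ _))// (le_lt_trans sr)// gtr_pMr// invf_lt1// ltr1n.
Qed.

Lemma dlap_cvg f x : has_laplacian f x -> forall e : R, 0 < e ->
  exists2 r : R, 0 < r & forall h : R, 0 < h -> h <= r -> `|dlap h f x - laplacian f x| <= e.
Proof.
move=> lf e e0.
have HN : 0 < (2 * N%:R + 1 : R) by rewrite ltr_wpDl// mulr_ge0// ler0n.
(* Each of the [N] coordinates contributes at most [2 * e']; the extra 1 keeps the denominator
   positive when [N] is 0. *)
pose e' := e / (2 * N%:R + 1).
have e'0 : 0 < e' by rewrite divr_gt0.
have H i : exists2 r : R, 0 < r & forall h : R, 0 < h -> h <= r ->
    `|diff2 h i f x - partial i (partial i f) x| <= 2 * e'.
  have [nd d] := lf i.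
  have [r1 r10 H1] := nbhs_evec nd.
  set c := partial i (partial i f) x.
  have : h^-1 *: (partial i f (h *: evec i + x) - partial i f x) @[h --> 0^'] --> c.
    exact: d.
  move=> /cvgrPdist_le /(_ e' e'0).
  rewrite near_withinE => /nbhs_ballP[r2 /= r20 H2].
  exists (Num.min r1 (r2 / 2)); first by rewrite lt_min r10 divr_gt0.
  move=> h h0; rewrite le_min => /andP[hr1 hr2].
  apply: (@diff2_near f x i c e' h h0) => s sh.
    by apply: H1; rewrite (le_trans sh).
  have [->|s0] := eqVneq s 0.
    by rewrite scale0r addr0 subrr mulr0 subr0 normr0 mulr0.
  have := H2 s; rewrite /ball/= sub0r normrN => /(_ _ s0).
  have -> : (`|s| < r2) = true.
    by rewrite (le_lt_trans sh)// (le_lt_trans hr2)// gtr_pMr// invf_lt1// ltr1n.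
  move=> /(_ isT); rewrite (addrC _ x) => H3.
  have -> : partial i f (x + s *: evec i) - partial i f x - c * s =
    - (c - s^-1 *: (partial i f (x + s *: evec i) - partial i f x)) * s.
    by rewrite {2}/GRing.scale/= opprB mulrBl mulrAC mulVf// mul1r.
  by rewrite normrM normrN ler_wpM2r.
have /choice[r Hr] : forall i, exists r : R, 0 < r /\ forall h : R, 0 < h -> h <= r ->
    `|diff2 h i f x - partial i (partial i f) x| <= 2 * e'.
  by move=> i; have [r ? ?] := H i; exists r.
exists (\big[Num.min/1]_i r i); first by apply/bigmin_gtP; split=> // i _; have [] := Hr i.
move=> h h0 /bigmin_geP[_ hr].
rewrite /dlap /laplacian -sumrB (le_trans (ler_norm_sum _ _ _))//.
apply: (@le_trans _ _ (\sum_(i < N) (2 * e'))).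
  by apply: ler_sum => i _; have [_ ->//] := Hr i; exact: hr.
rewrite big_const_ord iter_addr addr0 -[_ *+ N]mulr_natl /e' !mulrA ler_pdivrMr//.
rewrite [leRHS]mulrDr mulr1 (_ : _ * 2 * e = e * (2 * N%:R)); last by ring.
by rewrite lerDl ltW.
Qed.

(** This is [diff2_near] with slope [c = 0]: by the mean value theorem along the coordinate line,
    [partial i f] varies by at most [M * |s|]. *)
Lemma dlap_bound f x (M h : R) : 0 < h ->
  (forall i (s : R), `|s| <= h -> derivable f (x + s *: evec i) (evec i) /\
     derivable (partial i f) (x + s *: evec i) (evec i) /\
     `|partial i (partial i f) (x + s *: evec i)| <= M) ->
  `|dlap h f x| <= N%:R * (2 * M).
Proof.
move=> h0 H; rewrite /dlap (le_trans (ler_norm_sum _ _ _))//.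
apply: (@le_trans _ _ (\sum_(i < N) (2 * M))); last first.
  by rewrite big_const_ord iter_addr addr0 [N%:R * _]mulr_natl.
apply: ler_sum => i _; rewrite -[X in `|X|]subr0.
apply: (@diff2_near f x i 0 M h h0) => s sh; first by have [] := H i s sh.
rewrite mul0r subr0.
have dl (t : R) : `|t| <= h -> derivable (line (partial i f) x i) t 1.
  by move=> th; apply/derivable_line; have [_ []] := H i t th.
have dd (t : R) : `|t| <= h -> is_derive t 1 (line (partial i f) x i)
    (partial i (partial i f) (x + t *: evec i)).
  by move=> th; rewrite -derive1_line derive1E; apply/derivableP/dl.
have [s0|s0] := leP 0 s.
  have [|||c] := @MVT_segment _ (line (partial i f) x i)
    (fun t => partial i (partial i f) (x + t *: evec i)) 0 s.
  - by [].
  - move=> t; rewrite in_itv/= => /andP[t0 ts]; apply: dd.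
    by rewrite gtr0_norm// (le_trans (ltW ts))// (le_trans _ sh)// ler_norm.
  - apply: derivable_within_continuous => t; rewrite in_itv/= => /andP[t0 ts].
    by apply: dl; rewrite ger0_norm// (le_trans ts)// (le_trans _ sh)// ler_norm.
  rewrite in_itv/= {1 2}/line scale0r addr0 subr0 => /andP[c0 cs] ->.
  rewrite normrM ler_wpM2r//; have [|_ [_ //]] := H i c.
  by rewrite ger0_norm// (le_trans cs)// (le_trans _ sh)// ler_norm.
have [|||c] := @MVT_segment _ (line (partial i f) x i)
    (fun t => partial i (partial i f) (x + t *: evec i)) s 0.
- exact: ltW.
- move=> t; rewrite in_itv/= => /andP[t0 ts]; apply: dd.
  by rewrite ltr0_norm//; rewrite ltr0_norm// in sh; lra.
- apply: derivable_within_continuous => t; rewrite in_itv/= => /andP[t0 ts].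
  by apply: dl; rewrite ler0_norm//; rewrite ltr0_norm// in sh; lra.
rewrite in_itv/= {1 2}/line scale0r addr0 sub0r distrC => /andP[c0 cs] ->.
rewrite normrM normrN ler_wpM2r//; have [|_ [_ //]] := H i c.
by rewrite ler0_norm//; rewrite ltr0_norm// in sh; lra.
Qed.

End discrete_laplacian.

(** * Lebesgue measure on row vectors *)

Section lebesgue_rV_theory.
Context {R : realType}.

Lemma lebesgue_measure_shift (c : R) (A : set R) : measurable A ->
  pushforward lebesgue_measure ((fun x => x + c) : _ -> measurableTypeR R) A =
  lebesgue_measure A.
Proof.
move=> mA.
have mf : measurable_fun setT ((fun x => x + c) : measurableTypeR R -> measurableTypeR R).
  by apply: continuous_measurable_fun => x; apply: cvgD => //; exact: cvg_cst.
pose m := measure_function_pushforward__canonical__measure_function_Measure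
  (@lebesgue_measure R) mf.
apply/esym; apply: (@lebesgue_measure_unique R m) => //= _ [[a b]] _ <-.
rewrite /m /= /pushforward (_ : _ @^-1` _ = `]a - c, b - c]%classic); last first.
  by apply/seteqP; split => x /=; rewrite !in_itv/= ltrBlDr lerBrDr.
rewrite !lebesgue_measure_itv/= !lte_fin ltrD2r.
by case: ifP => // _; rewrite -!EFinB; congr EFin; ring.
Qed.

Context (N : nat).
Implicit Types (A B : set 'rV[R]_N) (x c : 'rV[R]_N).

Lemma measurable_rV_box (a b : 'I_N -> R) :
  measurable [set x : 'rV[R]_N | forall i, a i <= x ord0 i <= b i].
Proof.
rewrite (_ : [set x | _] = \bigcap_(i in [set: 'I_N])
    (rV_coord i @^-1` `[a i, b i])).
  apply: fin_bigcap_measurable; first exact: finite_finset.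
  move=> i _; have := @measurable_rV_coord R N i measurableT.
  by move=> /(_ _ (measurable_itv `[a i, b i])); rewrite setTI.
apply/seteqP; split => x h i; first by move=> _; rewrite /= in_itv/=; exact: h.
by have := h i I; rewrite /= in_itv/=.
Qed.

(** The sigma-algebra on row vectors is generated by the coordinates, not by the open sets; an open
    set is recovered as the countable union of the boxes with rational centre and radius
    [1 / (k + 1)] that it contains. *)
Lemma open_measurable_rV A : open A -> measurable A.
Proof.
move=> oA.
pose D (p : {ffun 'I_N -> rat} * nat) : set 'rV[R]_N :=
  [set x | forall i, ratr (p.1 i) - p.2.+1%:R^-1 <= x ord0 i <= ratr (p.1 i) + p.2.+1%:R^-1].
rewrite (_ : A = \bigcup_p (if asbool (D p `<=` A) then D p else set0)).
  apply: countable_bigcupT_measurable; first exact: countableP.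
  by move=> p; case: ifPn => // _; exact: measurable_rV_box.
apply/seteqP; split => [x Ax|x [p _]]; last by case: ifPn => // /asboolP; apply.
have [r r0 rA] : exists2 r : R, 0 < r & ball x r `<=` A.
  have /nbhs_ballP[s /= s0 sA] : nbhs x A by exact: open_nbhs_nbhs.
  by exists s.
(* The centre is within [e] of [x] and every point of the box within [e] of the centre, so
   [2 * e < r] keeps the box inside the ball. *)
have [k [e [ek er]]] : exists k (e : R), e = k.+1%:R^-1 /\ e < r / 2.
  have r20 : 0 < r / 2 by rewrite divr_gt0.
  have [k] := ltr_add_invr r20; rewrite add0r => ?.
  by exists k, k.+1%:R^-1.
have e0 : 0 < e by rewrite ek invr_gt0.
have /choice[q Hq] : forall i, exists q : rat, `|x ord0 i - ratr q| < e.
  move=> i; have [|q] := @rat_in_itvoo R (x ord0 i - e) (x ord0 i + e).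
    by lra.
  rewrite in_itv/= => /andP[q1 q2]; exists q.
  by rewrite ltr_norml; apply/andP; split; lra.
exists ([ffun i => q i], k) => //; case: ifPn => [_|/asboolP[]].
  move=> i /=; rewrite ffunE -ek; have := Hq i; rewrite ltr_norml => /andP[? ?].
  by apply/andP; split; lra.
move=> y Dy; apply: rA; rewrite -ball_normE/=.
apply: (@le_lt_trans _ _ (2 * e)); last by lra.
apply/rV_norm_leP; first by lra.
move=> i; have := Dy i; rewrite /= ffunE -ek => /andP[? ?].
have := Hq i; rewrite ltr_norml => /andP[? ?]; rewrite !mxE.
by rewrite ler_norml; apply/andP; split; lra.
Qed.

Lemma closed_measurable_rV A : closed A -> measurable A.
Proof. by move/closed_openC/open_measurable_rV/measurableC; rewrite setCK. Qed.

Lemma continuous_measurable_rV A (f : 'rV[R]_N -> R) : open A ->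
  {in A, continuous f} -> measurable_fun A (f : _ -> measurableTypeR R).
Proof.
move=> oA cf; apply: (measurability _ (RGenOpens.measurableE R)).
move=> _ [_ [a [b ->] <-]].
apply: open_measurable_rV.
by move: cf => /(continuous_inP f oA); apply; exact: interval_open.
Qed.

Lemma bounded_rV A : bounded_set A ->
  exists2 M : R, 0 < M & forall x, A x -> `|x| <= M.
Proof.
move=> [M [Mr H]]; exists (Num.max (M + 1) 1); first by rewrite lt_max ltr01 orbT.
by move=> x; apply: H; rewrite lt_max ltrDl ltr01.
Qed.

Lemma bounded_lebesgue_rV_lty A : measurable A -> bounded_set A ->
  (lebesgue_rV N A < +oo)%E.
Proof.
move=> mA /bounded_rV[M M0 AM].
have MM : - M <= M by lra.
apply: (@le_lt_trans _ _ (lebesgue_rV N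
  [set x : 'rV[R]_N | forall i, (fun=> - M) i <= x ord0 i <= (fun=> M) i])).
  apply: le_measure; rewrite ?inE//; first exact: measurable_rV_box.
  move=> x Ax i /=; rewrite -ler_norml (le_trans (rV_coord_le_norm _ _))//.
  exact: AM.
by rewrite lebesgue_rV_box// ltry.
Qed.

Lemma open_lebesgue_rV_gt0 A : open A -> A !=set0 -> (0 < lebesgue_rV N A)%E.
Proof.
move=> oA [x Ax].
have /nbhs_ballP[r /= r0 rA] : nbhs x A by exact: open_nbhs_nbhs.
pose a i : R := x ord0 i - r / 2; pose b i : R := x ord0 i + r / 2.
have ab i : a i <= b i by rewrite /a /b; lra.
apply: (@lt_le_trans _ _ (lebesgue_rV N
  [set x : 'rV[R]_N | forall i, a i <= x ord0 i <= b i])).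
  rewrite lebesgue_rV_box// lte_fin prodr_gt0// => i _.
  by rewrite /a /b; lra.
apply: le_measure; rewrite ?inE//; first exact: measurable_rV_box.
  exact: open_measurable_rV.
move=> y /= yab; apply: rA; rewrite -ball_normE/=.
apply: (@le_lt_trans _ _ (r / 2)); last by lra.
apply/rV_norm_leP; first lra.
move=> i; have /andP[] := yab i; rewrite !mxE /a /b => ? ?.
by rewrite ler_norml; apply/andP; split; lra.
Qed.

End lebesgue_rV_theory.

Section lebesgue_rV_shift.
Context {R : realType}.

Lemma measurable_shift_rV N (c : 'rV[R]_N) :
  measurable_fun [set: 'rV[R]_N] (fun x : 'rV[R]_N => x + c).
Proof.
apply: measurable_fun_rV => i.
rewrite (_ : _ \o _ = (fun x => rV_coord i x + c ord0 i)).
  by apply: measurable_funD => //; exact: measurable_rV_coord.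
by apply/funext => x /=; rewrite /rV_coord mxE.
Qed.

(** Induction on the dimension: a translation acts on the first coordinate and on the rest
    separately, so the translated product measure agrees with the product on rectangles, and
    uniqueness of product measures concludes. *)
Lemma lebesgue_rV_shift N (c : 'rV[R]_N) (A : set 'rV[R]_N) : measurable A ->
  lebesgue_rV N ((fun x => x + c) @^-1` A) = lebesgue_rV N A.
Proof.
elim: N c A => [|N IH] c A mA.
  congr (lebesgue_rV 0 _); apply/seteqP; split => x /=;
    by rewrite (_ : x + c = x)//; apply/rowP => -[].
pose c' : 'rV[R]_N := \row_j c ord0 (lift ord0 j).
pose T (p : measurableTypeR R * 'rV[R]_N) : measurableTypeR R * 'rV[R]_N :=
  (p.1 + c ord0 ord0, p.2 + c').
have mT : measurable_fun setT T.
  apply/measurable_fun_pair => /=; rewrite /T.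
    by apply: measurable_funD => //; exact: measurable_fst.
  apply: (measurableT_comp (measurable_shift_rV c')); exact: measurable_snd.
have TE p : rV_cons (T p) = rV_cons p + c.
  apply/rowP => i; rewrite [RHS]mxE.
  by have [j ->|->] := unliftP ord0 i;
    rewrite ?rV_consS ?rV_cons0 /T/= ?mxE.
pose m := measure_function_pushforward__canonical__measure_function_Measure
  (@lebesgue_measure R \x lebesgue_rV N)%E mT.
have mB : measurable (@rV_cons R N @^-1` A).
  by rewrite -[X in measurable X]setTI; exact: measurable_rV_cons.
transitivity (m (@rV_cons R N @^-1` A)).
  congr ((lebesgue_measure \x lebesgue_rV N)%E _).
  by apply/seteqP; split => p /=; rewrite TE.
apply/esym; apply: product_measure_unique => // B C mB' mC.
rewrite /m /= /pushforward.
rewrite (_ : T @^-1` _ = ((fun x => x + c ord0 ord0) @^-1` B) `*` ((fun x => x + c') @^-1` C))//.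
rewrite product_measure1E//=; last first.
- by rewrite -[X in measurable X]setTI; exact: measurable_shift_rV.
- rewrite -[X in measurable X]setTI; apply: measurable_funD => //.
by congr (_ * _)%E; [exact: lebesgue_measure_shift|exact: IH].
Qed.

Lemma integrable_rV_shift N (c : 'rV[R]_N) (f : 'rV[R]_N -> R) :
  (lebesgue_rV N).-integrable setT (EFin \o f) ->
  (lebesgue_rV N).-integrable setT (EFin \o (fun x => f (x + c))).
Proof.
move=> /integrableP[mf intf]; apply/integrableP; split.
  by apply: (measurableT_comp mf); exact: measurable_shift_rV.
apply: le_lt_trans intf.
rewrite [leRHS](eq_measure_integral
  (measure_function_pushforward__canonical__measure_function_Measure
    (lebesgue_rV N) (measurable_shift_rV c))); last first.
  by move=> A mA _ /=; rewrite /pushforward lebesgue_rV_shift.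
rewrite ge0_integral_pushforward//.
- exact: measurable_shift_rV.
- exact: measurableT_comp.
Qed.

Lemma Rintegral_rV_shift N (c : 'rV[R]_N) (f : 'rV[R]_N -> R) :
  (lebesgue_rV N).-integrable setT (EFin \o f) ->
  \int[lebesgue_rV N]_x f (x + c) = \int[lebesgue_rV N]_x f x.
Proof.
move=> intf; rewrite /Rintegral; congr fine.
rewrite [RHS](eq_measure_integral
  (measure_function_pushforward__canonical__measure_function_Measure
    (lebesgue_rV N) (measurable_shift_rV c))); last first.
  by move=> A mA _ /=; rewrite /pushforward lebesgue_rV_shift.
rewrite integral_pushforward//.
- exact: measurable_shift_rV.
- by case/integrableP: intf.
- exact: integrable_rV_shift.
Qed.

End lebesgue_rV_shift.

(** * Sup-convolutions *)

Section sup_convolution.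
Context {R : realType} (N : nat).
Implicit Types (F : 'rV[R]_N -> R) (x y w : 'rV[R]_N).

(** Squared Euclidean norm. The norm on row vectors is the maximum norm; the Euclidean square has
    the constant second difference 2 in every coordinate direction. *)
Definition sqn x : R := \sum_(i < N) x ord0 i ^+ 2.

Lemma sqn0 : sqn 0 = 0.
Proof. by rewrite /sqn big1// => i _; rewrite mxE expr0n. Qed.

Lemma norm_le_sqn x : `|x| ^+ 2 <= sqn x.
Proof.
have H : `|x| <= Num.sqrt (sqn x).
  apply/rV_norm_leP => // i; rewrite -sqrtr_sqr ler_wsqrtr//.
  by rewrite /sqn (bigD1 i)//= lerDl sumr_ge0// => j _; exact: sqr_ge0.
rewrite -(@sqr_sqrtr _ (sqn x)) ?sumr_ge0// => [|i _]; last exact: sqr_ge0.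
by rewrite ler_pXn2r// nnegrE.
Qed.

Lemma sqn_ge0 x : 0 <= sqn x.
Proof. by rewrite sumr_ge0// => i _; exact: sqr_ge0. Qed.

Lemma continuous_sqn : continuous sqn.
Proof.
move=> x; rewrite /sqn; apply: (@cvg_big R 'I_N +%R 0 xpredT (@add_continuous R) 'rV[R]_N (nbhs x)
  (index_enum _) (fun i y => y ord0 i ^+ 2) (fun i => x ord0 i ^+ 2)) => i _.
apply: (@continuous_comp _ _ _ (fun y : 'rV[R]_N => y ord0 i) (fun t : R => t ^+ 2)).
  exact: coord_continuous.
exact: exprn_continuous.
Qed.

Lemma sqn_evec x i (s : R) :
  sqn (x + s *: evec i) = sqn x + 2 * s * x ord0 i + s ^+ 2.
Proof.
rewrite /sqn (bigD1 i)//= [in RHS](bigD1 i)//=.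
rewrite (eq_bigr (fun j => x ord0 j ^+ 2)) => [|j ji]; last first.
  by rewrite !mxE (negbTE ji) andbF mulr0 addr0.
by rewrite !mxE !eqxx/=; ring.
Qed.

Lemma diff2_sqn (h : R) i x : h != 0 -> diff2 h i sqn x = 2.
Proof.
move=> h0; rewrite /diff2 -scaleNr !sqn_evec.
by field.
Qed.

(** [G] is the sup-convolution (Moreau envelope) of [F] at scale [d]. The maximiser [Y x] is part of
    the data because discrete Laplacians of [G] at [x] are compared with those of [F] at [Y x]. *)
Definition is_sup_convolution (d : R) F (G : 'rV[R]_N -> R) (Y : 'rV[R]_N -> 'rV[R]_N) :=
  (forall x, G x = F (Y x) - sqn (x - Y x) / (2 * d)) /\
  (forall x w, F w - sqn (x - w) / (2 * d) <= G x).

Lemma ex_sup_convolution (M d : R) F : 0 < d -> continuous F ->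
  (forall x, `|F x| <= M) -> exists G Y, is_sup_convolution d F G Y.
Proof.
move=> d0 cF FM.
have M0 : 0 <= M by rewrite (le_trans _ (FM 0)).
suff /choice[Y HY] : forall x, exists y, forall w,
    F w - sqn (x - w) / (2 * d) <= F y - sqn (x - y) / (2 * d).
  by exists (fun x => F (Y x) - sqn (x - Y x) / (2 * d)), Y.
move=> x.
pose q w := F w - sqn (x - w) / (2 * d).
(* Since [r >= 1], also [r ^+ 2 >= r >= 4 * d * M]; beyond distance [r] the penalty exceeds [2 * M],
   the largest possible gain in [F], so the maximum over the compact ball is global. *)
pose r := 4 * d * M + 1.
have r1 : 1 <= r by rewrite /r lerDr !mulr_ge0// ltW.
pose A := closed_ball x r.
have Ax : A x by apply: closed_ballxx; rewrite (lt_le_trans _ r1).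
have cA : compact A.
  apply: bounded_closed_compact; last exact: closed_ball_closed.
  exists (`|x| + r); split; first exact: num_real.
  move=> M' MM y; rewrite /A closed_ballE ?(lt_le_trans _ r1)// /closed_ball_/= => xy.
  rewrite (le_trans _ (ltW MM))// -[y in `|y|](subrK x) addrC (le_trans (ler_normD _ _))//.
  by rewrite lerD2l distrC.
have cq : continuous q.
  have cs : continuous (fun w => sqn (x - w) / (2 * d)).
    have c1 : continuous (fun w => x - w).
      by move=> w; apply: continuousB; [exact: cst_continuous|].
    have c2 : continuous (fun w => sqn (x - w)).
      by move=> w; apply: (@continuous_comp _ _ _ (fun w => x - w) sqn); [exact: c1|exact:
        continuous_sqn].
    by move=> w; apply: (@continuousM _ _ (fun w => sqn (x - w)) (cst (2 * d)^-1) w); [exact: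
      c2|exact: cst_continuous].
  by move=> w; apply: (@continuousB _ _ _ F (fun w => sqn (x - w) / (2 * d)) w); [exact: cF|exact:
    cs].
have [|||y yA ymax] := @EVT_max_rV R N q A.
- by exists x.
- by [].
- exact: continuous_subspaceT.
exists y => w; have [wA|wA] := pselect (A w).
  by apply: ymax; rewrite inE.
apply: (@le_trans _ _ (q x)); last by apply: ymax; rewrite inE.
rewrite /q subrr sqn0 mul0r subr0.
have : r < `|x - w|.
  rewrite ltNge; apply/negP => xw; apply: wA.
  by rewrite /A closed_ballE ?(lt_le_trans _ r1)//.
move=> rw.
have : 2 * M <= sqn (x - w) / (2 * d).
  rewrite ler_pdivlMr ?mulr_gt0// (le_trans _ (norm_le_sqn _))//.
  apply: (@le_trans _ _ (r ^+ 2)).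
    apply: (@le_trans _ _ r); first by rewrite /r; nra.
    by rewrite expr2 ler_peMr// (le_trans _ r1).
  by rewrite ler_pXn2r ?nnegrE ?(ltW rw)// (le_trans _ r1).
have := FM x; have := FM w; rewrite !ler_norml => /andP[? ?] /andP[? ?] ?.
lra.
Qed.

Section theory.
Variables (M d : R) (F G : 'rV[R]_N -> R) (Y : 'rV[R]_N -> 'rV[R]_N).
Hypotheses (d0 : 0 < d) (FM : forall x, `|F x| <= M).
Hypothesis FGY : is_sup_convolution d F G Y.

Lemma sup_convolution_ge x : F x <= G x.
Proof. by have := FGY.2 x x; rewrite subrr sqn0 mul0r subr0. Qed.

(** The point [x] itself competes without penalty, so the penalty at [Y x] is at most the
    oscillation [2 * M] of [F]. *)
Lemma sup_convolution_dist x : `|x - Y x| ^+ 2 <= 4 * d * M.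
Proof.
apply: le_trans (norm_le_sqn _) _.
have := sup_convolution_ge x; rewrite FGY.1 => H.
have : sqn (x - Y x) / (2 * d) <= 2 * M.
  have := FM x; have := FM (Y x); rewrite !ler_norml => /andP[? ?] /andP[? ?].
  by lra.
by rewrite ler_pdivrMr ?mulr_gt0//; nra.
Qed.

Lemma sup_convolution_le (e r : R) x : 0 < r -> 4 * d * M <= r ^+ 2 ->
  (forall y, `|x - y| <= r -> F y <= F x + e) -> G x <= F x + e.
Proof.
move=> r0 dr H; rewrite FGY.1.
apply: (@le_trans _ _ (F (Y x))).
  by rewrite gerBl divr_ge0// ?sqn_ge0// mulr_ge0// ltW.
apply: H; rewrite -(@ler_pXn2r _ 2)// ?nnegrE//; last exact: ltW.
exact: le_trans (sup_convolution_dist _) dr.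
Qed.

(** The competitor [Y x + c] at [x + c] pays the same penalty as [Y x] at [x]; hence [G] inherits
    the modulus of continuity of [F]. *)
Lemma sup_convolution_shift (e : R) x c :
  (forall y, F y <= F (y + c) + e) -> G x <= G (x + c) + e.
Proof.
move=> H; rewrite FGY.1.
have := FGY.2 (x + c) (Y x + c).
rewrite opprD addrACA subrr addr0 => H1.
by have := H (Y x); lra.
Qed.

Lemma sup_convolution_eq0 (r : R) x : 0 < r -> 4 * d * M <= r ^+ 2 ->
  (forall y, `|x - y| <= r -> F y = 0) -> G x = 0.
Proof.
move=> r0 dr H; have Fx : F x = 0 by apply: H; rewrite subrr normr0 ltW.
apply/eqP; rewrite eq_le -{2}Fx sup_convolution_ge andbT.
rewrite -[leRHS]addr0 -[X in _ <= X + _]Fx.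
by apply: (@sup_convolution_le 0 r) => // y /H ->; rewrite Fx addr0.
Qed.

(** Semiconvexity: with the competitor [Y x] frozen, [G] lies above a paraboloid touching it at [x],
    whose second difference is [- d^-1] in each direction. The bound does not depend on [h]. *)
Lemma sup_convolution_dlap_ge (h : R) x : h != 0 -> - (N%:R / d) <= dlap h G x.
Proof.
move=> h0.
have -> : - (N%:R / d) = \sum_(i < N) (- d^-1).
  by rewrite big_const_ord iter_addr addr0 mulNrn mulr_natl.
apply: ler_sum => i _.
have h20 : 0 < h ^+ 2 by rewrite exprn_even_gt0.
rewrite /diff2 ler_pdivlMr//.
have G1 := FGY.2 (x + h *: evec i) (Y x).
have G2 := FGY.2 (x - h *: evec i) (Y x).
move: G1 G2; rewrite (FGY.1 x).
have := @diff2_sqn h i (x - Y x) h0; rewrite /diff2 => /(congr1 ( *%R^~ (h ^+ 2))).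
have e1 : x + h *: evec i - Y x = x - Y x + h *: evec i by rewrite addrAC.
have e2 : x - h *: evec i - Y x = x - Y x - h *: evec i by rewrite addrAC.
rewrite divfK ?gt_eqF// e1 e2.
set a := sqn _; set b := sqn _; set c := sqn _ => E G1 G2.
have -> : - d^-1 * h ^+ 2 = (- (2 * h ^+ 2)) / (2 * d) by field; rewrite gt_eqF.
rewrite -E.
have -> : - (a + b - 2 * c) / (2 * d) = - (a / (2 * d)) - b / (2 * d) + 2 * (c / (2 * d)).
  by field; rewrite gt_eqF.
lra.
Qed.

(** Here the competitor moves along with the point, so the penalties cancel and only second
    differences of [F] at [Y x] remain. *)
Lemma sup_convolution_dlap (h : R) x : h != 0 -> dlap h F (Y x) <= dlap h G x.
Proof.
move=> h0; apply: ler_sum => i _.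
have h20 : 0 < h ^+ 2 by rewrite exprn_even_gt0.
rewrite /diff2 ler_pM2r ?invr_gt0//.
have := FGY.2 (x + h *: evec i) (Y x + h *: evec i).
have := FGY.2 (x - h *: evec i) (Y x - h *: evec i).
have E (c : 'rV[R]_N) : x + c - (Y x + c) = x - Y x by rewrite opprD addrACA subrr addr0.
rewrite !E => H1 H2.
by rewrite (FGY.1 x); lra.
Qed.

End theory.

End sup_convolution.

(** * Bounded functions with bounded support *)

Section tame_functions.
Context {R : realType} (N : nat).
Local Notation mu := (lebesgue_rV N).
Implicit Types (f g : 'rV[R]_N -> R) (c x y : 'rV[R]_N).

(** A class stable under sums, products, translations and discrete Laplacians, all of whose members
    are integrable; linearity of the integral then needs no further side condition. *)
Definition tame f := measurable_fun [set: 'rV[R]_N] (f : _ -> measurableTypeR R) /\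
  exists r M : R, forall x, `|f x| <= M /\ (r < `|x| -> f x = 0).

Lemma tame_bound f : tame f -> exists2 M : R, 0 <= M & forall x, `|f x| <= M.
Proof.
move=> [_ [r [M H]]]; exists M => [|x]; last by have [] := H x.
by have [/(le_trans (normr_ge0 _))] := H 0.
Qed.

Lemma tame_supp f : tame f -> exists2 r : R, 0 < r & forall x, r < `|x| -> f x = 0.
Proof.
move=> [_ [r [M H]]]; exists (Num.max r 1); first by rewrite lt_max ltr01 orbT.
by move=> x; rewrite gt_max => /andP[/(proj2 (H x))].
Qed.

Lemma tameP f : measurable_fun [set: 'rV[R]_N] (f : _ -> measurableTypeR R) ->
  (exists M : R, forall x, `|f x| <= M) ->
  (exists r : R, forall x, r < `|x| -> f x = 0) -> tame f.
Proof. by move=> mf [M HM] [r Hr]; split => //; exists r, M => x; split => //; exact: Hr. Qed.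

Lemma tame0 : tame (cst 0).
Proof. by apply: tameP => //; [exists 0 => x; rewrite normr0|exists 0]. Qed.

Lemma tameD f g : tame f -> tame g -> tame (fun x => f x + g x).
Proof.
move=> tf tg; have [M M0 HM] := tame_bound tf; have [M' M'0 HM'] := tame_bound tg.
have [r r0 Hr] := tame_supp tf; have [r' r'0 Hr'] := tame_supp tg.
apply: tameP.
- by apply: measurable_funD; [case: tf|case: tg].
- by exists (M + M') => x; rewrite (le_trans (ler_normD _ _))// lerD.
- by exists (Num.max r r') => x; rewrite gt_max => /andP[? ?]; rewrite Hr// Hr'// addr0.
Qed.

Lemma tameM f g : tame f -> measurable_fun [set: 'rV[R]_N] (g : _ -> measurableTypeR R) ->
  (exists M : R, forall x, `|g x| <= M) -> tame (fun x => f x * g x).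
Proof.
move=> tf mg [M' HM']; have [M M0 HM] := tame_bound tf.
have [r r0 Hr] := tame_supp tf.
apply: tameP.
- by apply: measurable_funM => //; case: tf.
- by exists (M * M') => x; rewrite normrM ler_pM.
- by exists r => x ?; rewrite Hr// mul0r.
Qed.

Lemma tameMr f g : tame f -> tame g -> tame (fun x => f x * g x).
Proof.
by move=> tf tg; apply: tameM => //; [case: tg|have [M _ ?] := tame_bound tg; exists M].
Qed.

Lemma tameZ (a : R) f : tame f -> tame (fun x => a * f x).
Proof.
move=> tf; rewrite (_ : (fun x => _) = (fun x => f x * a)); last first.
  by apply/funext => x; rewrite mulrC.
by apply: tameM => //; exists `|a|.
Qed.

Lemma tameN f : tame f -> tame (fun x => - f x).
Proof.
move=> /(@tameZ (-1)); rewrite (_ : (fun x => _) = (fun x => - f x))//.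
by apply/funext => x; rewrite mulN1r.
Qed.

Lemma tameB f g : tame f -> tame g -> tame (fun x => f x - g x).
Proof. by move=> tf /tameN tg; exact: tameD. Qed.

Lemma tame_norm f : tame f -> tame (fun x => `|f x|).
Proof.
move=> tf; have [M M0 HM] := tame_bound tf; have [r r0 Hr] := tame_supp tf.
apply: tameP.
- by apply: (measurableT_comp (@normr_measurable R setT)); case: tf.
- by exists M => x; rewrite normr_id.
- by exists r => x ?; rewrite Hr// normr0.
Qed.

Lemma tame_shift f c : tame f -> tame (fun x => f (x + c)).
Proof.
move=> tf; have [M M0 HM] := tame_bound tf; have [r r0 Hr] := tame_supp tf.
apply: tameP.
- apply: (measurableT_comp (f := f : 'rV[R]_N -> measurableTypeR R)); first by case: tf.
  exact: measurable_shift_rV.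
- by exists M => x.
- exists (r + `|c|) => x rx; apply: Hr.
  by have := ler_normB (x + c) c; rewrite addrK; lra.
Qed.

Lemma tame_diff2 f (h : R) i : tame f -> tame (diff2 h i f).
Proof.
move=> tf; rewrite /diff2.
rewrite (_ : (fun x => _) = (fun x => (h ^+ 2)^-1 *
   (f (x + h *: evec i) + f (x + - (h *: evec i)) - 2 * f x))); last first.
  by apply/funext => x; rewrite mulrC.
apply: tameZ; apply: tameB; last exact: tameZ.
by apply: tameD; exact: tame_shift.
Qed.

Lemma tame_sum (I : Type) (s : seq I) (F : I -> 'rV[R]_N -> R) :
  (forall i, tame (F i)) -> tame (fun x => \sum_(i <- s) F i x).
Proof.
move=> tF; elim: s => [|i s IH].
  by under eq_fun do rewrite big_nil; exact: tame0.
by under eq_fun do rewrite big_cons; exact: tameD.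
Qed.

Lemma tame_dlap f (h : R) : tame f -> tame (dlap h f).
Proof. by move=> tf; apply: tame_sum => i; exact: tame_diff2. Qed.

Lemma continuous_tame f : continuous f ->
  (exists M : R, forall x, `|f x| <= M) ->
  (exists r : R, forall x, r < `|x| -> f x = 0) -> tame f.
Proof.
move=> cf fM fr; apply: tameP => //.
by apply: continuous_measurable_rV; [exact: openT|move=> x _; exact: cf].
Qed.

Lemma measurable_rV_norm_le (r : R) : measurable [set x : 'rV[R]_N | `|x| <= r].
Proof.
apply: closed_measurable_rV.
rewrite (_ : [set _ | _] = (fun x : 'rV[R]_N => `|x|) @^-1` [set t | t <= r])//.
by apply: closed_comp => [x _|]; [exact: norm_continuous|exact: closed_le].
Qed.

Lemma integrable_norm_le_cst (r M : R) :
  mu.-integrable [set: 'rV[R]_N]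
    (EFin \o (fun x => M * \1_[set x : 'rV[R]_N | `|x| <= r] x)).
Proof.
apply: (@integrableZl _ _ _ mu setT measurableT M
  (fun x => (\1_[set x : 'rV[R]_N | `|x| <= r] x)%:E)).
have mA := measurable_rV_norm_le r.
apply/integrableP; split; first by apply/measurable_EFinP; exact: measurable_indic.
rewrite (eq_integral (fun x => (\1_[set x0 : 'rV[R]_N | `|x0| <= r] x)%:E)); last first.
  by move=> x _; rewrite gee0_abs// lee_fin.
rewrite integral_indic// setIT.
apply: bounded_lebesgue_rV_lty => //.
exists r; split; first exact: num_real.
by move=> t rt x /= xr; rewrite (le_trans xr)// ltW.
Qed.

Lemma tame_integrable f : tame f -> mu.-integrable [set: 'rV[R]_N] (EFin \o f).
Proof.
move=> tf; have [M M0 HM] := tame_bound tf; have [r r0 Hr] := tame_supp tf.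
apply: (@le_integrable _ _ _ mu setT measurableT _ _ _ _ (integrable_norm_le_cst r M)).
  by apply/measurable_EFinP; case: tf.
move=> x _ /=; rewrite lee_fin indicE.
have [xr|xr] := leP `|x| r.
  by rewrite mem_set// mulr1 (le_trans (HM x))// ler_norm.
by rewrite (Hr _ xr) normr0 normr_ge0.
Qed.

Lemma tame_le_Rintegral f g : tame f -> tame g -> (forall x, f x <= g x) ->
  \int[mu]_x f x <= \int[mu]_x g x.
Proof.
by move=> tf tg fg; apply: le_Rintegral => //; exact: tame_integrable.
Qed.

Lemma tame_RintegralD f g : tame f -> tame g ->
  \int[mu]_x (f x + g x) = \int[mu]_x f x + \int[mu]_x g x.
Proof. by move=> tf tg; rewrite RintegralD//; exact: tame_integrable. Qed.

Lemma tame_RintegralB f g : tame f -> tame g ->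
  \int[mu]_x (f x - g x) = \int[mu]_x f x - \int[mu]_x g x.
Proof. by move=> tf tg; rewrite RintegralB//; exact: tame_integrable. Qed.

Lemma tame_RintegralZ (a : R) f : tame f ->
  \int[mu]_x (a * f x) = a * \int[mu]_x f x.
Proof. by move=> tf; rewrite RintegralZl//; exact: tame_integrable. Qed.

Lemma tame_Rintegral_sum (I : Type) (s : seq I) (F : I -> 'rV[R]_N -> R) :
  (forall i, tame (F i)) ->
  \int[mu]_x (\sum_(i <- s) F i x) = \sum_(i <- s) \int[mu]_x F i x.
Proof.
move=> tF; elim: s => [|i s IH].
  under eq_Rintegral do rewrite big_nil.
  by rewrite big_nil Rintegral_cst// mul0r.
under eq_Rintegral do rewrite big_cons.
by rewrite big_cons tame_RintegralD ?IH//; exact: tame_sum.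
Qed.

(** Translation invariance moves a shift by [c] from one factor to a shift by [- c] of the other,
    and the symmetric quotient contains both shifts. *)
Lemma tame_dlap_by_parts f g (h : R) : tame f -> tame g ->
  \int[mu]_x (f x * dlap h g x) = \int[mu]_x (g x * dlap h f x).
Proof.
move=> tf tg.
have E (c : 'rV[R]_N) (u v : 'rV[R]_N -> R) : tame u -> tame v ->
    \int[mu]_x (u x * v (x + c)) = \int[mu]_x (v x * u (x - c)).
  move=> tu tv; rewrite -(@Rintegral_rV_shift _ _ (- c) (fun x => u x * v (x + c))).
    by apply: eq_Rintegral => x _; rewrite subrK mulrC.
  by apply: tame_integrable; apply: tameMr => //; exact: tame_shift.
transitivity (\sum_(i < N) \int[mu]_x (f x * diff2 h i g x)).
  rewrite -tame_Rintegral_sum; last by move=> i; apply: tameMr => //; exact: tame_diff2.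
  by apply: eq_Rintegral => x _; rewrite mulr_sumr.
transitivity (\sum_(i < N) \int[mu]_x (g x * diff2 h i f x)); last first.
  rewrite -tame_Rintegral_sum; last by move=> i; apply: tameMr => //; exact: tame_diff2.
  by apply: eq_Rintegral => x _; rewrite mulr_sumr.
apply: eq_bigr => i _.
have D (u v : 'rV[R]_N -> R) : tame u -> tame v ->
  \int[mu]_x (u x * diff2 h i v x) = (h ^+ 2)^-1 *
    (\int[mu]_x (u x * v (x + h *: evec i)) + \int[mu]_x (u x * v (x - h *: evec i))
      - 2 * \int[mu]_x (u x * v x)).
  move=> tu tv.
  have t1 c : tame (fun x => u x * v (x + c)) by apply: tameMr => //; exact: tame_shift.
  have t2 : tame (fun x => u x * v x) by exact: tameMr.
  rewrite -tame_RintegralD// -tame_RintegralZ// -tame_RintegralB//; last 2 first.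
    exact: tameD.
    exact: tameZ.
  rewrite -tame_RintegralZ; last by apply: tameB; [exact: tameD|exact: tameZ].
  by apply: eq_Rintegral => x _; rewrite /diff2; ring.
rewrite (D f g tf tg) (D g f tg tf) (E (h *: evec i) f g tf tg).
rewrite (E (- (h *: evec i)) f g tf tg) opprK.
congr (_ * (_ - 2 * _)); first by rewrite addrC.
by apply: eq_Rintegral => x _; rewrite mulrC.
Qed.

(** Since the integral vanishes, positive and negative parts of a discrete Laplacian have equal
    mass: this is what turns one-sided bounds into bounds in L1 below. *)
Lemma tame_Rintegral_dlap f (h : R) : tame f -> \int[mu]_x dlap h f x = 0.
Proof.
move=> tf.
have E (c : 'rV[R]_N) : \int[mu]_x f (x + c) = \int[mu]_x f x.
  by apply: Rintegral_rV_shift; exact: tame_integrable.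
rewrite /dlap tame_Rintegral_sum; last by move=> i; exact: tame_diff2.
apply: big1 => i _.
transitivity (\int[mu]_x ((h ^+ 2)^-1 *
   (f (x + h *: evec i) + f (x + - (h *: evec i)) - 2 * f x))).
  by apply: eq_Rintegral => x _; rewrite mulrC.
have t1 c : tame (fun x => f (x + c)) by exact: tame_shift.
rewrite tame_RintegralZ; last by apply: tameB; [exact: tameD|exact: tameZ].
rewrite tame_RintegralB; [|exact: tameD|exact: tameZ].
by rewrite tame_RintegralD// tame_RintegralZ// !E; ring.
Qed.

Lemma tame_bounded_convergence (f_ : nat -> 'rV[R]_N -> R) f (r M : R) :
  (forall n, tame (f_ n)) -> tame f ->
  (\forall n \near \oo, forall x, `|f_ n x| <= M /\ (r < `|x| -> f_ n x = 0)) ->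
  (forall x, f_ n x @[n --> \oo] --> f x) ->
  \int[mu]_x f_ n x @[n --> \oo] --> \int[mu]_x f x.
Proof.
move=> tf_ tf [n0 _ Hn0] cf.
(* The uniform bound is assumed only eventually; the sequence is shifted to where it holds. *)
pose g_ n := f_ (n + n0)%N.
rewrite -(cvg_shiftn n0).
have H n x : `|g_ n x| <= M /\ (r < `|x| -> g_ n x = 0).
  by apply: Hn0 => /=; rewrite leq_addl.
have [] := @dominated_convergence _ _ _ mu setT measurableT
  (fun n => EFin \o g_ n) (EFin \o f)
  (EFin \o (fun x => M * \1_[set x : 'rV[R]_N | `|x| <= r] x)).
- by move=> n; apply/measurable_EFinP; case: (tf_ (n + n0)%N).
- by apply/measurable_EFinP; case: tf.
- apply: aeW => x _; apply: cvg_EFin; first exact: nearW.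
  by have := cf x; rewrite -(cvg_shiftn n0).
- exact: integrable_norm_le_cst.
- apply: aeW => x n _ /=; rewrite lee_fin indicE.
  have [H1 H2] := H n x; have [xr|xr] := leP `|x| r.
    by rewrite mem_set// mulr1.
  by rewrite H2// normr0 mulr_ge0// (le_trans _ H1).
move=> intf _ cv.
apply: (@fine_cvg _ _ _ _ (fun n => \int[mu]_x (g_ n x)%:E)%E).
rewrite fineK//; apply: integrable_fin_num => //.
Qed.

End tame_functions.

(** The Heine-Cantor theorem, from the near-covering form of compactness. The space is left general
    since it is applied to sets of points as well as to space-time cylinders. *)
Lemma heine (R : realType) (T : pseudoMetricType R) (K : set T) (f : T -> R) :
  compact K -> {within K, continuous f} -> forall e : R, 0 < e ->
  exists2 d : R, 0 < d & forall x y, K x -> K y -> ball x d y -> `|f x - f y| <= e.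
Proof.
move=> /compact_near_coveringP cK cf e e0.
have [d0 /= d00 H] : \forall d \near 0^'+,
    K `<=` (fun x => K x -> forall y, K y -> ball x d y -> `|f x - f y| <= e).
  apply: (cK R (0^'+) (fun d x => K x -> forall y, K y -> ball x d y -> `|f x - f y| <= e)).
  move=> x Kx.
  have /cvgrPdist_le /(_ (e / 2)) : f @ within K (nbhs x) --> f x.
    by move: cf => /subspace_continuousP; apply.
  rewrite divr_gt0// => /(_ isT); rewrite near_withinE => /nbhs_ballP[r /= r0 H].
  have r20 : 0 < r / 2 by rewrite divr_gt0.
  exists (ball x (r / 2), [set d | d < r / 2]); first split => /=.
  - exact: nbhsx_ballx.
  - exact: nbhs_right_lt.
  move=> [x' d] /= [xx' dr] Kx' y Ky x'y.
  have H1 : `|f x - f x'| <= e / 2.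
    by apply: H => //; apply: le_ball xx'; lra.
  have H2 : `|f x - f y| <= e / 2.
    apply: H => //; rewrite [r]splitr; apply: ball_triangle xx' _.
    by apply: le_ball x'y; exact: ltW.
  rewrite [e]splitr (le_trans _ (lerD H1 H2))// (distrC (f x) (f x')).
  by have := ler_normD (f x' - f x) (f x - f y); rewrite addrA subrK.
have [d dd d0'] : exists2 d, 0 < d & d < d0.
  by exists (d0 / 2); lra.
exists d => // x y Kx Ky xy.
by apply: (H d _ dd) => //=; rewrite ?sub0r ?normrN ?gtr0_norm.
Qed.

(** * Extension by zero outside the domain, and interior parallel sets *)

Section zero_extension.
Context {R : realType} (N : nat).
Local Notation mu := (lebesgue_rV N).
Variable Omega : set 'rV[R]_N.
Hypotheses (oO : open Omega) (bO : bounded_set Omega).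
Implicit Types (f g Z V G : 'rV[R]_N -> R) (c x y : 'rV[R]_N).

Definition ucont f := forall e : R, 0 < e -> exists2 d : R, 0 < d &
  forall x y, `|x - y| <= d -> `|f x - f y| <= e.

Lemma ucontN f : ucont f -> ucont (fun x => - f x).
Proof.
move=> uf e /uf[d d0 H]; exists d => // x y /H.
by rewrite -opprD normrN.
Qed.

Lemma ucont_continuous f : ucont f -> continuous f.
Proof.
move=> uf x; apply/(@cvgrPdist_le _ _ _ (nbhs x)) => e /uf[d d0 H].
by apply/nbhs_ballP; exists d => // y; rewrite -ball_normE/= => /ltW; exact: H.
Qed.

Lemma compact_closure_bounded : compact (closure Omega).
Proof.
apply: bounded_closed_compact; last exact: closed_closure.
have [M M0 HM] := bounded_rV bO.
exists M; split; first exact: num_real.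
move=> M' MM x /= Ox; rewrite (le_trans _ (ltW MM))//.
have : closed [set x : 'rV[R]_N | `|x| <= M].
  rewrite (_ : [set _ | _] = (fun x : 'rV[R]_N => `|x|) @^-1` [set t | t <= M])//.
  by apply: closed_comp => [y _|]; [exact: norm_continuous|exact: closed_le].
move=> /closure_id E.
have : closure [set x : 'rV[R]_N | `|x| <= M] x.
  by apply: closure_subset Ox => y; exact: HM.
by rewrite -E.
Qed.

Lemma ucont_continuous_supp f : continuous f -> (forall x, ~ Omega x -> f x = 0) -> ucont f.
Proof.
move=> cf f0 e e0.
have [M M0 HM] := bounded_rV bO.
pose K := closed_ball (0 : 'rV[R]_N) (M + 1).
have M10 : 0 < M + 1 by lra.
have KE x : K x <-> `|x| <= M + 1.
  by rewrite /K closed_ballE// /closed_ball_/= sub0r normrN.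
have cK : compact K.
  apply: bounded_closed_compact; last exact: closed_ball_closed.
  exists (M + 1); split; first exact: num_real.
  by move=> M1 MM x /KE xM; exact: le_trans xM (ltW MM).
have [d d0 Hd] := heine cK (continuous_subspaceT cf) e0.
(* The cap at 1 means that if one of two close points leaves the ball of radius [M + 1], then both
   lie outside [Omega], where [f] vanishes. *)
pose d' := Num.min (d / 2) 1.
have d'0 : 0 < d' by rewrite lt_min divr_gt0//=.
exists d' => // x y; rewrite le_min => /andP[xyd xy1].
have [Kx|Kx] := pselect (K x); have [Ky|Ky] := pselect (K y).
- apply: Hd => //; rewrite -ball_normE/= (le_lt_trans xyd)//.
  by lra.
- move/KE: Kx => Kx; move/KE/negP: Ky; rewrite -ltNge => Ky.
  rewrite !f0 ?subrr ?normr0 ?ltW//.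
    by move=> /HM; lra.
  by move=> /HM; have := ler_normB x (x - y); rewrite opprB addrC subrK; lra.
- move/KE: Ky => Ky; move/KE/negP: Kx; rewrite -ltNge => Kx.
  rewrite !f0 ?subrr ?normr0 ?ltW//.
    by move=> /HM; have := ler_normD (x - y) y; rewrite subrK; lra.
  by move=> /HM; lra.
- move/KE/negP: Kx; move/KE/negP: Ky; rewrite -!ltNge => Ky Kx.
  by rewrite !f0 ?subrr ?normr0 ?ltW//; move=> /HM; lra.
Qed.

Lemma ucont_bounded f : ucont f -> (forall x, ~ Omega x -> f x = 0) ->
  exists2 M : R, 0 < M & forall x, `|f x| <= M.
Proof.
move=> /ucont_continuous cf f0.
have /compact_bounded[M [_ HM]] : compact (f @` closure Omega).
  by apply: continuous_compact; [exact: continuous_subspaceT|exact: compact_closure_bounded].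
exists (Num.max M 0 + 1); first by rewrite ltr_wpDl// le_max lexx orbT.
move=> x; have [Ox|/f0->] := pselect (Omega x); last first.
  by rewrite normr0 addr_ge0// le_max lexx orbT.
apply: HM; first by rewrite ltr_pwDr// le_max lexx.
by exists x => //; exact: subset_closure.
Qed.

Lemma ucont_tame f : ucont f -> (forall x, ~ Omega x -> f x = 0) -> tame f.
Proof.
move=> uf f0; apply: continuous_tame; first exact: ucont_continuous.
  by have [M _ HM] := ucont_bounded uf f0; exists M.
have [M _ HM] := bounded_rV bO; exists M => x Mx; apply: f0 => /HM.
by rewrite leNgt Mx.
Qed.

Definition zext f x := if asbool (Omega x) then f x else 0.

Lemma zextE f x : Omega x -> zext f x = f x.
Proof. by move=> Ox; rewrite /zext; case: ifPn => // /asboolP. Qed.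

Lemma zext0 f x : ~ Omega x -> zext f x = 0.
Proof. by move=> Ox; rewrite /zext; case: ifPn => // /asboolP. Qed.

Lemma continuous_zext f : {within closure Omega, continuous f} ->
  (forall x, bnd Omega x -> f x = 0) -> continuous (zext f).
Proof.
move=> cf f0 x; have [Ox|Ox] := pselect (Omega x).
  have nO : nbhs x Omega by exact: open_nbhs_nbhs.
  rewrite /continuous_at zextE//.
  apply/(@cvgrPdist_le _ _ _ (nbhs x)) => e e0.
  have /subspace_continuousP/(_ _ (subset_closure Ox))/cvgrPdist_le/(_ _ e0) := cf.
  rewrite near_withinE => H; near=> y.
  have Oy : Omega y by near: y.
  by rewrite zextE//; apply: (near H y) => //; exact: subset_closure.
rewrite /continuous_at (zext0 _ Ox).
apply/(@cvgrPdist_le _ _ _ (nbhs x)) => e e0.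
have [cx|cx] := pselect (closure Omega x); last first.
  have nO : nbhs x (~` closure Omega).
    by apply: open_nbhs_nbhs; split => //; apply: closed_openC; exact: closed_closure.
  near=> y; rewrite zext0 ?subrr ?oppr0 ?normr0 ?ltW//.
  have : (~` closure Omega) y by near: y.
  by apply: contra_not; exact: subset_closure.
have fx : f x = 0 by apply: f0.
have /subspace_continuousP/(_ _ cx)/cvgrPdist_le/(_ _ e0) := cf.
rewrite near_withinE => H; near=> y.
have [Oy|Oy] := pselect (Omega y); last by rewrite zext0// subrr normr0 ltW.
rewrite zextE// -fx; apply: (near H y) => //; exact: subset_closure.
Unshelve. all: end_near. Qed.

Definition inner (rho : R) x := forall y, `|x - y| <= rho -> Omega y.

Lemma inner_in rho x : 0 <= rho -> inner rho x -> Omega x.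
Proof. by move=> r0; apply; rewrite subrr normr0. Qed.

(** A point within [d] of the complement has [|f x| <= e / 2], so the set where [|f|] reaches [e]
    keeps a fixed distance from the complement. Truncation at height [e] thereby produces supports
    well inside [Omega]. *)
Lemma ucont_inner f : ucont f -> (forall x, ~ Omega x -> f x = 0) ->
  forall e, 0 < e -> exists2 rho : R, 0 < rho & forall x, e <= `|f x| -> inner rho x.
Proof.
move=> uf f0 e e0; have /uf[d d0 H] : 0 < e / 2 by rewrite divr_gt0.
exists d => // x ex y /H; have [//|/f0->] := pselect (Omega y).
by rewrite subr0 => /(le_trans ex); rewrite ler_pdivlMr// ger_pMr// lern1.
Qed.

End zero_extension.

(** * Green's identity *)

Section soft_threshold.
Context {R : realType}.
Implicit Types (k a b t : R).

(** Soft thresholding: for [k >= 0], the odd 1-Lipschitz map that sends [[-k, k]] to 0 and moves all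
    other values by [k] towards 0. *)
Definition soft k t : R := Num.max (t - k) 0 - Num.max (- t - k) 0.

Lemma soft_dist k t : 0 <= k -> `|soft k t - t| <= k.
Proof.
move=> k0; rewrite /soft ler_norml.
by case: (leP (t - k) 0) => ?; case: (leP (- t - k) 0) => ?; apply/andP; split; lra.
Qed.

Lemma soft_lipschitz k a b : 0 <= k -> `|soft k a - soft k b| <= `|a - b|.
Proof.
move=> k0; rewrite /soft ler_norml.
have := ler_norm (a - b); have := ler_norm (- (a - b)); rewrite normrN.
by case: (leP (a - k) 0) => ?; case: (leP (- a - k) 0) => ?;
  case: (leP (b - k) 0) => ?; case: (leP (- b - k) 0) => ?; move=> ? ?; apply/andP; split; lra.
Qed.

Lemma soft_neq0 k t : soft k t != 0 -> k <= `|t|.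
Proof.
rewrite /soft; have := ler_norm t; have := ler_norm (- t); rewrite normrN.
by case: (leP (t - k) 0) => ?; case: (leP (- t - k) 0) => ?; rewrite ?subrr ?eqxx//; lra.
Qed.

Lemma soft0 k : soft k 0 = 0.
Proof. by rewrite /soft oppr0 sub0r subrr. Qed.

End soft_threshold.

Lemma sup_convolution_ucont (R : realType) (N : nat) (d : R) (F G : 'rV[R]_N -> R)
  (Y : 'rV[R]_N -> 'rV[R]_N) : is_sup_convolution d F G Y -> ucont F -> ucont G.
Proof.
move=> GY uF e e0; have [d' d'0 Hd'] := uF _ e0; exists d' => // x y xy.
have H u v : `|u - v| <= d' -> G u <= G v + e.
  move=> uv; rewrite -{1}(subrK u v) (addrC _ u).
  apply: (sup_convolution_shift GY) => t.
  have := Hd' t (t + (v - u)); rewrite opprD addNKr normrN distrC => /(_ uv).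
  by rewrite ler_norml => /andP[? ?]; lra.
have H1 := H x y xy; have H2 := H y x; rewrite distrC in H2.
by rewrite ler_norml; have := H2 xy; move=> ?; apply/andP; split; lra.
Qed.

Section green.
Context {R : realType} (N : nat).
Local Notation mu := (lebesgue_rV N).
Variable Omega : set 'rV[R]_N.
Hypothesis bO : bounded_set Omega.
Implicit Types (f g Z V G P : 'rV[R]_N -> R) (c x y : 'rV[R]_N).

Let hn (n : nat) : R := n.+1%:R^-1.

Let hn_gt0 n : 0 < hn n. Proof. by rewrite invr_gt0. Qed.

Let hn_le (r : R) : 0 < r -> \forall n \near \oo, hn n <= r.
Proof. by move=> r0; near=> n; apply: ltW; near: n; exact: near_infty_natSinv_lt (PosNum r0).
  Unshelve. all: end_near. Qed.

(** A notion of [g] being the Laplacian of [Z] that keeps just what Green's identity consumes and is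
    stable under negation. The modulus of continuity of [g] concerns pairs of points of [Omega]
    only, because [g] is extended by zero and may jump at the boundary. *)
Record lap_on Z g : Prop := LapOn {
  lap_ucont : ucont Z;
  lap_out : forall x, ~ Omega x -> Z x = 0;
  lap_tame : tame g;
  lap_unif : forall e : R, 0 < e -> exists2 d : R, 0 < d &
    forall x y, Omega x -> Omega y -> `|x - y| <= d -> `|g x - g y| <= e;
  lap_cvg : forall x, Omega x -> dlap (hn n) Z x @[n --> \oo] --> g x }.

Lemma dlapN (h : R) f x : dlap h (fun y => - f y) x = - dlap h f x.
Proof.
by rewrite /dlap -sumrN; apply: eq_bigr => i _; rewrite /diff2; ring.
Qed.

Lemma lap_onN Z g : lap_on Z g -> lap_on (fun x => - Z x) (fun x => - g x).
Proof.
case=> u o t f c; split.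
- exact: ucontN.
- by move=> x /o ->; rewrite oppr0.
- exact: tameN.
- move=> e /f[d d0 H]; exists d => // x y Ox Oy /(H _ _ Ox Oy).
  by rewrite -opprD normrN.
- move=> x /c H; under eq_fun do rewrite dlapN.
  exact: cvgN.
Qed.

Lemma lap_tameZ Z g : lap_on Z g -> tame Z.
Proof. by case=> u o _ _ _; exact: (ucont_tame bO). Qed.

Lemma tame_indic_le (r : R) : tame (\1_[set x : 'rV[R]_N | `|x| <= r] : _ -> R).
Proof.
apply: tameP.
- by apply: measurable_indic; exact: measurable_rV_norm_le.
- by exists 1 => x; rewrite indicE; case: (_ \in _); rewrite ?normr1 ?normr0.
- exists r => x xr; rewrite indicE memNset//=; apply/negP; by rewrite -ltNge.
Qed.

(** Soft thresholding pulls the support inside [Omega] and a sup-convolution adds semiconvexity. The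
    discrete Laplacian then has a uniform lower bound and integral zero, hence a bound in L1 uniform
    in the step. Half of [w] is spent on each operation. *)
Lemma semiconvex_approx Z : ucont Z -> (forall x, ~ Omega x -> Z x = 0) ->
  forall w : R, 0 < w -> exists zeta C rho,
    [/\ 0 < rho, forall x, `|zeta x - Z x| <= w, tame zeta,
       forall x, zeta x != 0 -> inner Omega rho x &
       forall h : R, 0 < h -> h <= 1 -> \int[mu]_x `|dlap h zeta x| <= C].
Proof.
move=> uZ Z0 w w0.
have [w2 [w20 w2E]] : exists w2 : R, 0 < w2 /\ w = w2 + w2 by exists (w / 2); lra.
pose Zk x := soft w2 (Z x).
have uZk : ucont Zk.
  move=> e /uZ[d d0 H]; exists d => // x y /H; apply: le_trans.
  exact: soft_lipschitz (ltW w20).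
have Zk0 x : ~ Omega x -> Zk x = 0 by move=> /Z0 E; rewrite /Zk E soft0.
have [M M0 HM] := ucont_bounded bO uZk Zk0.
have [d d0 Hd] := uZk _ w20.
have [r1 r10 Hr1] := ucont_inner uZ Z0 w20.
have [r [r0 rd rr1]] : exists r : R, [/\ 0 < r, r <= d & r <= r1 / 2].
  exists (Num.min d (r1 / 2)); split; last 2 first.
  - by rewrite ge_min lexx.
  - by rewrite ge_min lexx orbT.
  - by rewrite lt_min d0 divr_gt0.
(* Scale at which maximisers stay within distance [r]: [4 * del * M = r ^+ 2]. *)
pose del := r ^+ 2 / (4 * M).
have del0 : 0 < del by rewrite divr_gt0 ?exprn_gt0 ?mulr_gt0.
have delE : 4 * del * M <= r ^+ 2.
  by rewrite /del le_eqVlt; apply/orP; left; apply/eqP; field; rewrite gt_eqF.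
have [G [Y GY]] := ex_sup_convolution del0 (ucont_continuous uZk) HM.
have GZk x : Zk x <= G x <= Zk x + w2.
  rewrite (sup_convolution_ge GY)/=.
  apply: (sup_convolution_le del0 HM GY r0 delE) => y xy.
  by have := Hd x y (le_trans xy rd); rewrite ler_norml => /andP[? ?]; lra.
(* If [G x] is nonzero, some [y] within [r <= r1 / 2] of [x] has [Zk y != 0]; a point within
   [r1 / 2] of [x] is then within [r1] of [y], hence in [Omega]. *)
have G0 x : G x != 0 -> inner Omega (r1 / 2) x.
  move=> Gx; have [//|nin] := pselect (inner Omega (r1 / 2) x).
  exfalso; move/eqP: Gx; apply.
  apply: (sup_convolution_eq0 del0 HM GY r0 delE) => y xy.
  apply/eqP; apply: contra_notT nin => Zky u xu.
  apply: (Hr1 y (soft_neq0 Zky)).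
  have := ler_normD (y - x) (x - u); rewrite addrA subrK (distrC y x).
  by lra.
have G0' x : ~ Omega x -> G x = 0.
  move=> Ox; apply/eqP; apply: contra_notT Ox => /G0.
  by apply: inner_in; rewrite divr_ge0// ltW.
have uG : ucont G by exact: sup_convolution_ucont GY uZk.
have tG : tame G by exact: (ucont_tame bO).
have [MO MO0 HMO] := bounded_rV bO.
(* From [a >= - N / del] follows [|a| <= a + 2 * N / del], and [a = dlap h G] integrates to zero.
   The radius [MO + 1] contains the support of [dlap h G] for every [h <= 1]. *)
pose C := 2 * (N%:R / del) * \int[mu]_x (\1_[set x : 'rV[R]_N | `|x| <= MO + 1] x : R).
exists G, C, (r1 / 2); split => //.
- by rewrite divr_gt0.
- move=> x; have := soft_dist (Z x) (ltW w20); rewrite -/(Zk x).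
  have /andP[? ?] := GZk x.
  by rewrite !ler_norml => /andP[? ?]; apply/andP; split; lra.
move=> h h0 h1.
have ti := tame_indic_le (MO + 1).
have tl := tame_dlap h tG.
rewrite /C -tame_RintegralZ// -[leRHS]add0r -(tame_Rintegral_dlap h tG).
rewrite -tame_RintegralD//; last exact: tameZ.
apply: tame_le_Rintegral.
- exact: tame_norm.
- by apply: tameD => //; exact: tameZ.
move=> x; rewrite indicE.
have := sup_convolution_dlap_ge del0 GY x (lt0r_neq0 h0).
have [xM|xM] := leP `|x| (MO + 1).
  rewrite mem_set//= mulr1 => H; have N0 : 0 <= N%:R / del by rewrite divr_ge0// ltW.
  by rewrite ler_norml; apply/andP; split; lra.
rewrite memNset//=; last by apply/negP; rewrite -ltNge.
move=> _; rewrite mulr0 addr0 (_ : dlap h G x = 0) ?normr0//.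
rewrite /dlap big1// => i _; rewrite /diff2 !G0' ?mulr0 ?addr0 ?subr0 ?mul0r//.
- by move=> /HMO; lra.
- move=> /HMO; have := ler_normD (x - h *: evec i) (h *: evec i).
  by rewrite subrK; have := evec_norm i h; rewrite gtr0_norm//; lra.
- move=> /HMO; have := ler_normB (x + h *: evec i) (h *: evec i).
  by rewrite addrK; have := evec_norm i h; rewrite gtr0_norm//; lra.
Qed.

(** A Fatou argument: [dlap h G x] is at least [dlap h Z (Y x)], which tends to [g (Y x)], close to
    [g x]; the semiconvexity bound provides the minorant. The sign of [P] makes the one-sided
    information integrable. *)
Lemma sup_convolution_lower Z g P (rho w : R) : lap_on Z g -> tame P ->
  (forall x, 0 <= P x) -> 0 < rho -> (forall x, P x != 0 -> inner Omega rho x) ->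
  0 < w -> exists G, [/\ tame G, forall x, `|G x - Z x| <= w &
    \forall n \near \oo, \int[mu]_x (P x * g x) - w <= \int[mu]_x (P x * dlap (hn n) G x)].
Proof.
move=> [uZ Z0 tg gu gc] tP P0 rho0 PO w0.
have [Mg Mg0 HMg] := tame_bound tg; have [MP MP0 HMP] := tame_bound tP.
have [rP rP0 HrP] := tame_supp tP.
pose IP := \int[mu]_x P x.
have IP0 : 0 <= IP by exact: Rintegral_ge0.
(* The pointwise loss [2 * w'] integrates against [P] to at most [w / 2]; the other half of [w] pays
   for the convergence in [n]. *)
pose w' := w / (4 * (IP + 1)).
have w'0 : 0 < w' by rewrite divr_gt0// mulr_gt0// ltr_wpDl.
have w'E : 2 * w' * IP <= w / 2.
  rewrite /w' (_ : 2 * _ * IP = (w / 2) * (IP / (IP + 1))); last first.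
    by field; rewrite gt_eqF// ltr_wpDl.
  have IP1 : 0 < IP + 1 by rewrite ltr_wpDl.
  apply: ler_piMr; first by rewrite divr_ge0// ltW.
  by rewrite ler_pdivrMr// mul1r lerDl.
have [M M0 HM] := ucont_bounded bO uZ Z0.
have [d d0 Hd] := uZ _ w0.
have [d' d'0 Hd'] := gu _ w'0.
have [r [r0 rd rd' rr1]] : exists r : R, [/\ 0 < r, r <= d, r <= d' & r <= rho].
  exists (Num.min d (Num.min d' rho)); split.
  - by rewrite !lt_min d0 d'0.
  - by rewrite ge_min lexx.
  - by rewrite !ge_min lexx orbT.
  - by rewrite !ge_min lexx !orbT.
pose del := r ^+ 2 / (4 * M).
have del0 : 0 < del by rewrite divr_gt0 ?exprn_gt0 ?mulr_gt0.
have delE : 4 * del * M = r ^+ 2 by rewrite /del; field; rewrite gt_eqF.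
have [G [Y GY]] := ex_sup_convolution del0 (ucont_continuous uZ) HM.
have GZ x : Z x <= G x <= Z x + w.
  rewrite (sup_convolution_ge GY)/=.
  apply: (sup_convolution_le del0 HM GY r0); first by rewrite delE.
  move=> y xy.
  by have := Hd x y (le_trans xy rd); rewrite ler_norml => /andP[? ?]; lra.
have uG : ucont G by exact: sup_convolution_ucont GY uZ.
have [MO MO0 HMO] := bounded_rV bO.
have tG : tame G.
  apply: continuous_tame; first exact: ucont_continuous.
    exists (M + w) => x; have := HM x; rewrite !ler_norml => /andP[? ?].
    by have /andP[? ?] := GZ x; apply/andP; split; lra.
  exists (MO + r) => x xM.
  apply: (sup_convolution_eq0 del0 HM GY r0); first by rewrite delE.
  move=> y xy; apply: Z0 => /HMO yM.
  by have := ler_normD (x - y) y; rewrite subrK; lra.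
(* Cutting from above makes the sequence bounded on both sides. Where [P] is nonzero it is
   eventually equal to [g x - 2 * w']: one [w'] for passing from [g x] to [g (Y x)], one for the
   convergence of [dlap (hn n) Z] at [Y x]. *)
pose b n x := Num.min (dlap (hn n) G x) (g x - 2 * w').
have tgw : measurable_fun [set: 'rV[R]_N] ((fun x => g x - 2 * w') : _ -> measurableTypeR R).
  by apply: measurable_funB => //; case: tg.
have tb n : tame (fun x => P x * b n x).
  apply: tameM => //.
    by apply: measurable_minr => //; case: (tame_dlap (hn n) tG).
  have [ML ML0 HML] := tame_bound (tame_dlap (hn n) tG).
  exists (ML + Mg + 2 * w') => x; rewrite /b.
  have := HML x; have := HMg x; rewrite !ler_norml => /andP[? ?] /andP[? ?].
  by case: (leP (dlap (hn n) G x)) => ?; apply/andP; split; lra.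
have tf : tame (fun x => P x * (g x - 2 * w')).
  apply: tameM => //; exists (Mg + 2 * w') => x.
  by have := HMg x; rewrite !ler_norml => /andP[? ?]; apply/andP; split; lra.
have cvb : \int[mu]_x (P x * b n x) @[n --> \oo] --> \int[mu]_x (P x * (g x - 2 * w')).
  apply: (@tame_bounded_convergence _ _ _ _ rP (MP * (N%:R / del + Mg + 2 * w'))) => //.
    apply: nearW => n x; split; last by move=> /HrP ->; rewrite mul0r.
    rewrite normrM ler_pM//.
    have N0 : 0 <= N%:R / del by rewrite divr_ge0// ltW.
    have := sup_convolution_dlap_ge del0 GY x (lt0r_neq0 (hn_gt0 n)).
    have := HMg x; rewrite !ler_norml /b => /andP[? ?] ?.
    by case: (leP (dlap (hn n) G x)) => ?; apply/andP; split; lra.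
  move=> x; have [->|Px] := eqVneq (P x) 0.
    by under eq_fun do rewrite mul0r; rewrite mul0r; exact: cvg_cst.
  apply: (@cvg_trans _ ((fun n => P x * (g x - 2 * w')) @ \oo)); last exact: cvg_cst.
  apply: near_eq_cvg.
  have xin := PO x Px.
  have xY : `|x - Y x| <= r.
    rewrite -(@ler_pXn2r _ 2)// ?nnegrE//; last exact: ltW.
    by rewrite -delE; exact: (sup_convolution_dist del0 HM GY).
  have OY : Omega (Y x) by apply: xin; exact: le_trans xY rr1.
  have Ox : Omega x by exact: inner_in (ltW rho0) xin.
  have gxy := Hd' x (Y x) Ox OY (le_trans xY rd').
  have /cvgrPdist_le/(_ _ w'0) := gc _ OY.
  apply: filterS => n Hn; congr (_ * _); rewrite /b; apply/esym/min_idPr.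
  have := sup_convolution_dlap GY x (lt0r_neq0 (hn_gt0 n)).
  by move: Hn gxy; rewrite !ler_norml => /andP[? ?] /andP[? ?]; lra.
exists G; split => //.
  move=> x; have /andP[? ?] := GZ x.
  by rewrite ler_norml; apply/andP; split; lra.
have tPg : tame (fun x => P x * g x) by exact: tameMr.
have Elim : \int[mu]_x (P x * (g x - 2 * w')) = \int[mu]_x (P x * g x) - 2 * w' * IP.
  rewrite /IP -tame_RintegralZ// -tame_RintegralB//; last exact: tameZ.
  by apply: eq_Rintegral => x _; ring.
have w20 : 0 < w / 2 by rewrite divr_gt0.
move/cvgrPdist_le : cvb => /(_ _ w20); apply: filterS => n.
rewrite Elim ler_norml => /andP[? ?].
apply: (@le_trans _ _ (\int[mu]_x (P x * b n x))); first lra.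
apply: tame_le_Rintegral => //.
  by apply: tameMr => //; exact: tame_dlap.
by move=> x; rewrite ler_wpM2l// /b ge_min lexx.
Qed.

(** The two-sided domination available for a C^2 eigenfunction; it allows bounded convergence
    against test functions supported in [inner Omega rho]. *)
Definition dlap_locally_bounded V := forall rho : R, 0 < rho -> exists C r : R, 0 < r /\
  forall x, inner Omega rho x -> forall h : R, 0 < h -> h <= r -> `|dlap h V x| <= C.

Lemma dlap_locally_boundedN V : dlap_locally_bounded V ->
  dlap_locally_bounded (fun x => - V x).
Proof.
move=> H rho /H[C [r [r0 {}H]]]; exists C, r; split => // x xi h h0 hr.
by rewrite dlapN normrN; exact: H.
Qed.

Lemma Rintegral_dlap_cvg zeta V l (rho : R) : lap_on V l -> dlap_locally_bounded V ->
  tame zeta -> 0 < rho -> (forall x, zeta x != 0 -> inner Omega rho x) ->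
  \int[mu]_x (zeta x * dlap (hn n) V x) @[n --> \oo] --> \int[mu]_x (zeta x * l x).
Proof.
move=> VL /[dup] bV /(_ rho) + tz rho0 zO => /(_ rho0)[C [r [r0 Hr]]].
have [M M0 HM] := tame_bound tz; have [rz rz0 Hrz] := tame_supp tz.
have tV := lap_tameZ VL; have tl := lap_tame VL.
apply: (@tame_bounded_convergence _ _ _ _ rz (M * Num.max C 0)).
- by move=> n; apply: tameMr => //; exact: tame_dlap.
- exact: tameMr.
- near=> n => x; split; last by move=> /Hrz ->; rewrite mul0r.
  have [->|zx] := eqVneq (zeta x) 0.
    by rewrite mul0r normr0 mulr_ge0// le_max lexx orbT.
  rewrite normrM ler_pM// le_max (Hr x (zO x zx))//.
  by near: n; exact: hn_le.
- move=> x; have [->|zx] := eqVneq (zeta x) 0.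
    by under eq_fun do rewrite mul0r; rewrite mul0r; exact: cvg_cst.
  apply: cvgM; first exact: cvg_cst.
  by apply: (lap_cvg VL); exact: inner_in (ltW rho0) (zO x zx).
Unshelve. all: end_near. Qed.

End green.

Section green_identity.
Context {R : realType} (N : nat).
Local Notation mu := (lebesgue_rV N).
Variable Omega : set 'rV[R]_N.
Hypothesis bO : bounded_set Omega.
Implicit Types (f g Z V G P : 'rV[R]_N -> R) (c x y : 'rV[R]_N).

Let hn (n : nat) : R := n.+1%:R^-1.

Let hn_gt0 n : 0 < hn n. Proof. by rewrite invr_gt0. Qed.

Lemma measurable_gt_set f (e : R) : continuous f -> measurable [set x | e < f x].
Proof.
move=> cf; apply: open_measurable_rV.
rewrite (_ : [set x | e < f x] = f @^-1` [set t | e < t])//.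
by apply: open_comp => [x _|]; [exact: cf|exact: open_gt].
Qed.

Lemma tame_trunc V (e : R) : tame V -> 0 < e -> tame (fun x => Num.max (V x - e) 0).
Proof.
move=> tV e0; have [M M0 HM] := tame_bound tV; have [r r0 Hr] := tame_supp tV.
apply: tameP.
- apply: measurable_maxr => //.
  by apply: measurable_funB => //; case: tV.
- exists M => x; have := HM x; rewrite !ler_norml.
  by case: (leP (V x - e)) => ? /andP[? ?]; apply/andP; split; lra.
- by exists r => x /Hr ->; apply/max_idPr; lra.
Qed.

(** A discrete Kato inequality. Where [V x <= e] the truncation has a minimum with value 0, so its
    discrete Laplacian is nonnegative; where [V x > e] it touches [V - e] from above, so its
    discrete Laplacian dominates that of [V]. Negative parts therefore come only from [V] on the set
    [e < V]. *)
Lemma trunc_dlap_ge V (e h : R) x : h != 0 ->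
  `|dlap h (fun y => Num.max (V y - e) 0) x| <=
  dlap h (fun y => Num.max (V y - e) 0) x +
    2 * (\1_[set y | e < V y] x * `|dlap h V x|).
Proof.
move=> h0; set P := fun y => _.
have P0 y : 0 <= P y by rewrite /P le_max lexx orbT.
have PV y : V y - e <= P y by rewrite /P le_max lexx.
have h20 : 0 < (h ^+ 2)^-1 by rewrite invr_gt0 exprn_even_gt0.
rewrite indicE; have [eV|eV] := ltP e (V x).
  rewrite mem_set// mul1r.
  have PxE : P x = V x - e by apply/max_idPl; rewrite subr_ge0 ltW.
  have : dlap h V x <= dlap h P x.
    apply: ler_sum => i _; rewrite /diff2 ler_pM2r// PxE.
    by have := PV (x + h *: evec i); have := PV (x - h *: evec i); lra.
  move: (dlap h V x) (dlap h P x) => a b ab.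
  have := ler_norm (- a); rewrite normrN; have := normr_ge0 a => ? ?.
  by rewrite ler_norml; apply/andP; split; lra.
rewrite memNset//=; last by apply/negP; rewrite -leNgt.
rewrite mul0r mulr0 addr0 ger0_norm//.
apply: sumr_ge0 => i _; rewrite /diff2; apply: mulr_ge0; last exact: ltW.
have PxE : P x = 0 by apply/max_idPr; rewrite subr_le0.
by rewrite PxE mulr0 subr0 addr_ge0.
Qed.

(** The discrete Laplacian of the truncation integrates to zero, and its negative part is controlled
    by [V] on a set well inside [Omega], where bounded convergence applies. The resulting bound does
    not depend on [e], although the threshold in [n] does. *)
Lemma trunc_dlap_L1 V l (e : R) : lap_on Omega V l -> dlap_locally_bounded Omega V ->
  0 < e -> \forall n \near \oo,
    \int[mu]_x `|dlap (hn n) (fun y => Num.max (V y - e) 0) x| <=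
    2 * \int[mu]_x `|l x| + 1.
Proof.
move=> VL bV e0; have tV := lap_tameZ bO VL; have tl := lap_tame VL.
have [rho rho0 Hrho] := ucont_inner (lap_ucont VL) (lap_out VL) e0.
have [C [r [r0 Hr]]] := bV _ rho0.
have [rV rV0 HrV] := tame_supp tV.
have cV := ucont_continuous (lap_ucont VL).
pose B : 'rV[R]_N -> R := \1_[set y | e < V y].
have mB : measurable_fun [set: 'rV[R]_N] (B : _ -> measurableTypeR R).
  by apply: measurable_indic; exact: measurable_gt_set.
have B1 x : `|B x| <= 1.
  by rewrite /B indicE; case: (_ \in _); rewrite ?normr1 ?normr0.
have tBf f : tame f -> tame (fun x => B x * `|f x|).
  move=> tf; rewrite (_ : (fun x => _) = (fun x => `|f x| * B x)); last first.
    by apply/funext => x; rewrite mulrC.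
  by apply: tameM => //; [exact: tame_norm|exists 1].
have tBl : tame (fun x => B x * `|l x|) by exact: tBf.
have ta n : tame (fun x => B x * `|dlap (hn n) V x|) by apply: tBf; exact: tame_dlap.
have BE x : e < V x -> B x = 1 by move=> ?; rewrite /B indicE mem_set.
have BE0 x : V x <= e -> B x = 0.
  by move=> eV; rewrite /B indicE memNset//=; apply/negP; rewrite -leNgt.
have inV x : e < V x -> inner Omega rho x.
  by move=> eV; apply: Hrho; rewrite (le_trans (ltW eV))// ler_norm.
have cva : \int[mu]_x (B x * `|dlap (hn n) V x|) @[n --> \oo] --> \int[mu]_x (B x * `|l x|).
  apply: (@tame_bounded_convergence _ _ _ _ rV (Num.max C 0)) => //.
    near=> n => x; split; last first.
      by move=> /HrV Vx; rewrite BE0 ?Vx ?mul0r// ltW.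
    have [eV|eV] := ltP e (V x); last first.
      by rewrite BE0// mul0r normr0 le_max lexx orbT.
    rewrite BE// mul1r normr_id le_max (Hr x (inV x eV))//.
    near: n; near=> n; apply: ltW; near: n; exact: near_infty_natSinv_lt (PosNum r0).
  move=> x; have [eV|eV] := ltP e (V x); last first.
    by under eq_fun do rewrite BE0// mul0r; rewrite BE0// mul0r; exact: cvg_cst.
  apply: cvgM; first exact: cvg_cst.
  apply: cvg_norm; apply: (lap_cvg VL).
  exact: inner_in (ltW rho0) (inV x eV).
have H2 : 0 < 2^-1 :> R by rewrite invr_gt0.
move/cvgrPdist_le : cva => /(_ _ H2); apply: filterS => n.
rewrite ler_norml => /andP[Hn _].
have tP := tame_trunc tV e0.
have tdP := tame_dlap (hn n) tP.
apply: (@le_trans _ _ (2 * \int[mu]_x (B x * `|dlap (hn n) V x|))).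
  rewrite -tame_RintegralZ// -[leRHS]add0r -[X in _ <= X + _](tame_Rintegral_dlap (hn n) tP).
  rewrite -tame_RintegralD//; last exact: tameZ.
  apply: tame_le_Rintegral.
  - exact: tame_norm.
  - by apply: tameD => //; exact: tameZ.
  - by move=> x; exact: trunc_dlap_ge (lt0r_neq0 (hn_gt0 n)).
have : \int[mu]_x (B x * `|l x|) <= \int[mu]_x `|l x|.
  apply: tame_le_Rintegral => //; first exact: tame_norm.
  by move=> x; rewrite ler_piMl// (le_trans (ler_norm _)).
move: Hn; set a := \int[mu]_x _; set b := \int[mu]_x _; set c := \int[mu]_x _.
by move=> *; lra.
Unshelve. all: end_near. Qed.

Lemma tame_Rintegral_norm_le f (M : R) g : tame f -> tame g -> 0 <= M ->
  (forall x, `|f x| <= M * `|g x|) -> `|\int[mu]_x f x| <= M * \int[mu]_x `|g x|.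
Proof.
move=> tf tg M0 fg.
have tg' := tame_norm tg.
rewrite -tame_RintegralZ// ler_norml -[X in X <= _ <= _]mulN1r -tame_RintegralZ; last exact: tameZ.
have tM : tame (fun x => M * `|g x|) by exact: tameZ.
apply/andP; split.
- apply: tame_le_Rintegral => // [|x]; first exact: tameZ.
  by have := fg x; rewrite ler_norml mulN1r => /andP[].
- apply: tame_le_Rintegral => // x.
  by have := fg x; rewrite ler_norml => /andP[].
Qed.

Lemma tame_Rintegral_le_norm f (M : R) g : tame f -> tame g -> 0 <= M ->
  (forall x, `|f x| <= M) -> \int[mu]_x (f x * g x) <= M * \int[mu]_x `|g x|.
Proof.
move=> tf tg M0 fM; apply: le_trans (ler_norm _) _.
apply: tame_Rintegral_norm_le => //; first exact: tameMr.
by move=> x; rewrite normrM ler_wpM2r.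
Qed.

(* The truncations [P], [Q] of [V] and [- V] at height [e] are test functions with support inside
   [Omega] whose discrete Laplacians are bounded in L1, so that they absorb uniformly small
   errors; [Z] is replaced by a semiconvex function in the pairing with [P] and a semiconcave one
   in the pairing with [Q], which makes the pointwise convergence of the discrete Laplacian
   usable on one side. *)
Lemma green_le Z g V l : lap_on Omega Z g -> lap_on Omega V l ->
  dlap_locally_bounded Omega V ->
  \int[mu]_x (V x * g x) <= \int[mu]_x (Z x * l x).
Proof.
move=> ZL VL bV; apply/ler_addgt0Pr => eta eta0.
have tV := lap_tameZ bO VL; have tl := lap_tame VL.
have tZ := lap_tameZ bO ZL; have tg := lap_tame ZL.
have VLN := lap_onN VL; have bVN := dlap_locally_boundedN bV.
pose C0 := \int[mu]_x `|l x|; pose Cg := \int[mu]_x `|g x|.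
have C00 : 0 <= C0 by exact: Rintegral_ge0.
have Cg0 : 0 <= Cg by exact: Rintegral_ge0.
(* The estimates below add up to an error of [w * (9 * C0 + 7) + e * (Cg + C)]. The order of choices
   matters: [w] depends on [C0] only, [C] comes from [zeta] and hence from [w], and [e] is taken
   last, which is possible as the L1 bounds on the truncations are uniform in [e]. *)
have [w [w0 wE]] : exists w : R, 0 < w /\ w * (9 * C0 + 16) <= eta / 2.
  exists (eta / 2 / (9 * C0 + 16)); have H : 0 < 9 * C0 + 16 by lra.
  by rewrite divr_gt0 ?divr_gt0// divfK// gt_eqF.
have [zeta [C [rho [rho0 Hz tz zO HC]]]] :=
  semiconvex_approx bO (lap_ucont ZL) (lap_out ZL) w0.
have Cz0 : 0 <= C.
  by apply: le_trans (HC 1 ltr01 (lexx _)); exact: Rintegral_ge0.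
have [e [e0 eE]] : exists e : R, 0 < e /\ e * (Cg + C) <= eta / 2.
  exists (eta / 2 / (Cg + C + 1)); have H : 0 < Cg + C + 1 by lra.
  split; first by rewrite divr_gt0 ?divr_gt0.
  have e20 : 0 < eta / 2 by rewrite divr_gt0.
  rewrite mulrAC ler_pdivrMr// ler_pM2l//; lra.
pose P x := Num.max (V x - e) 0; pose Q x := Num.max (- V x - e) 0.
have tP : tame P by exact: tame_trunc.
have tQ : tame Q by apply: (@tame_trunc (fun x => - V x)) => //; exact: tameN.
have P0 x : 0 <= P x by rewrite /P le_max lexx orbT.
have Q0 x : 0 <= Q x by rewrite /Q le_max lexx orbT.
have [r2 r20 Hr2] := ucont_inner (lap_ucont VL) (lap_out VL) e0.
have PO x : P x != 0 -> inner Omega r2 x.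
  rewrite /P; have [eV|eV _] := leP (V x) e.
    by rewrite (max_idPr _) ?subr_le0// eqxx.
  by apply: Hr2; rewrite (le_trans (ltW eV))// ler_norm.
have QO x : Q x != 0 -> inner Omega r2 x.
  rewrite /Q; have [eV|eV _] := leP (- V x) e.
    by rewrite (max_idPr _) ?subr_le0// eqxx.
  by apply: Hr2; rewrite -normrN (le_trans (ltW eV))// ler_norm.
have [Gp [tGp HGp nP]] := sup_convolution_lower bO ZL tP P0 r20 PO w0.
have [Gm [tGm HGm nQ]] := sup_convolution_lower bO (lap_onN ZL) tQ Q0 r20 QO w0.
have nPL := trunc_dlap_L1 VL bV e0.
have nQL := trunc_dlap_L1 VLN bVN e0.
have nz : \forall n \near \oo,
    \int[mu]_x (zeta x * dlap (hn n) V x) <= \int[mu]_x (zeta x * l x) + w.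
  have /cvgrPdist_le/(_ _ w0) := Rintegral_dlap_cvg bO VL bV tz rho0 zO.
  by apply: filterS => n; rewrite ler_norml => /andP[? _]; lra.
have [n [H1 [H2 [H3 [H4 H5]]]]] :=
  filter_ex (filterI nP (filterI nQ (filterI nPL (filterI nQL nz)))).
rewrite -/(hn n) in H1 H2.
rewrite -/P -/C0 in H3; rewrite -/Q in H4.
have {}H4 : \int[mu]_x `|dlap (hn n) Q x| <= 2 * C0 + 1.
  rewrite (_ : C0 = \int[mu]_x `|- l x|)//.
  by apply: eq_Rintegral => x _; rewrite normrN.
have H6 : \int[mu]_x `|dlap (hn n) zeta x| <= C.
  by apply: HC => //; rewrite /hn invf_le1// ler1n.
have tdP := tame_dlap (hn n) tP; have tdQ := tame_dlap (hn n) tQ.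
have tdz := tame_dlap (hn n) tz; have tdV := tame_dlap (hn n) tV.
have tPg : tame (fun x => P x * g x) by exact: tameMr.
have tQg : tame (fun x => Q x * g x) by exact: tameMr.
have tVg : tame (fun x => V x * g x) by exact: tameMr.
have w20 : 0 <= 2 * w by rewrite mulr_ge0// ltW.
have swap (a b c : R) : `|a - c| <= w -> `|b - c| <= w -> `|a - b| <= 2 * w.
  move=> ac bc; rewrite (_ : a - b = (a - c) - (b - c)); last by ring.
  by rewrite (le_trans (ler_normB _ _))// mulrDl mul1r lerD.
(* By summation by parts the discrete Laplacian falls on [P], where it is bounded in L1, while [Gp]
   and [zeta] differ by at most [2 * w] uniformly. *)
have H7 : \int[mu]_x (P x * dlap (hn n) Gp x) <=
    \int[mu]_x (zeta x * dlap (hn n) P x) + 2 * w * (2 * C0 + 1).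
  rewrite tame_dlap_by_parts// -lerBlDl -tame_RintegralB; [|exact: tameMr..].
  apply: le_trans (ler_wpM2l w20 H3).
  rewrite (_ : \int[mu]_x _ = \int[mu]_x ((Gp x - zeta x) * dlap (hn n) P x)); last first.
    by apply: eq_Rintegral => x _; rewrite mulrBl.
  apply: tame_Rintegral_le_norm => //; first exact: tameB.
  by move=> x; exact: swap (HGp x) (Hz x).
clear nP nQ nPL nQL nz.
have H8 : \int[mu]_x (Q x * dlap (hn n) Gm x) <=
    2 * w * (2 * C0 + 1) - \int[mu]_x (zeta x * dlap (hn n) Q x).
  rewrite tame_dlap_by_parts// lerBrDr -tame_RintegralD; [|exact: tameMr..].
  apply: le_trans (ler_wpM2l w20 H4).
  rewrite (_ : \int[mu]_x _ = \int[mu]_x ((Gm x + zeta x) * dlap (hn n) Q x)); last first.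
    by apply: eq_Rintegral => x _; rewrite mulrDl.
  apply: tame_Rintegral_le_norm => //; first exact: tameD.
  move=> x; rewrite -[zeta x]opprK; apply: swap (HGm x) _.
  by rewrite -opprD normrN; exact: Hz.
(* [P x - Q x] is [soft e (V x)]. *)
have PQV x : `|P x - Q x - V x| <= e by exact: soft_dist (ltW e0).
have tPQ : tame (fun x => P x - Q x) by exact: tameB.
have tPQV : tame (fun x => P x - Q x - V x) by exact: tameB.
(* Now the discrete Laplacian is moved onto [zeta], whose L1 bound [C] absorbs the uniform error [e]
   between [P - Q] and [V]. *)
have H9 : \int[mu]_x (zeta x * dlap (hn n) P x) - \int[mu]_x (zeta x * dlap (hn n) Q x)
    <= \int[mu]_x (zeta x * dlap (hn n) V x) + e * C.
  rewrite !(tame_dlap_by_parts _ tz)// -tame_RintegralB; [|exact: tameMr..].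
  rewrite -lerBlDl -tame_RintegralB; [|by apply: tameB; exact: tameMr|exact: tameMr].
  apply: le_trans (ler_wpM2l (ltW e0) H6).
  rewrite (_ : \int[mu]_x _ = \int[mu]_x ((P x - Q x - V x) * dlap (hn n) zeta x)); last first.
    by apply: eq_Rintegral => x _; rewrite !mulrBl.
  by apply: tame_Rintegral_le_norm => //; exact: ltW.
have H10 : \int[mu]_x (zeta x * l x) <= \int[mu]_x (Z x * l x) + w * C0.
  rewrite -lerBlDl -tame_RintegralB; [|exact: tameMr..].
  rewrite (_ : \int[mu]_x _ = \int[mu]_x ((zeta x - Z x) * l x)); last first.
    by apply: eq_Rintegral => x _; rewrite !mulrBl.
  by apply: tame_Rintegral_le_norm => //; [exact: tameB|exact: ltW].
have H11 : \int[mu]_x (V x * g x) <=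
    \int[mu]_x (P x * g x) + \int[mu]_x (Q x * - g x) + e * Cg.
  rewrite -lerBlDl.
  rewrite (_ : _ - _ = \int[mu]_x (- (P x - Q x - V x) * g x)).
    apply: tame_Rintegral_le_norm => //; [exact: tameN|exact: ltW|].
    by move=> x; rewrite normrN.
  rewrite -tame_RintegralD//; last by apply: tameMr => //; exact: tameN.
  rewrite -tame_RintegralB//; last first.
    by apply: tameD => //; apply: tameMr => //; exact: tameN.
  by apply: eq_Rintegral => x _; ring.
move: H1 H2 H5 H7 H8 H9 H10 H11 wE eE.
move: (\int[mu]_x (P x * g x)) (\int[mu]_x (Q x * - g x)) => a1 a2.
move: (\int[mu]_x (P x * dlap (hn n) Gp x)) (\int[mu]_x (Q x * dlap (hn n) Gm x)) => a3 a4.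
move: (\int[mu]_x (zeta x * dlap (hn n) P x)) (\int[mu]_x (zeta x * dlap (hn n) Q x)) => a5 a6.
move: (\int[mu]_x (zeta x * dlap (hn n) V x)) (\int[mu]_x (zeta x * l x)) => a7 a8.
move: (\int[mu]_x (Z x * l x)) (\int[mu]_x (V x * g x)) => a9 a10.
clear -C00 w0; move: C0 C Cg C00 => c c1 c2 c0 *.
have : 0 <= w * c by rewrite mulr_ge0// ltW.
nra.
Qed.

Lemma green Z g V l : lap_on Omega Z g -> lap_on Omega V l ->
  dlap_locally_bounded Omega V ->
  \int[mu]_x (V x * g x) = \int[mu]_x (Z x * l x).
Proof.
move=> ZL VL bV; apply/eqP; rewrite eq_le; apply/andP; split.
  exact: green_le ZL VL bV.
have := green_le ZL (lap_onN VL) (dlap_locally_boundedN bV).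
have tV := lap_tameZ bO VL; have tl := lap_tame VL.
have tZ := lap_tameZ bO ZL; have tg := lap_tame ZL.
have E f k : tame f -> tame k -> \int[mu]_x (- f x * k x) = - \int[mu]_x (f x * k x).
  move=> tf tk; rewrite -mulN1r -tame_RintegralZ; last exact: tameMr.
  by apply: eq_Rintegral => x _; ring.
have -> : \int[mu]_x (Z x * - l x) = \int[mu]_x (- Z x * l x).
  by apply: eq_Rintegral => x _; ring.
by rewrite !E// lerN2.
Qed.

End green_identity.

(** * Fourier coefficients for negative times *)

Section classical_laplacian.
Context {R : realType} (N : nat).
Local Notation mu := (lebesgue_rV N).
Variable Omega : set 'rV[R]_N.
Hypotheses (oO : open Omega) (bO : bounded_set Omega).
Implicit Types (f g v : 'rV[R]_N -> R) (x y : 'rV[R]_N).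

Lemma within_continuous_bounded f (K : set 'rV[R]_N) : compact K ->
  {within K, continuous f} -> exists M : R, forall x, K x -> `|f x| <= M.
Proof.
move=> cK cf.
have /compact_bounded[M [_ HM]] : compact (f @` K) by exact: continuous_compact.
exists (M + 1) => x Kx; apply: HM; first by rewrite ltrDl.
by exists x.
Qed.

Lemma tame_zext g : {within closure Omega, continuous g} -> tame (zext Omega g).
Proof.
move=> cg.
have [M HM] := within_continuous_bounded (compact_closure_bounded bO) cg.
have [r r0 Hr] := bounded_rV bO.
have M0 : 0 <= Num.max M 0 by rewrite le_max lexx orbT.
apply: tameP.
- rewrite (_ : zext Omega g = g \_ Omega).
    apply/(measurable_restrictT _ _).1; first exact: open_measurable_rV.
    apply: continuous_measurable_rV => // x; rewrite inE => Ox.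
    apply/(@cvgrPdist_le _ _ _ (nbhs x)) => e e0.
    have nO : nbhs x Omega by exact: open_nbhs_nbhs.
    have /subspace_continuousP/(_ _ (subset_closure Ox))/cvgrPdist_le/(_ _ e0) := cg.
    rewrite near_withinE => H; near=> y.
    have Oy : Omega y by near: y.
    by apply: (near H y) => //; exact: subset_closure.
  apply/funext => x; rewrite /zext /patch.
  have [Ox|Ox] := pselect (Omega x).
    by rewrite asboolT// (mem_set Ox).
  by rewrite asboolF// (memNset Ox).
- exists (Num.max M 0) => x; have [Ox|Ox] := pselect (Omega x).
    by rewrite zextE// le_max HM//; exact: subset_closure.
  by rewrite zext0// normr0.
- by exists r => x rx; apply: zext0 => /Hr; rewrite leNgt rx.
Unshelve. all: end_near. Qed.

Lemma dlap_zext f x : Omega x -> exists2 r : R, 0 < r &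
  forall h : R, 0 < h -> h <= r -> dlap h (zext Omega f) x = dlap h f x.
Proof.
move=> Ox; have nO : nbhs x Omega by exact: open_nbhs_nbhs.
have [r r0 Hr] := nbhs_evec nO; exists r => // h h0 hr.
apply: eq_bigr => i _; rewrite /diff2 -scaleNr.
by rewrite !zextE//; apply: Hr; rewrite ?normrN gtr0_norm.
Qed.

Lemma lap_on_classical f g : {within closure Omega, continuous f} ->
  (forall x, bnd Omega x -> f x = 0) -> (forall x, Omega x -> has_laplacian f x) ->
  {within closure Omega, continuous g} -> (forall x, Omega x -> g x = laplacian f x) ->
  lap_on Omega (zext Omega f) (zext Omega g).
Proof.
move=> cf f0 hf cg gE; split.
- apply: (ucont_continuous_supp bO); first exact: continuous_zext.
  by move=> x; exact: zext0.
- by move=> x; exact: zext0.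
- exact: tame_zext.
- move=> e e0; have [d d0 Hd] := heine (compact_closure_bounded bO) cg e0.
  exists (d / 2); first by rewrite divr_gt0.
  move=> x y Ox Oy xy; rewrite !zextE//.
  apply: Hd; [exact: subset_closure..|].
  by rewrite -ball_normE/=; lra.
- move=> x Ox; rewrite zextE// gE//; apply/cvgrPdist_le => e e0.
  have [r r0 Hr] := dlap_cvg (hf x Ox) e0.
  have [r' r'0 Hr'] := dlap_zext f Ox.
  near=> n.
  have n0 : 0 < n.+1%:R^-1 :> R by rewrite invr_gt0.
  rewrite Hr'//; last by near: n; near=> n; apply: ltW; near: n; exact: near_infty_natSinv_lt
    (PosNum r'0).
  rewrite distrC; apply: Hr => //.
  by near: n; near=> n; apply: ltW; near: n; exact: near_infty_natSinv_lt (PosNum r0).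
Unshelve. all: end_near. Qed.

Lemma closure_inner (rho : R) x : 0 < rho -> closure (inner Omega rho) x ->
  inner Omega (rho / 2) x.
Proof.
move=> r0 cx y xy.
have [|z [rz /=]] := cx (ball x (rho / 2)); first by apply: nbhsx_ballx; rewrite divr_gt0.
rewrite -ball_normE/= => xz; apply: rz.
have := ler_normD (z - x) (x - y); rewrite addrA subrK (distrC z x); lra.
Qed.

(** Steps of length at most [rho / 2] from [inner Omega rho] stay in [inner Omega (rho / 2)], whose
    closure is a compact subset of [Omega]; the continuous pure second derivatives are bounded
    there. *)
Lemma Ck2_locally_bounded v : Ck 2 Omega v -> dlap_locally_bounded Omega (zext Omega v).
Proof.
move=> [_ Cv] rho rho0.
have rho20 : 0 < rho / 2 by rewrite divr_gt0.
pose K := closure (inner Omega (rho / 2)).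
have KO : K `<=` Omega.
  by move=> x /(closure_inner rho20); apply: inner_in; rewrite !divr_ge0// ltW.
have cK : compact K.
  apply: bounded_closed_compact; last exact: closed_closure.
  have [M M0 HM] := bounded_rV bO; exists M; split; first exact: num_real.
  by move=> M' MM x /KO /HM xM; exact: le_trans xM (ltW MM).
have /choice[M HM] : forall i, exists M : R, forall x, K x -> `|partial i (partial i v) x| <= M.
  move=> i; apply: within_continuous_bounded => //.
  have [_ [_ Cvi]] := Cv i; have [_ [Cvii _]] := Cvi i.
  apply: continuous_in_subspaceT => x; rewrite inE => /KO; exact: Cvii.
pose MM := \sum_(i < N) Num.max (M i) 0.
exists (N%:R * (2 * MM)), (rho / 2); split => // x xin h h0 hr.
have -> : dlap h (zext Omega v) x = dlap h v x.
  apply: eq_bigr => i _; rewrite /diff2 -scaleNr.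
  have xO (s : R) : `|s| <= h -> Omega (x + s *: evec i).
    move=> sh; apply: xin; rewrite opprD addrA subrr add0r normrN.
    by rewrite (le_trans (evec_norm _ _))// (le_trans sh)//; lra.
  rewrite !zextE//; first by have := xO 0; rewrite scale0r addr0 normr0; apply; exact: ltW.
    by apply: xO; rewrite normrN gtr0_norm.
  by apply: xO; rewrite gtr0_norm.
apply: dlap_bound => // i s sh.
have Kxs : K (x + s *: evec i).
  apply: subset_closure => y xy; apply: xin.
  have := ler_normB (x + s *: evec i - y) (s *: evec i).
  by rewrite addrAC addrK; have := evec_norm i s; lra.
have [d1 [_ Cvi]] := Cv i; have [d2 _] := Cvi i.
split; first exact/d1/KO; split; first exact/d2/KO.
apply: le_trans (HM i _ Kxs) _.
rewrite /MM (bigD1 i)//= (le_trans _ (ler_wpDr _ (lexx _)))//.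
  by rewrite le_max lexx.
by apply: sumr_ge0 => j _; rewrite le_max lexx orbT.
Qed.

End classical_laplacian.

Lemma within_continuous_slice (S T U : topologicalType) (A : set S) (B : set T)
    (F : S * T -> U) (t : T) : {within A `*` B, continuous F} -> B t ->
  {within A, continuous (fun x => F (x, t))}.
Proof.
move=> cF Bt; apply/subspace_continuousP => x Ax.
have /subspace_continuousP/(_ (x, t) (conj Ax Bt)) := cF.
apply: cvg_trans => P /= [[U1 U2] /= [nU1 nU2] UP].
suff : nbhs x [set y | A y -> P (F (y, t))] by [].
apply: filterS nU1 => y Uy Ay; apply: (UP (y, t)) => //; split => //=.
exact: nbhs_singleton.
Qed.

Section eigenmodes.
Context {R : realType} (N : nat).
Local Notation mu := (lebesgue_rV N).
Variable Omega : set 'rV[R]_N.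
Hypotheses (oO : open Omega) (bO : bounded_set Omega).
Implicit Types (f g v : 'rV[R]_N -> R) (x y : 'rV[R]_N).

(** The set of points of [Omega] where [f] is nonzero is open, and a nonempty open set contains a
    box of positive measure. *)
Lemma ae0_continuous f : continuous f ->
  {ae mu, forall x, Omega x -> f x = 0} -> forall x, Omega x -> f x = 0.
Proof.
move=> cf [A [mA A0 HA]] x Ox; apply/eqP/negP => /negP fx.
pose U := Omega `&` f @^-1` [set t | t != 0].
have oU : open U.
  apply: openI => //; apply: open_comp => [y _|]; first exact: cf.
  exact: open_neq.
have : (0 < mu U)%E by apply: open_lebesgue_rV_gt0 => //; exists x.
apply/negP; rewrite -leNgt -A0; apply: le_measure; rewrite ?inE//.
  exact: open_measurable_rV.
by move=> y [Oy /eqP fy]; apply: HA => /= /(_ Oy).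
Qed.

Lemma tame_L2 f : tame f -> L2 Omega f.
Proof.
move=> tf; have mO := open_measurable_rV oO; split.
  by apply: measurable_funTS; case: tf.
apply: (integrableS measurableT) => //.
rewrite (_ : (fun x => _) = EFin \o (fun x => f x * f x)).
  by apply: tame_integrable; exact: tameMr.
by apply/funext => x; rewrite expr2.
Qed.

Lemma L2_dot_zext f v : L2_dot Omega (zext Omega f) v =
  \int[mu]_x (zext Omega f x * zext Omega v x).
Proof.
rewrite /L2_dot Rintegral_mkcond; apply: eq_Rintegral => x _; rewrite /patch.
have [Ox|Ox] := pselect (Omega x); first by rewrite (mem_set Ox) [zext Omega v x]zextE.
by rewrite (memNset Ox) zext0// mul0r.
Qed.

Lemma complete_eq0 (v : nat -> 'rV[R]_N -> R) f :
  complete_orthonormal_system Omega v ->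
  {within closure Omega, continuous f} -> (forall x, bnd Omega x -> f x = 0) ->
  (forall k, \int[mu]_x (zext Omega f x * zext Omega (v k) x) = 0) ->
  forall x, closure Omega x -> f x = 0.
Proof.
move=> [_ _ cv] cf f0 H.
have cz := continuous_zext oO cf f0.
have tz : tame (zext Omega f).
  apply: (ucont_tame bO); last by move=> x; exact: zext0.
  by apply: (ucont_continuous_supp bO) => // x; exact: zext0.
have := cv (zext Omega f) (tame_L2 tz).
have H' k : L2_dot Omega (zext Omega f) (v k) = 0 by rewrite L2_dot_zext.
move=> /(_ H') /(ae0_continuous cz) H0 x cx.
have [Ox|Ox] := pselect (Omega x); last exact: f0.
by rewrite -(zextE f Ox) H0.
Qed.

Lemma eigenfunction_lap_on (lam : R) v : dirichlet_eigenfunction Omega lam v ->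
  lap_on Omega (zext Omega v) (zext Omega (fun x => - lam * v x)) /\
  dlap_locally_bounded Omega (zext Omega v).
Proof.
move=> [cv C2v lv v0 _]; split; last exact: Ck2_locally_bounded.
apply: lap_on_classical => //.
- move=> x Ox i; have [_ /(_ i)[d1 [_ /(_ i)[d2 _]]]] := C2v; split; last exact: d2.
  have nO : nbhs x Omega by exact: open_nbhs_nbhs.
  by near=> y; apply: d1; near: y.
- move=> x; apply: (@continuousM _ _ (cst (- lam)) (v : subspace (closure Omega) -> R)).
    exact: cst_continuous.
  exact: cv.
- by move=> x Ox; rewrite mulNr -lv// opprK.
Unshelve. all: end_near. Qed.

(** Green's identity with the roles distributed by regularity: the C^2 eigenfunction supplies the
    locally bounded discrete Laplacians, whereas [f] has only pointwise derivatives and a Laplacian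
    that extends continuously. *)
Lemma eigenmode_laplacian (lam : R) v f g : dirichlet_eigenfunction Omega lam v ->
  {within closure Omega, continuous f} ->
  (forall x, bnd Omega x -> f x = 0) -> (forall x, Omega x -> has_laplacian f x) ->
  {within closure Omega, continuous g} -> (forall x, Omega x -> g x = laplacian f x) ->
  \int[mu]_x (zext Omega g x * zext Omega v x) =
  - lam * \int[mu]_x (zext Omega f x * zext Omega v x).
Proof.
move=> ev cf f0 hf cg gE.
have [Lv bv] := eigenfunction_lap_on ev.
have Lf := lap_on_classical oO bO cf f0 hf cg gE.
have := green bO Lf Lv bv.
have tV := lap_tameZ bO Lv; have tZ := lap_tameZ bO Lf.
rewrite -tame_RintegralZ; last exact: tameMr.
have -> : \int[mu]_x (zext Omega v x * zext Omega g x) =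
  \int[mu]_x (zext Omega g x * zext Omega v x).
  by apply: eq_Rintegral => x _; rewrite mulrC.
move=> ->; apply: eq_Rintegral => x _.
have [Ox|Ox] := pselect (Omega x); last by rewrite !zext0// !mul0r mulr0.
by rewrite !zextE//; ring.
Qed.

End eigenmodes.

Section backward_modes.
Context {R : realType} (N : nat).
Local Notation mu := (lebesgue_rV N).
Variable Omega : set 'rV[R]_N.
Hypotheses (oO : open Omega) (bO : bounded_set Omega).
Variables (alpha lam : R) (v : 'rV[R]_N -> R) (z : 'rV[R]_N -> R -> R)
  (g : 'rV[R]_N * R -> R).
Hypothesis ev : dirichlet_eigenfunction Omega lam v.
Hypothesis cz : {within closure Omega `*` `[- alpha, 0], continuous (fun p => z p.1 p.2)}.
Hypothesis zb : forall x t, bnd Omega x -> - alpha <= t <= 0 -> z x t = 0.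
Hypothesis zl : forall x t, Omega x -> - alpha < t < 0 -> has_laplacian (z ^~ t) x.
Hypothesis cg : {within closure Omega `*` `]- alpha, 0[, continuous g}.
Hypothesis gE : forall x t, Omega x -> - alpha < t < 0 -> g (x, t) = laplacian (z ^~ t) x.
Hypothesis dz : forall x t, closure Omega x -> - alpha < t < 0 -> derivable (z x) t 1.
Hypothesis cdz : {within closure Omega `*` `]- alpha, 0[,
  continuous (fun p => derive1 (z p.1) p.2)}.
Hypothesis zE : forall x t, Omega x -> - alpha < t < 0 ->
  derive1 (z x) t + laplacian (z ^~ t) x = 0.

Let V := zext Omega v.
Let T t := \int[mu]_x (zext Omega (z ^~ t) x * V x).

Let tV : tame V.
Proof. by have [L _] := eigenfunction_lap_on oO bO ev; exact: (lap_tameZ bO L). Qed.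

Let cz_slice t : - alpha <= t <= 0 -> {within closure Omega, continuous (z ^~ t)}.
Proof. by move=> ?; apply: (within_continuous_slice (t := t) cz); rewrite /= in_itv. Qed.

Let tz t : - alpha <= t <= 0 -> tame (zext Omega (z ^~ t)).
Proof. by move=> ?; apply: tame_zext => //; exact: cz_slice. Qed.

Let cT : {within `[- alpha, 0], continuous T}.
Proof.
have cK : compact (closure Omega `*` `[- alpha, 0]).
  by apply: compact_setX; [exact: compact_closure_bounded|exact: segment_compact].
apply/subspace_continuousP => t tin; apply/cvgrPdist_le => e e0.
have IV0 : 0 <= \int[mu]_x `|V x| by exact: Rintegral_ge0.
pose e' := e / (\int[mu]_x `|V x| + 1).
have IV1 : 0 < \int[mu]_x `|V x| + 1 by rewrite ltr_wpDl.
have e'0 : 0 < e' by rewrite divr_gt0.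
have [d d0 Hd] := heine cK cz e'0.
rewrite near_withinE; near=> s => sin.
have Ht : - alpha <= t <= 0 by move: tin; rewrite /= in_itv.
have Hs : - alpha <= s <= 0 by move: sin; rewrite /= in_itv.
have ts : ball t d s by near: s; exact: nbhsx_ballx.
have tzt := tz Ht; have tzs := tz Hs.
rewrite /from_subspace /T -tame_RintegralB; [|exact: tameMr..].
apply: (@le_trans _ _ (e' * \int[mu]_x `|V x|)).
  apply: tame_Rintegral_norm_le => //; first by apply: tameB; exact: tameMr.
    exact: ltW.
  move=> x; rewrite -mulrBl normrM ler_wpM2r//.
  have [Ox|Ox] := pselect (Omega x); last by rewrite !zext0// subrr normr0 ltW.
  rewrite !zextE//; apply: (Hd (x, t) (x, s)) => //=.
  - by split => //; exact: subset_closure.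
  - by split => //; exact: subset_closure.
  - by split => //=; exact: ballxx.
by rewrite /e' mulrAC ler_pdivrMr// ler_pM2l// lerDl.
Unshelve. all: end_near. Qed.

Let dT t : - alpha < t < 0 -> is_derive t 1 T (lam * T t).
Proof.
move=> /andP[t1 t2].
(* The time derivative is continuous only over the open interval and may blow up at its ends; a
   compact subinterval around [t] gives the constant that dominates it under the integral. *)
have [u [w [u1 ut tw w2]]] : exists u w, [/\ - alpha < u, u < t, t < w & w < 0].
  by exists ((t - alpha) / 2), (t / 2); split; lra.
have Huw s : u <= s <= w -> - alpha < s < 0 by move=> /andP[? ?]; apply/andP; split; lra.
have Huw' s : u <= s <= w -> - alpha <= s <= 0 by move=> /andP[? ?]; apply/andP; split; lra.
have cK : compact (closure Omega `*` `[u, w]).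
  by apply: compact_setX; [exact: compact_closure_bounded|exact: segment_compact].
have [M HM] : exists M : R, forall p, (closure Omega `*` `[u, w]) p -> `|derive1 (z p.1) p.2| <= M.
  have cd : {within closure Omega `*` `[u, w], continuous (fun p => derive1 (z p.1) p.2)}.
    apply: continuous_subspaceW cdz => -[x s] /= [cx]; rewrite !in_itv/=; split => //.
    exact: Huw.
  have /compact_bounded[M [_ HM]] := continuous_compact cd cK.
  by exists (M + 1) => p Kp; apply: HM; [rewrite ltrDl|exists p].
pose f s x := zext Omega (z ^~ s) x * V x.
have Huoo s : `]u, w[%classic s -> u <= s <= w.
  by rewrite /= in_itv/= => /andP[? ?]; rewrite !ltW.
have fder s x : `]u, w[%classic s -> is_derive s 1 (f ^~ x)
    (zext Omega (fun y => derive1 (z y) s) x * V x).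
  move=> /Huoo sin; have [Ox|Ox] := pselect (Omega x); last first.
    rewrite (_ : f ^~ x = cst 0); last by apply/funext => r; rewrite /f zext0// mul0r.
    by rewrite zext0// mul0r; exact: is_derive_cst.
  rewrite zextE// (_ : f ^~ x = (fun r => V x *: z x r)); last first.
    by apply/funext => r; rewrite /f zextE// mulrC.
  rewrite mulrC derive1E; apply: is_deriveZ; apply/derivableP.
  by apply: dz; [exact: subset_closure|exact: Huw].
have tin : `]u, w[%classic t by rewrite /= in_itv/= ut tw.
pose G x := Num.max M 0 * `|V x|.
have tG : tame G by apply: tameZ; exact: tame_norm.
have mf : measurable [set: 'rV[R]_N] by [].
have H1 s : `]u, w[%classic s -> mu.-integrable setT (EFin \o f s).
  by move=> /Huoo/Huw' sin; apply: tame_integrable; apply: tameMr => //; exact: tz.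
have H2 s x : `]u, w[%classic s -> [set: 'rV[R]_N] x -> derivable (f ^~ x) s 1.
  by move=> sin _; have [] := fder s x sin.
have H3 x : 0 <= G x by rewrite mulr_ge0// le_max lexx orbT.
have H4 : mu.-integrable setT (EFin \o G) by exact: tame_integrable.
have H5 s x : `]u, w[%classic s -> [set: 'rV[R]_N] x -> `|partial1of2 f s x| <= G x.
  move=> sin _; rewrite partial1of2E; have [_ ->] := fder s x sin.
  rewrite normrM ler_wpM2r//; have [Ox|Ox] := pselect (Omega x); last first.
    by rewrite zext0// normr0 le_max lexx orbT.
  rewrite zextE// le_max (HM (x, s))//; split => /=; first exact: subset_closure.
  by rewrite in_itv/=; exact: Huoo.
have dF := @derivable_under_integral _ _ _ mu f setT mf t u w tin H1 H2 G H3 H4 H5.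
have DF := @differentiation_under_integral _ _ _ mu f setT mf t u w tin H1 H2 G H3 H4 H5.
apply: DeriveDef; first exact: dF.
rewrite -derive1E; apply: etrans DF _.
transitivity (\int[mu]_x (zext Omega (fun y => derive1 (z y) t) x * V x)).
  apply: eq_Rintegral => x _; rewrite partial1of2E.
  by have [_ ->] := fder t x tin.
have Ht : - alpha < t < 0 by rewrite t1 t2.
have Ht' : - alpha <= t <= 0 by rewrite !ltW.
(* The equation replaces the time derivative by [- g]; [eigenmode_laplacian] contributes a second
   minus sign, whence the factor [lam]. *)
transitivity (\int[mu]_x (- 1 * (zext Omega (fun y => g (y, t)) x * V x))).
  apply: eq_Rintegral => x _; have [Ox|Ox] := pselect (Omega x).
    rewrite !zextE// mulrA; congr (_ * _); rewrite mulN1r gE//.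
    by apply/eqP; rewrite -addr_eq0 zE.
  by rewrite !zext0// !mul0r mulr0.
have cgt : {within closure Omega, continuous (fun y => g (y, t))}.
  by apply: (within_continuous_slice (t := t) cg); rewrite /= in_itv.
rewrite tame_RintegralZ; last by apply: tameMr => //; apply: tame_zext.
rewrite (@eigenmode_laplacian _ _ _ oO bO lam v (z ^~ t) (fun y => g (y, t)) ev).
- by rewrite !mulNr mul1r opprK.
- exact: cz_slice.
- by move=> x bx; exact: zb.
- by move=> x Ox; exact: zl.
- exact: cgt.
- by move=> x Ox; exact: gE.
Qed.

(** [T s * expR (- lam * s)] has derivative zero on the open interval and is continuous up to the
    ends, so the mean value theorem reaches both [- alpha] and 0. *)
Lemma backward_mode t : - alpha <= t <= 0 -> T t = T (- alpha) * expR (lam * (t + alpha)).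
Proof.
move=> /andP[at_ t0].
pose S s := T s * expR (- lam * s).
have dE (s : R) : is_derive s 1 (fun s : R => expR (- lam * s)) (- lam * expR (- lam * s)).
  rewrite mulrC; apply: (@is_derive1_comp _ expR (fun s => - lam * s)).
  apply: is_derive_eq; rewrite /GRing.scale/=; ring.
have [c _ Ec] : exists2 c, c \in `[- alpha, t] & S t - S (- alpha) = 0 * (t - - alpha).
  apply: (@MVT_segment R S (fun=> 0)) => //.
    move=> s; rewrite in_itv/= => /andP[s1 s2].
    have ds : is_derive s 1 T (lam * T s) by apply: dT; rewrite s1 (lt_le_trans s2).
    rewrite (_ : S = T * (fun s => expR (- lam * s)))//.
    apply: is_derive_eq; rewrite /GRing.scale/=; ring.
  apply: (@continuous_subspaceW _ _ _ `[- alpha, 0]%classic).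
    by move=> s; rewrite /= !in_itv/= => /andP[-> s2] /=; rewrite (le_trans s2).
  have cE : continuous (fun s : R => expR (- lam * s)).
    move=> s; apply: differentiable_continuous; apply/derivable1_diffP.
    by have [] := dE s.
  move=> s; apply: (@continuousM _ _ (T : subspace `[- alpha, 0] -> R)
    ((fun s : R => expR (- lam * s)) : subspace `[- alpha, 0] -> R)).
    exact: cT.
  exact: continuous_subspaceT.
move: Ec; rewrite mul0r => /subr0_eq; rewrite /S => E.
rewrite -[LHS]mulr1 -expR0 -(subrr (lam * t)) expRD mulrA [T t * _]mulrC -mulrA.
rewrite -mulNr E mulrCA -expRD; congr (_ * expR _); ring.
Qed.

End backward_modes.

(** * Absolutely continuous functions *)

Section chains.
Context {R : realType}.
Implicit Types (a b d e x y : R) (f : R -> R) (p q : R * R) (L M : seq (R * R)).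

Definition apart p q := (p.2 <= q.1) || (q.2 <= p.1).

(* A finite family of nonoverlapping subintervals of [a, b], as a list of pairs of endpoints. *)
Definition chain a b L :=
  all (fun p => [&& a <= p.1, p.1 <= p.2 & p.2 <= b]) L && pairwise apart L.

Definition len L := \sum_(p <- L) (p.2 - p.1).

Definition osc f L := \sum_(p <- L) `|f p.2 - f p.1|.

(** Absolute continuity over lists, which admit induction on the family; the weak inequality
    survives the passage to the supremum defining total variation. *)
Definition chain_ac a b f := forall e, 0 < e -> exists2 d, 0 < d &
  forall L, chain a b L -> len L < d -> osc f L <= e.

Lemma abs_continuous_chain a b f : abs_continuous a b f -> chain_ac a b f.
Proof.
move=> ac e e0; have [d d0 Hd] := ac e e0; exists d => // L /andP[La Lp] Ld.
pose l (i : 'I_(size L)) := (nth (0, 0) L i).1.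
pose r (i : 'I_(size L)) := (nth (0, 0) L i).2.
have E (F : R * R -> R) : \sum_(p <- L) F p = \sum_(i < size L) F (nth (0, 0) L i).
  by rewrite (big_nth (0, 0)) big_mkord.
rewrite /osc E ltW//; apply: (Hd _ l r).
- move=> i; move/allP : La => /(_ (nth (0, 0) L i)).
  by rewrite mem_nth// => /(_ isT)/and3P[].
- have H (i j : 'I_(size L)) t : `]l i, r i[%classic t -> `]l j, r j[%classic t -> ~ (i < j)%N.
    rewrite /= !in_itv/= => /andP[t1 t2] /andP[t3 t4] ij.
    move/(pairwiseP (0, 0)) : Lp => /(_ i j); rewrite !inE !ltn_ord => /(_ isT isT ij).
    move=> /orP[] H; first by have := lt_trans t3 t2; rewrite ltNge H.
    by have := lt_trans t1 t4; rewrite ltNge H.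
  move=> i j _ _ [t [ti tj]]; apply/val_inj.
  by have [ij|ij|//] := ltngtP (i : nat) (j : nat); [case: (H i j t)|case: (H j i t)].
- by move: Ld; rewrite /len E.
Qed.

Fixpoint steps a (s : seq R) : seq (R * R) :=
  if s is x :: s' then (a, x) :: steps x s' else [::].

Lemma steps_chain a (s : seq R) : path <%R a s -> chain a (last a s) (steps a s).
Proof.
elim: s a => [//|x s IH] a /= /andP[ax xs].
have /andP[H1 H2] := IH x xs; apply/andP; split => /=.
  apply/andP; split.
    rewrite lexx (ltW ax)/=.
    have : sorted <=%R (x :: s) by apply: sub_path xs => u w; exact: ltW.
    by move=> /(order_path_min le_trans)/allP; case: (lastP s) => // s' z; rewrite last_rcons;
      apply; rewrite mem_rcons mem_head.
  apply: sub_all H1 => p /and3P[H3 -> ->]; rewrite (le_trans (ltW ax) H3)//.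
apply/andP; split => //.
by apply: sub_all H1 => p /and3P[H3 _ _]; rewrite /apart/= H3.
Qed.

Lemma len_steps a (s : seq R) : len (steps a s) = last a s - a.
Proof.
elim: s a => [|x s IH] a /=; first by rewrite /len big_nil subrr.
by rewrite /len big_cons -/(len _) IH/= addrC subrKA.
Qed.

Lemma osc_steps f a b (s : seq R) : itv_partition a b s ->
  osc f (steps a s) = variation a b f s.
Proof.
move=> abs; rewrite variation_zip//; move: {abs} a; elim: s => [|x s IH] a /=.
  by rewrite /osc !big_nil.
by rewrite /osc !big_cons/= -IH.
Qed.

Lemma apart_sub x y p q : apart (x, y) q -> x <= p.1 -> p.2 <= y -> apart p q.
Proof.
by rewrite /apart/= => /orP[H|H] H1 H2; rewrite ?(le_trans H2 H)// (le_trans H H1) orbT.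
Qed.

Lemma apartC p q : apart p q = apart q p. Proof. by rewrite /apart orbC. Qed.

Lemma chain_cons_replace a b x y L M N : chain x y N -> chain a b (M ++ (x, y) :: L) ->
  chain a b ((N ++ M) ++ L).
Proof.
move=> /andP[Na Np] /andP[Ha Hp].
move: Ha; rewrite all_cat/= => /and3P[Ma /and3P[ax xy yb] La].
move: Hp; rewrite pairwise_cat/= allrel_consr => /and3P[/andP[Mx ML] Mp /andP[xL Lp]].
apply/andP; split.
  rewrite !all_cat Ma La !andbT; apply: sub_all Na => p /and3P[H1 H2 H3].
  by rewrite (le_trans ax H1) H2 (le_trans H3 yb).
have sub q : apart (x, y) q -> all (fun p => apart p q) N.
  move=> xq; apply: sub_all Na => p /and3P[H1 _ H3].
  exact: apart_sub xq H1 H3.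
rewrite !pairwise_cat Np Mp Lp /= andbT.
rewrite allrel_catl ML andbT; apply/andP; split.
  apply/allrelP => p q pN qL; move/allP: xL => /(_ q qL)/sub/allP; exact.
rewrite andbT; apply/allrelP => p q pN qM.
by move/allP: Mx => /(_ q qM); rewrite apartC => /sub/allP; apply.
Qed.

Lemma len_cat L M : len (L ++ M) = len L + len M. Proof. exact: big_cat. Qed.

Local Notation TV := total_variation.

(** Subdividing an interval preserves the total length, so oscillations can be replaced by total
    variations one interval at a time with the same [d]. [M] collects the pieces already subdivided,
    [L] the intervals still to be treated. *)
Lemma chain_ac_TV a b f e d : (forall L, chain a b L -> len L < d -> osc f L <= e) ->
  forall L M, chain a b (M ++ L) -> len (M ++ L) < d ->
  ((osc f M)%:E + \sum_(p <- L) TV p.1 p.2 f <= e%:E)%E.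
Proof.
move=> H; elim=> [|[x y] L IH] M cML lML.
  by rewrite big_nil adde0 lee_fin H//; rewrite cats0 in cML lML.
have xy : x <= y.
  by move/andP: cML => [+ _]; rewrite all_cat/= => /and3P[_ /and3P[]].
have TL0 : (0 <= \sum_(p <- L) TV p.1 p.2 f)%E.
  move/andP: cML => [+ _]; rewrite all_cat/= => /and3P[_ _ /allP HL].
  rewrite big_seq; apply: sume_ge0 => p /HL /and3P[_ ? _].
  exact: total_variation_ge0.
(* Finiteness is needed to move this sum across the inequality; it comes from the induction
   hypothesis with the interval [(x, y)] left out. *)
have Lfin : (\sum_(p <- L) TV p.1 p.2 f)%E \is a fin_num.
  have := IH M; rewrite ge0_fin_numE// => {}IH.
  have : ((osc f M)%:E + \sum_(p <- L) TV p.1 p.2 f <= e%:E)%E.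
    apply: IH.
      by have := @chain_cons_replace a b x y L M [::] isT cML.
    move: lML; rewrite !len_cat /len big_cons/=; apply: le_lt_trans.
    by rewrite lerD2l lerDr subr_ge0.
  have : (\sum_(p <- L) TV p.1 p.2 f <= (osc f M)%:E + \sum_(p <- L) TV p.1 p.2 f)%E.
    by rewrite leeDr// lee_fin sumr_ge0.
  by move=> /le_trans h /h /le_lt_trans; apply; exact: ltry.
rewrite big_cons/= addeCA -leeBrDr ?fin_numD ?Lfin//.
apply: ge_ereal_sup => _ [_ [s ps <-] <-].
rewrite leeBrDr ?fin_numD ?Lfin// -(osc_steps f ps) addeA -EFinD.
have := IH (steps x s ++ M).
rewrite /osc big_cat/= -/(osc _ _) -/(osc _ _); apply.
  case: (ps) => pxs /eqP lxs; apply: chain_cons_replace cML.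
  by rewrite -lxs; exact: steps_chain.
move: lML; rewrite -catA !len_cat len_steps; case: ps => _ /eqP ->.
by rewrite /len big_cons/= addrCA.
Qed.

(** With [d] the constant for [e = 1], the variation over any interval of length at most [d / 2] is
    at most 1, and finitely many such intervals reach [x]. *)
Lemma chain_ac_TV_fin a b f x : chain_ac a b f -> a <= x <= b -> TV a x f \is a fin_num.
Proof.
move=> /(_ _ ltr01)[d d0 H] /andP[ax xb].
rewrite ge0_fin_numE; last exact: total_variation_ge0.
have step u w : a <= u -> u <= w -> w <= b -> w - u < d -> (TV u w f < +oo)%E.
  move=> au uw wb uwd; apply: (@le_lt_trans _ _ 1%:E); last exact: ltry.
  have := @chain_ac_TV a b f 1 d H [:: (u, w)] [::].
  rewrite /chain/= au uw wb /len /osc !(big_cons, big_nil)/= addr0 adde0 add0e.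
  exact.
have [n Hn] : exists n : nat, x - a <= n%:R * (d / 2).
  exists (Num.bound ((x - a) / (d / 2))).
  rewrite -ler_pdivrMr ?divr_gt0//; apply/ltW/archi_boundP.
  by apply: divr_ge0; [rewrite subr_ge0|exact/ltW/divr_gt0].
elim: n x ax xb Hn => [|n IH] x ax xb Hn.
  have -> : x = a by apply: le_anti; rewrite ax andbT -subr_le0; rewrite mul0r in Hn.
  by rewrite total_variationxx.
have [xs|xs] := leP (x - a) (d / 2).
  by apply: step => //; rewrite (le_lt_trans xs)//; lra.
pose y := x - d / 2.
rewrite (@total_variationD _ a x y); last 2 first.
- by rewrite /y; lra.
- by rewrite /y; lra.
rewrite lte_add_pinfty//.
  apply: IH; rewrite /y; [lra|lra|].
  by move: Hn; rewrite -natr1 mulrDl mul1r; lra.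
by apply: step; rewrite /y; lra.
Qed.

End chains.

Lemma lebesgue_stieltjes_measure_itv_oc (R : realType) (G : cumulative R R) (x y : R) :
  x <= y -> lebesgue_stieltjes_measure G `]x, y]%classic = (G y - G x)%:E.
Proof.
move=> xy; rewrite /lebesgue_stieltjes_measure /measure_extension/=.
rewrite measurable_mu_extE/=; last exact: is_ocitv.
exact: wlength_itv_bnd.
Qed.

Section clamp.
Context {R : realType}.
Variables (a b : R).
Hypothesis ab : a < b.

(** Precomposition with this 1-Lipschitz retraction extends a function on [[a, b]] to the line by
    its end values. *)
Definition clamp (x : R) := Num.min b (Num.max a x).

Lemma clamp_in x : a <= clamp x <= b.
Proof.
rewrite /clamp; apply/andP; split; last by rewrite ge_min lexx.
by rewrite le_min (ltW ab) le_max lexx.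
Qed.

Lemma clamp_cases x : [\/ x <= a /\ clamp x = a, (a <= x /\ x <= b) /\ clamp x = x |
  b <= x /\ clamp x = b].
Proof.
have [xa|ax] := leP x a.
  by apply: Or31; rewrite /clamp (max_idPl xa) (min_idPr (ltW ab)).
have [xb|bx] := leP x b.
  by apply: Or32; rewrite /clamp (max_idPr (ltW ax)) (min_idPr xb) (ltW ax).
by apply: Or33; rewrite /clamp (max_idPr (ltW ax)) (min_idPl (ltW bx)) (ltW bx).
Qed.

Lemma clamp_nd x y : x <= y -> clamp x <= clamp y.
Proof.
move=> xy; have := ab.
case: (clamp_cases x) => -[+ ->]; case: (clamp_cases y) => -[+ ->]; lra.
Qed.

Lemma clamp_lip x y : x <= y -> clamp y - clamp x <= y - x.
Proof.
move=> xy; have := ab.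
case: (clamp_cases x) => -[+ ->]; case: (clamp_cases y) => -[+ ->]; lra.
Qed.

Lemma clampE x : a <= x <= b -> clamp x = x.
Proof. by move=> /andP[ax xb]; rewrite /clamp (max_idPr ax) (min_idPr xb). Qed.

End clamp.

(** * Density of a monotone absolutely continuous function *)

Section monotone_density.
Context {R : realType}.
Variables (a b : R) (F : R -> R).
Hypothesis ab : a < b.
Hypothesis ndF : forall x y, a <= x -> x <= y -> y <= b -> F x <= F y.
Hypothesis acF : chain_ac a b F.

Local Notation clip := (clamp a b).
Let clip_in := clamp_in ab.
Let clip_nd := clamp_nd ab.
Let clip_lip := clamp_lip ab.

Let G x := F (clip x).

Let ndG : {homo G : x y / x <= y}.
Proof.
move=> x y xy; rewrite /G.
have /andP[? _] := clip_in x; have /andP[_ ?] := clip_in y.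
by apply: ndF => //; exact: clip_nd.
Qed.

Let rcG : right_continuous G.
Proof.
move=> x; apply/cvgrPdist_le => e e0.
have [d d0 Hd] := acF e0; near=> y.
have xy : x <= y by near: y; exact: nbhs_right_ge.
have yd : y - x < d.
  by rewrite ltrBlDl; near: y; apply: nbhs_right_lt; rewrite ltrDl.
have := Hd [:: (clip x, clip y)].
rewrite /chain/= clip_nd// /len /osc !big_cons !big_nil/= !addr0 !andbT distrC.
have /andP[-> _] := clip_in x; have /andP[_ ->] := clip_in y.
by apply => //; apply: le_lt_trans yd; exact: clip_lip.
Unshelve. all: end_near. Qed.

HB.instance Definition _ := isCumulative.Build R _ R G ndG rcG.

Let mu : {measure set (measurableTypeR R) -> \bar R} := lebesgue_stieltjes_measure (G : cumulative
  R R).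

Let mD : measurable (`]a, b]%classic : set (measurableTypeR R)).
Proof. by []. Qed.

Let muab : (mu `]a, b]%classic < +oo)%E.
Proof. by rewrite /mu/= lebesgue_stieltjes_measure_itv_oc ?ltW// ltry. Qed.

Let nu : {finite_measure set (measurableTypeR R) -> \bar R} := mfrestr mD muab.

Section grid.
Variables (U : set R) (n : nat).

Let x_ (k : nat) : R := a + (b - a) * (k%:R / n.+1%:R).

Let x_nd (k j : nat) : (k <= j)%N -> x_ k <= x_ j.
Proof.
move=> kj; rewrite /x_ lerD2l ler_pM2l ?subr_gt0//.
by rewrite ler_pM2r ?invr_gt0// ler_nat.
Qed.

(** A rejected cell becomes an empty interval instead of being removed, so that the family is always
    indexed by all [k < n.+1]. *)
Let r_ (k : nat) : R := if `[< `]x_ k, x_ k.+1]%classic `<=` U >] then x_ k.+1 else x_ k.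

Let x0 : x_ 0 = a. Proof. by rewrite /x_ mul0r mulr0 addr0. Qed.

Let xn : x_ n.+1 = b.
Proof. by rewrite /x_ divff// mulr1 addrC subrK. Qed.

Let xr k : x_ k <= r_ k.
Proof. by rewrite /r_; case: ifP => // _; exact: x_nd. Qed.

Let rx k : r_ k <= x_ k.+1.
Proof. by rewrite /r_; case: ifP => // _; exact: x_nd. Qed.

Definition grid_chain := [seq (x_ k, r_ k) | k <- iota 0 n.+1].

(* The union of those of the [n.+1] equal cells of [`]a, b]] that lie in [U]. *)
Definition grid_set := \big[setU/set0]_(k < n.+1) `]x_ k, r_ k]%classic.

Lemma grid_chainP : chain a b grid_chain.
Proof.
apply/andP; split.
  apply/allP => p /mapP[k]; rewrite mem_iota/= add0n => kn ->/=.
  rewrite xr/=; apply/andP; split; first by rewrite -[leLHS]x0 x_nd.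
  by rewrite (le_trans (rx k))// -[leRHS]xn; exact: x_nd.
rewrite pairwise_map; apply: (@sub_pairwise _ ltn).
  move=> k j kj; rewrite /= /apart/= (le_trans (rx k))//.
  exact: x_nd.
rewrite -sorted_pairwise; last exact: ltn_trans.
exact: iota_ltn_sorted.
Qed.

Let grid_triv : trivIset `I_n.+1 (fun k => `]x_ k, r_ k]%classic).
Proof.
have H k j t : (k < j)%N -> t <= r_ k -> x_ j < t -> False.
  move=> kj tk jt; have := lt_le_trans jt (le_trans tk (le_trans (rx k) (x_nd kj))).
  by rewrite ltxx.
move=> k j _ _ [t []]; rewrite /= !in_itv/= => /andP[t1 t2] /andP[t3 t4].
by have [kj|jk|//] := ltngtP k j; [have := H k j t kj t2 t3|have := H j k t jk t4 t1].
Qed.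

Lemma measurable_grid_set : measurable grid_set.
Proof. exact: bigsetU_measurable. Qed.

Let grid_measure (m : {measure set (measurableTypeR R) -> \bar R}) (g : R -> R) :
  (forall x y, x <= y -> m `]x, y]%classic = (g y - g x)%:E) ->
  m grid_set = (\sum_(p <- grid_chain) (g p.2 - g p.1))%:E.
Proof.
move=> mE; rewrite (@measure_semi_additive_ord_I _ _ _ m (fun k => `]x_ k, r_ k]%classic))//.
  rewrite big_map -[n.+1 in RHS]subn0 -/(index_iota 0 n.+1) big_mkord -sumEFin.
  by apply: eq_bigr => k _; exact: mE.
exact: measurable_grid_set.
Qed.

Lemma grid_set_sub : grid_set `<=` U.
Proof.
rewrite /grid_set -(bigcup_mkord n.+1 (fun k => `]x_ k, r_ k]%classic)) => t [k _ /=].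
by rewrite /r_; case: ifPn => [/asboolP H|_]; [exact: H|rewrite in_itv/= => /andP[t1 /(lt_le_trans
  t1)]; rewrite ltxx].
Qed.

Lemma lebesgue_grid_set : lebesgue_measure grid_set = (len grid_chain)%:E.
Proof.
apply: (@grid_measure lebesgue_measure id) => x y xy.
apply: etrans (lebesgue_measure_itv `]x, y]) _; rewrite /= lte_fin lt_neqAle xy andbT.
by case: eqVneq => [->|_]/=; rewrite ?subrr// EFinB.
Qed.

Lemma stieltjes_grid_set : mu grid_set = (osc F grid_chain)%:E.
Proof.
rewrite (@grid_measure mu G); last by move=> x y; exact: lebesgue_stieltjes_measure_itv_oc.
congr EFin; rewrite /osc; have /andP[/allP H _] := grid_chainP.
rewrite big_seq [RHS]big_seq; apply: eq_bigr => p /H/and3P[ap pp pb].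
rewrite /G !clampE ?ap ?pb ?(le_trans pp)// ?(le_trans ap)//.
by rewrite ger0_norm// subr_ge0; exact: ndF.
Qed.

Lemma grid_set_mem t : a < t <= b ->
  (forall s, a <= s <= b -> `|t - s| <= (b - a) / n.+1%:R -> U s) -> grid_set t.
Proof.
move=> /andP[at_ tb] HU.
have ba0 : 0 < b - a by rewrite subr_gt0.
have n0 : 0 < n.+1%:R :> R by [].
have step k : x_ k.+1 = x_ k + (b - a) / n.+1%:R.
  by rewrite /x_ -natr1; field; rewrite gt_eqF.
have [w wE] : exists w, w = (b - a) / n.+1%:R by exists ((b - a) / n.+1%:R).
rewrite -wE in HU step.
have ex : exists k, t <= x_ k.+1 by exists n; rewrite xn.
have [k tk kmin] := ex_minnP ex.
have kn : (k <= n)%N by apply: kmin; rewrite xn.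
have kt : x_ k < t.
  move: kmin; case: k {tk kn} => [|k] kmin; first by rewrite x0.
  by rewrite ltNge; apply/negP => /kmin; rewrite ltnn.
rewrite /grid_set -(bigcup_mkord n.+1 (fun k => `]x_ k, r_ k]%classic)).
exists k => //=; rewrite /r_; case: ifPn => [_|/asboolP[]].
  by rewrite in_itv/= kt.
move=> s /=; rewrite in_itv/= => /andP[s1 s2]; apply: HU.
  have ak : a <= x_ k by rewrite -[leLHS]x0 x_nd.
  have kb : x_ k.+1 <= b by rewrite -[leRHS]xn x_nd.
  by rewrite (le_trans ak (ltW s1)) (le_trans s2).
rewrite step in s2 tk.
by rewrite ler_norml; apply/andP; split; lra.
Qed.

End grid.

(** Absolute continuity speaks of finite families only; the open set is exhausted by finite unions
    of grid cells, each of Stieltjes mass at most [e], and continuity from below concludes. *)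
Let mu_open (e d : R) (U : set R) : 0 < e ->
  (forall L, chain a b L -> len L < d -> osc F L <= e) -> open U ->
  (lebesgue_measure U < d%:E)%E -> (mu (U `&` `]a, b]) <= e%:E)%E.
Proof.
move=> e0 H oU Ud.
have muW n : (mu (grid_set U n) <= e%:E)%E.
  rewrite stieltjes_grid_set lee_fin; apply: H; first exact: grid_chainP.
  rewrite -lte_fin -lebesgue_grid_set; apply: le_lt_trans Ud.
  by apply: le_measure; rewrite ?inE; [exact: measurable_grid_set|exact: open_measurable|exact:
    grid_set_sub].
(* Grids of different mesh are not nested, so the grid sets are not monotone in [n]; the
   intersections of their tails are, and they still cover [U] within []a, b]]. *)
pose W m := \bigcap_(n in [set n | (m <= n)%N]) grid_set U n.
have mW m : measurable (W m).
  by apply: bigcap_measurable => [|k _]; [exists m => /=|exact: measurable_grid_set].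
have WW m : (mu (W m) <= e%:E)%E.
  apply: le_trans (muW m); apply: le_measure; rewrite ?inE.
  - exact: mW.
  - exact: measurable_grid_set.
  - by apply: bigcap_inf => /=.
have mUW : measurable (\bigcup_m W m) by exact: bigcupT_measurable.
have ndW : nondecreasing_seq W.
  by move=> m p mp; apply/subsetPset => t Wt n /= pn; apply: Wt => /=; exact: leq_trans pn.
have cvW := @nondecreasing_cvg_mu _ _ _ mu W mW mUW ndW.
apply: (@le_trans _ _ (mu (\bigcup_m W m))); last first.
  by apply: cvge_to_le cvW _; apply: nearW => m; exact: WW.
apply: le_measure; rewrite ?inE//.
  by apply: measurableI => //; exact: open_measurable.
move=> t [Ut /=]; rewrite in_itv/= => /andP[at_ tb].
have /nbhs_ballP[r /= r0 rU] : nbhs t U by exact: open_nbhs_nbhs.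
have [m Hm] : exists m : nat, m.+1%:R^-1 < r / (b - a).
  have r1 : 0 < r / (b - a) by rewrite divr_gt0// subr_gt0.
  by have [m] := ltr_add_invr r1; rewrite add0r => ?; exists m.
exists m => // n /= mn; apply: grid_set_mem; first by rewrite at_.
move=> s _ ts; apply: rU; rewrite -ball_normE/=; apply: le_lt_trans ts _.
rewrite mulrC -ltr_pdivlMr ?subr_gt0//; apply: le_lt_trans Hm.
by rewrite lef_pV2 ?posrE// ler_nat.
Qed.

(** By outer regularity a null set lies in an open set of Lebesgue measure below [d], whose
    Stieltjes mass is at most [e] by [mu_open]. *)
Let dom : nu `<< (lebesgue_measure : set (measurableTypeR R) -> \bar R).
Proof.
apply/null_content_dominatesP => A mA A0.
apply/eqP; rewrite eq_le measure_ge0 andbT; apply/lee_addgt0Pr => e e0.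
have [d d0 Hd] := acF e0.
have d20 : 0 < d by [].
have Afin : (lebesgue_measure A < +oo)%E by rewrite A0 ltry.
have [U [oU AU Ud]] := lebesgue_regularity_outer mA Afin d0.
rewrite add0e; apply: (@le_trans _ _ (mu (U `&` `]a, b]))).
  change (mu (A `&` `]a, b]%classic) <= mu (U `&` `]a, b]%classic))%E.
  apply: le_measure; rewrite ?inE; [exact: measurableI| |exact: setSI].
  by apply: measurableI => //; exact: open_measurable.
apply: (mu_open e0 Hd oU).
have mU := open_measurable oU.
rewrite (_ : U = A `|` (U `\` A)); last by rewrite setDUK.
apply: le_lt_trans (measureU2 _ _ _) _ => //; first exact: measurableD.
by rewrite A0 add0e.
Qed.

(** The Radon-Nikodym derivative of the Stieltjes measure of [F] restricted to []a, b]]. *)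
Lemma monotone_density : exists h : R -> R, [/\ (forall x, 0 <= h x),
  lebesgue_measure.-integrable setT (EFin \o h) &
  forall x y, a <= x -> x <= y -> y <= b ->
    F y - F x = \int[lebesgue_measure]_(t in `]x, y]) h t].
Proof.
have [h [h0 hfin ih hE]] := radon_nikodym_sigma_finite dom.
have hh : EFin \o (fine \o h) = h by apply/funext => t /=; rewrite fineK.
exists (fine \o h); split.
- by move=> x /=; exact: fine_ge0.
- by rewrite hh.
move=> x y ax xy yb; rewrite /Rintegral.
have -> : (\int[lebesgue_measure]_(t in `]x, y]) ((fine \o h) t)%:E =
  \int[lebesgue_measure]_(t in `]x, y]) h t)%E.
  by apply: eq_integral => t _ /=; rewrite fineK.
rewrite -hE//= /mfrestr /mrestr (_ : _ `&` _ = `]x, y]%classic); last first.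
  apply/seteqP; split => [t [] //|t /= txy]; split => //=.
  move: txy; rewrite /= !in_itv/= => /andP[xt ty].
  by rewrite (le_lt_trans ax xt) (le_trans ty yb).
rewrite /mu/= lebesgue_stieltjes_measure_itv_oc//= /G !clampE//.
- by rewrite ax (le_trans xy).
- by rewrite yb (le_trans ax).
Qed.

End monotone_density.

Section absolutely_continuous.
Context {R : realType}.
Implicit Types (a b d e x y : R) (f : R -> R) (L : seq (R * R)).
Local Notation TV := total_variation.

Lemma chain_acD a b f g : chain_ac a b f -> chain_ac a b g ->
  chain_ac a b (fun x => f x - g x).
Proof.
move=> af ag e e0; have e20 : 0 < e / 2 by rewrite divr_gt0.
have [d1 d10 H1] := af _ e20; have [d2 d20 H2] := ag _ e20.
exists (Num.min d1 d2); first by rewrite lt_min d10.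
move=> L cL; rewrite lt_min => /andP[l1 l2].
apply: (@le_trans _ _ (osc f L + osc g L)).
  rewrite /osc -big_split/=; apply: ler_sum => p _.
  rewrite (_ : _ - _ - _ = (f p.2 - f p.1) - (g p.2 - g p.1)); last by ring.
  exact: ler_normB.
by have := H1 L cL l1; have := H2 L cL l2; lra.
Qed.

(** Jordan decomposition: with [V] the variation function, [f = V - (V - f)] is a difference of
    nondecreasing functions, both absolutely continuous by [chain_ac_TV]. *)
Lemma ac_density a b f : a < b -> abs_continuous a b f ->
  exists g : R -> R, lebesgue_measure.-integrable setT (EFin \o g) /\
  forall x y, a <= x -> x <= y -> y <= b ->
    f y - f x = \int[lebesgue_measure]_(t in `]x, y]) g t.
Proof.
move=> ab /abs_continuous_chain acf.
pose V x := fine (TV a x f).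
have Vfin x : a <= x <= b -> TV a x f \is a fin_num by exact: chain_ac_TV_fin acf.
have VB x y : a <= x -> x <= y -> y <= b -> (V y - V x)%:E = TV x y f.
  move=> ax xy yb; have xfin : TV a x f \is a fin_num by apply: Vfin; rewrite ax (le_trans xy).
  have yfin : TV a y f \is a fin_num by apply: Vfin; rewrite (le_trans ax).
  by rewrite EFinB /V !fineK// (total_variationD f ax xy) (addeC (TV a x f)) addeK.
have ndV x y : a <= x -> x <= y -> y <= b -> V x <= V y.
  by move=> ax xy yb; rewrite -subr_ge0 -lee_fin VB//; exact: total_variation_ge0.
have acV : chain_ac a b V.
  move=> e /acf[d d0 Hd]; exists d => // L cL lL.
  have := @chain_ac_TV _ a b f e d Hd L [::] cL lL.
  rewrite {1}/osc big_nil add0e -[in X in _ -> X]lee_fin; apply: le_trans.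
  rewrite /osc -sumEFin big_seq [leRHS]big_seq; apply: lee_sum => p pL.
  have /andP[/allP/(_ p pL)/and3P[ap pp pb] _] := cL.
  by rewrite -(VB p.1 p.2)// lee_fin ger0_norm// subr_ge0; exact: ndV.
have ndP x y : a <= x -> x <= y -> y <= b -> V x - f x <= V y - f y.
  move=> ax xy yb; have := total_variation_ge f xy; rewrite -VB// lee_fin.
  by have := ler_norm (f y - f x); lra.
have [h1 [_ i1 E1]] := monotone_density ab ndV acV.
have [h2 [_ i2 E2]] := monotone_density ab ndP (chain_acD acV acf).
exists (fun x => h1 x - h2 x); split.
  rewrite (_ : EFin \o _ = (EFin \o h1) \- (EFin \o h2))%E; first exact: integrableB.
  by apply/funext => x /=; rewrite EFinB.
move=> x y ax xy yb; rewrite RintegralB//.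
- by rewrite -E1// -E2//; ring.
- exact: (integrableS measurableT).
- exact: (integrableS measurableT).
Qed.

Lemma density_derive a b f g : a < b ->
  lebesgue_measure.-integrable setT (EFin \o g) ->
  (forall x y, a <= x -> x <= y -> y <= b ->
    f y - f x = \int[lebesgue_measure]_(t in `]x, y]) g t) ->
  {ae lebesgue_measure, forall x, a < x < b -> is_derive x 1 f (g x)}.
Proof.
move=> ab ig gE.
have lg : locally_integrable [set: R] g.
  by apply: open_integrable_locally => //; exact: openT.
have [A [mA A0 HA]] := lebesgue_differentiation lg.
exists A; split => // x Hx; apply: HA => /= lx; apply: Hx => /andP[ax xb].
have ig' : lebesgue_measure.-integrable [set` Interval (BRight a) (BRight b)] (EFin \o g).
  exact: (integrableS measurableT).
have [dF FE] := FTC1_lebesgue_pt xb ig' ax lx.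
pose F y := f a + \int[lebesgue_measure]_(t in `]a, y]) g t.
have dF' : is_derive x 1 F (g x).
  rewrite -[g x]add0r; apply: is_deriveD.
  apply: DeriveDef; first exact: dF.
  by rewrite -derive1E; exact: FE.
have nF : {near x, F =1 f}.
  have : x \in `]a, b[ by rewrite in_itv/= ax.
  move=> /near_in_itvoo; apply: filterS => y; rewrite in_itv/= => /andP[ay yb].
  by rewrite /F -gE ?lexx ?ltW// addrC subrK.
have [dF1 dF2] := dF'.
apply: DeriveDef.
  by apply: near_eq_derivable nF dF1.
by rewrite -(near_eq_derive _ nF).
Qed.

End absolutely_continuous.

(** * Measurability of the derivative of a continuous function *)

Section measurable_derive1.
Context {R : realType}.
Variable F : R -> R.
Hypothesis cF : continuous F.

Let quot (h x : R) : R := h^-1 * (F (h + x) - F x).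

Let small (m : nat) (p : rat) := (ratr p != 0 :> R) && (`|ratr p| < m.+1%:R^-1 :> R).

Let derivableE x : derivable F x 1 <-> cvg (quot h x @[h --> 0^']).
Proof.
rewrite /derivable (_ : (fun h : R => h^-1 *: ((F \o shift x) (h *: (1 : R)) - F x)) = quot^~ x)//.
by apply/funext => h; rewrite /quot /= (_ : h *: (1 : R) = h)//; exact: mulr1.
Qed.

Let cquot x (h : R) : h != 0 -> {for h, continuous (quot^~ x)}.
Proof.
move=> h0; apply: continuousM; first exact: continuousV.
apply: continuousB; last exact: cst_continuous.
apply: continuous_comp; last exact: cF.
by apply: continuousD => //; exact: cst_continuous.
Qed.

Let rat_dense (h d r : R) : h != 0 -> 0 < d -> `|h| < r ->
  exists p : rat, [/\ ratr p != 0 :> R, `|ratr p| < r :> R & `|h - ratr p| < d].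
Proof.
move=> h0 d0 hr; have nh0 : 0 < `|h| by rewrite normr_gt0.
pose d' := Num.min d (Num.min `|h| (r - `|h|)).
have d'0 : 0 < d' by rewrite !lt_min d0 nh0 subr_gt0.
have [|p] := @rat_in_itvoo R (h - d') (h + d').
  by rewrite ltrD2l gtrN.
rewrite in_itv/= => /andP[p1 p2]; exists p.
have hp : `|h - ratr p| < d' by rewrite ltr_norml; apply/andP; split; lra.
move: hp; rewrite !lt_min => /and3P[H1 H2 H3]; split => //.
  by apply: contraTneq H2 => ->; rewrite subr0 ltxx.
have := ler_normB h (h - ratr p); rewrite opprB addrC subrK => H.
by apply: le_lt_trans H _; lra.
Qed.

(** Cauchy criterion for the difference quotient, restricted to rational increments; continuity of
    the quotient in a nonzero increment extends it to real ones. Only countable operations remain,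
    as measurability requires. *)
Let derivable_rat x : derivable F x 1 <-> (forall k, exists m, forall p r,
  small m p -> small m r -> `|quot (ratr p) x - quot (ratr r) x| <= k.+1%:R^-1).
Proof.
rewrite derivableE; split.
  move=> /cvg_ex[/= l /cvgrPdist_le H] k.
  have k0 : 0 < (k.+1%:R^-1) / 2 :> R by rewrite divr_gt0 ?invr_gt0.
  have := H _ k0; rewrite near_withinE => /nbhs_ballP[e /= e0 He].
  have [m Hm] := ltr_add_invr e0; rewrite add0r in Hm; exists m => p r.
  move=> /andP[p0 pm] /andP[r0 rm].
  have H1 : `|l - quot (ratr p) x| <= k.+1%:R^-1 / 2.
    by apply: He => //; rewrite /ball/= sub0r normrN (lt_trans pm).
  have H2 : `|l - quot (ratr r) x| <= k.+1%:R^-1 / 2.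
    by apply: He => //; rewrite /ball/= sub0r normrN (lt_trans rm).
  rewrite [leRHS]splitr (_ : _ - _ = (l - quot (ratr r) x) - (l - quot (ratr p) x)); last by ring.
  by rewrite (le_trans (ler_normB _ _))// lerD.
move=> H; apply: cauchy_cvg; apply/cauchy_ballP => e e0.
have e20 : 0 < e / 2 by rewrite divr_gt0.
have [k Hk] := ltr_add_invr e20; rewrite add0r in Hk.
have [m Hm] := H k.
have m0 : 0 < m.+1%:R^-1 :> R by rewrite invr_gt0.
have HR (s t : R) : s != 0 -> t != 0 -> `|s| < m.+1%:R^-1 -> `|t| < m.+1%:R^-1 ->
    `|quot s x - quot t x| < e.
  move=> s0 t0 sm tm.
  have e40 : 0 < e / 4 by rewrite divr_gt0.
  have /cvgrPdist_lt/(_ _ e40)/nbhs_ballP[d1 /= d10 Hd1] := @cquot x s s0.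
  have /cvgrPdist_lt/(_ _ e40)/nbhs_ballP[d2 /= d20 Hd2] := @cquot x t t0.
  have [p [p0 pm sp]] := rat_dense s0 d10 sm.
  have [r [r0 rm tr]] := rat_dense t0 d20 tm.
  have H1 := Hd1 _ sp; have H2 := Hd2 _ tr.
  have := Hm p r; rewrite /small p0 pm r0 rm => /(_ isT isT) H3.
  rewrite (_ : _ - _ = (quot s x - quot (ratr p) x) + (quot (ratr p) x - quot (ratr r) x)
    - (quot t x - quot (ratr r) x)); last by ring.
  apply: le_lt_trans (ler_normB _ _) _.
  have := ler_normD (quot s x - quot (ratr p) x) (quot (ratr p) x - quot (ratr r) x).
  have {H3}H3 := le_lt_trans H3 Hk; move: H1 H2 H3; set A := `|_|; set B := `|_|; set C := `|_|;
    set D := `|_|.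
  by lra.
pose S := [set s : R | s != 0 /\ `|s| < m.+1%:R^-1].
have nS : \forall s \near (0 : R)^', S s.
  rewrite near_withinE; apply/nbhs_ballP; exists m.+1%:R^-1 => //= s.
  by rewrite /ball/= sub0r normrN => sm s0; split.
exists ((fun h => quot h x) @` S, (fun h => quot h x) @` S) => /=.
  by split; apply: filterS nS => s Ss; exists s.
move=> [_ _] /= [[s [s0 sm] <-] [t [t0 tm] <-]].
by rewrite /ball/=; exact: HR.
Qed.

Let mquot (h : R) : measurable_fun [set: R] (quot h).
Proof.
apply: continuous_measurable_fun => x.
apply: (@continuousM _ _ (cst h^-1) (fun x => F (h + x) - F x) x); first exact: cst_continuous.
apply: (@continuousB _ _ _ (fun x => F (h + x)) F x); last exact: cF.
apply: (@continuous_comp _ _ _ (fun x => h + x) F x); last exact: cF.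
apply: (@continuousD _ _ _ (cst h) id x); first exact: cst_continuous.
by [].
Qed.

Lemma measurable_derivable : measurable [set x | derivable F x 1].
Proof.
rewrite (_ : [set x | _] = \bigcap_(k in [set: nat]) \bigcup_(m in [set: nat])
   \bigcap_(pr in [set: rat * rat]) [set x : R | small m pr.1 -> small m pr.2 ->
     `|quot (ratr pr.1) x - quot (ratr pr.2) x| <= k.+1%:R^-1]); last first.
  apply/seteqP; split => x /=.
    by move=> /derivable_rat H k _; have [m Hm] := H k; exists m => // -[p r] _; exact: Hm.
  move=> H; apply/derivable_rat => k; have [m _ Hm] := H k I.
  by exists m => p r; exact: (Hm (p, r) I).
apply: bigcapT_measurable => k; apply: bigcupT_measurable => m.
rewrite -[X in measurable X]setCK setC_bigcap; apply: measurableC.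
apply: countable_bigcupT_measurable => [|[p r]]; first exact: countableP.
apply: measurableC => /=.
have [pm|pm] := boolP (small m p); last first.
  by rewrite (_ : [set x | _] = setT)//; apply/seteqP; split.
have [rm|rm] := boolP (small m r); last first.
  by rewrite (_ : [set x | _] = setT)//; apply/seteqP; split.
rewrite (_ : [set x | _] = setT `&` (fun x => `|quot (ratr p) x - quot (ratr r) x|) @^-1` `]-oo,
  k.+1%:R^-1]); last first.
  by rewrite setTI; apply/seteqP; split => x /=; rewrite in_itv/=; [exact|].
have mf : measurable_fun [set: R] (fun x => `|quot (ratr p) x - quot (ratr r) x|).
  apply: (measurableT_comp (@normr_measurable R setT)).
  by apply: measurable_funB; exact: mquot.
by apply: mf => //; exact: measurable_itv.
Qed.

Lemma measurable_derive1 : measurable_fun [set: R] (derive1 F).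
Proof.
pose D := [set x | derivable F x 1].
apply: (@measurable_fun_cvg _ _ _ _ (fun n x => \1_D x * quot n.+1%:R^-1 x)).
  move=> n; apply: measurable_funM; last exact: mquot.
  by apply: measurable_indic; exact: measurable_derivable.
move=> x _; have [Dx|Dx] := pselect (D x).
  rewrite (_ : (fun n => _) = (fun n => quot n.+1%:R^-1 x)); last first.
    by apply/funext => n; rewrite indicE mem_set// mul1r.
  have /derivableE cx : derivable F x 1 by [].
  have : quot h x @[h --> 0^'] --> derive1 F x by exact: cx.
  move=> /cvgrPdist_le H; apply/cvgrPdist_le => e e0.
  have := H _ e0; rewrite near_withinE => /nbhs_ballP[r /= r0 Hr].
  near=> n; apply: Hr; last by rewrite invr_eq0.
  rewrite /ball/= sub0r normrN gtr0_norm ?invr_gt0//.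
  near: n; exact: near_infty_natSinv_lt (PosNum r0).
rewrite (_ : (fun n => _) = cst 0); last first.
  by apply/funext => n; rewrite indicE memNset// mul0r.
(* Where [F] is not derivable, [derive1] is the limit of a divergent filter, whose default value is
   0. *)
rewrite (_ : derive1 F x = 0); first exact: cvg_cst.
by apply: dvgP => cx; apply: Dx; apply/derivableE.
Unshelve. all: end_near. Qed.

End measurable_derive1.

(** * The Caputo derivative *)

Section caputo_linear.
Context {R : realType}.
Implicit Types (a b c d e t x y : R) (f g : R -> R).
Local Notation mu := (@lebesgue_measure R).

Lemma abs_continuous_lin a b f g (p q : R) : abs_continuous a b f ->
  abs_continuous a b g -> abs_continuous a b (fun x => p * f x + q * g x).
Proof.
move=> af ag e e0.
pose K := `|p| + `|q| + 1.
have K0 : 0 < K by rewrite ltr_wpDl ?addr_ge0.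
have e'0 : 0 < e / K by rewrite divr_gt0.
have [d1 d10 H1] := af _ e'0; have [d2 d20 H2] := ag _ e'0.
exists (Num.min d1 d2); first by rewrite lt_min d10.
move=> n l r lr tlr; rewrite lt_min => /andP[s1 s2].
have {}H1 := H1 n l r lr tlr s1; have {}H2 := H2 n l r lr tlr s2.
apply: (@le_lt_trans _ _ (`|p| * \sum_(i < n) `|f (r i) - f (l i)| +
  `|q| * \sum_(i < n) `|g (r i) - g (l i)|)).
  rewrite !mulr_sumr -big_split/=; apply: ler_sum => i _.
  rewrite (_ : _ - _ = p * (f (r i) - f (l i)) + q * (g (r i) - g (l i))); last by ring.
  by rewrite (le_trans (ler_normD _ _))// !normrM.
apply: (@le_lt_trans _ _ ((`|p| + `|q|) * (e / K))).
  by rewrite mulrDl lerD// ler_wpM2l// ltW.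
rewrite mulrA ltr_pdivrMr// mulrC ltr_pM2l// /K ltrDl//.
Qed.

Lemma abs_continuous_cont a b f e : abs_continuous a b f -> 0 < e ->
  exists2 d, 0 < d & forall x y, a <= x -> x <= y -> y <= b -> y - x < d -> `|f y - f x| <= e.
Proof.
move=> /abs_continuous_chain ac /ac[d d0 H]; exists d => // x y ax xy yb xyd.
have := H [:: (x, y)]; rewrite /chain/= ax xy yb /len /osc !big_cons !big_nil/= !addr0.
exact.
Qed.

(** Nothing is known of [f] outside [[0, b]]; composing with [clamp] gives a function continuous on
    the line that has the same derivative inside. *)
Lemma ac_measurable_derive1 b t f : 0 < b -> abs_continuous 0 b f -> t <= b ->
  measurable_fun `]0, t[ (derive1 f).
Proof.
move=> b0 acf tb.
pose clip := clamp 0 b.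
have clip_cases := clamp_cases b0.
have clip_lip x y : x <= y -> [/\ 0 <= clip x, clip x <= clip y, clip y <= b & clip y - clip x <= y
  - x].
  move=> xy; have /andP[? _] := clamp_in b0 x; have /andP[_ ?] := clamp_in b0 y.
  by split=> //; [exact: clamp_nd|exact: clamp_lip].
pose F x := f (clip x).
have cF : continuous F.
  move=> x; apply/cvgrPdist_le => e e0.
  have [d d0 H] := abs_continuous_cont acf e0.
  apply/nbhs_ballP; exists d => // y; rewrite /ball/= => xyd.
  have [xy|yx] := leP x y.
    have [? ? ? ?] := clip_lip _ _ xy.
    rewrite distrC; apply: H => //; have := ler_norm (y - x); rewrite distrC; lra.
  have [? ? ? ?] := clip_lip _ _ (ltW yx).
  apply: H => //; have := ler_norm (x - y); lra.
apply: (@eq_measurable_fun _ _ _ _ _ (derive1 F)).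
  move=> x; rewrite inE/= in_itv/= => /andP[x0 xt].
  rewrite !derive1E; apply: near_eq_derive.
  have : x \in `]0, b[ by rewrite in_itv/= x0 (lt_le_trans xt).
  move=> /near_in_itvoo; apply: filterS => y; rewrite in_itv/= => /andP[y0 yb].
  rewrite /F /clip; case: (clip_cases y) => -[+ ->]//; first by rewrite leNgt y0.
  by rewrite leNgt yb.
by apply: measurable_funTS; exact: measurable_derive1.
Qed.

Lemma ac_ae_derivable b f : 0 < b -> abs_continuous 0 b f ->
  {ae mu, forall x, 0 < x < b -> derivable f x 1}.
Proof.
move=> b0 /(ac_density b0)[g [ig gE]].
have [A [mA A0 HA]] := density_derive b0 ig gE.
exists A; split => // x Hx; apply: HA => /= H; apply: Hx => x0.
by have [] := H x0.
Qed.

Lemma ae_eq_integrable (dT : measure_display) (T : measurableType dT) (m : {measure set T -> \bar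
  R})
    (D : set T) (f g : T -> \bar R) : measurable D -> measurable_fun D f ->
  m.-integrable D g -> ae_eq m D f g ->
  m.-integrable D f /\ (\int[m]_(x in D) f x = \int[m]_(x in D) g x)%E.
Proof.
move=> mD mf ig fg; have mg := measurable_int m ig; split; last exact: ae_eq_integral.
apply/integrableP; split => //; case/integrableP: ig => _; apply: le_lt_trans.
rewrite le_eqVlt; apply/orP; left; apply/eqP.
apply: ae_eq_integral => //; [exact: measurableT_comp..|].
by apply: filterS fg => x /= H Dx; rewrite H.
Qed.

Lemma measurable_caputo_integrand b rho t f : 0 < b -> abs_continuous 0 b f -> t <= b ->
  measurable_fun `]0, t[ (caputo_integrand rho f t).
Proof.
move=> b0 acf tb; apply: measurable_funM; first exact: (ac_measurable_derive1 b0).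
rewrite (_ : (fun x => _) = (fun x => (t - x) `^ (- rho))); last first.
  by apply/funext => x; rewrite powRN.
apply: (measurableT_comp (measurable_powR (- rho))).
by apply: measurable_funB.
Qed.

(** [derive1] is total and not linear at points where [f] or [g] fails to be derivable; absolute
    continuity makes these points a null set, so linearity holds after integration. *)
Lemma caputo_lin b rho t f g (p q : R) : 0 < b -> abs_continuous 0 b f ->
  abs_continuous 0 b g -> t <= b -> has_caputo rho f t -> has_caputo rho g t ->
  let h := fun x => p * f x + q * g x in
  has_caputo rho h t /\ caputo rho h t = p * caputo rho f t + q * caputo rho g t.
Proof.
move=> b0 acf acg tb hf hg h.
have ach : abs_continuous 0 b h by exact: abs_continuous_lin.
have mI : measurable (`]0, t[%classic : set (measurableTypeR R)) by [].
pose k x := p * caputo_integrand rho f t x + q * caputo_integrand rho g t x.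
have ik1 : mu.-integrable `]0, t[ (fun x => (p * caputo_integrand rho f t x)%:E).
  exact: (integrableZl mI p hf).
have ik2 : mu.-integrable `]0, t[ (fun x => (q * caputo_integrand rho g t x)%:E).
  exact: (integrableZl mI q hg).
have ik : mu.-integrable `]0, t[ (EFin \o k).
  rewrite (_ : EFin \o k = (fun x => (p * caputo_integrand rho f t x)%:E) \+
    (fun x => (q * caputo_integrand rho g t x)%:E))%E; first exact: integrableD.
  by apply/funext => x; rewrite /= EFinD.
have mh : measurable_fun `]0, t[ (fun x => (caputo_integrand rho h t x)%:E).
  by apply/measurable_EFinP; exact: (measurable_caputo_integrand rho b0).
have ehk : ae_eq mu (`]0, t[%classic : set (measurableTypeR R)) (fun x => (caputo_integrand rho h t
  x)%:E) (EFin \o k).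
  have [A [mA A0 HA]] := ac_ae_derivable b0 acf.
  have [B [mB B0 HB]] := ac_ae_derivable b0 acg.
  exists (A `|` B); split; first exact: measurableU.
    apply/eqP; rewrite -measure_le0.
    by apply: le_trans (measureU2 mu mA mB) _; rewrite -[leRHS]adde0; apply: leeD; rewrite
      measure_le0; apply/eqP; [exact: A0|exact: B0].
  move=> x Hx; apply: contrapT => /not_orP[nA nB]; apply: Hx.
  have df : 0 < x < b -> derivable f x 1 by apply: contrapT => /HA.
  have dg : 0 < x < b -> derivable g x 1 by apply: contrapT => /HB.
  rewrite /= in_itv/= => /andP[x0 xt].
  have xb : 0 < x < b by rewrite x0 (lt_le_trans xt).
  have {}df := df xb; have {}dg := dg xb.
  congr EFin; rewrite /caputo_integrand /k /caputo_integrand.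
  have -> : derive1 h x = p * derive1 f x + q * derive1 g x.
    rewrite !derive1E.
    have H1 : is_derive x 1 f ('D_1 f x) by exact/derivableP.
    have H2 : is_derive x 1 g ('D_1 g x) by exact/derivableP.
    have [] : is_derive x 1 h (p * 'D_1 f x + q * 'D_1 g x).
      rewrite /h; apply: is_deriveD; exact: is_deriveZ.
    by [].
  by ring.
have [ih Eh] := ae_eq_integrable mI mh ik ehk; split; first exact: ih.
rewrite /caputo [in LHS]/Rintegral Eh -/(Rintegral _ _ _).
have -> : \int[mu]_(x in `]0, t[) k x =
  p * \int[mu]_(x in `]0, t[) caputo_integrand rho f t x +
  q * \int[mu]_(x in `]0, t[) caputo_integrand rho g t x.
  by rewrite -RintegralZl// -RintegralZl// -RintegralD.
have distr (c x y : R) : c * (p * x + q * y) = p * (c * x) + q * (c * y) by ring.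
exact: distr.
Qed.

End caputo_linear.

Section caputo_extremum.
Context {R : realType}.
Implicit Types (b c s t x : R) (f g k : R -> R).
Local Notation mu := (@lebesgue_measure R).

(** The sum counts the positive integers up to [M] lying below [x]; with [count_lb] it is a
    discretisation of [x] from below with error at most 1. *)
Let count_ub (M : nat) x : 0 <= x -> \sum_(j < M) (j.+1%:R < x)%R%:R <= x.
Proof.
move=> x0; suff [] : \sum_(j < M) (j.+1%:R < x)%R%:R <= x /\ \sum_(j < M) (j.+1%:R < x)%R%:R <=
  M%:R :> R by [].
elim: M => [|M [IH1 IH2]]; first by rewrite big_ord0.
rewrite big_ord_recr/= -natr1; have [Mx|_] /= := ltP; split; rewrite ?addr0//; last 2 first.
- exact: lerD.
- by rewrite (le_trans IH2)// lerDl.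
by apply: (le_trans (lerD IH2 (lexx _))); exact: ltW.
Qed.

Let count_lb (M : nat) x : x <= M%:R -> x - 1 <= \sum_(j < M) (j.+1%:R < x)%R%:R.
Proof.
move=> xM; suff : Num.min (M%:R) (x - 1) <= \sum_(j < M) (j.+1%:R < x)%R%:R.
  by apply: le_trans; rewrite le_min lexx andbT; lra.
elim: {xM}M => [|M IH]; first by rewrite big_ord0 ge_min lexx.
rewrite big_ord_recr/= ge_min; have [Mx|Mx] /= := ltP; move: Mx; rewrite -[M.+1%:R]natr1 => Mx.
  by move: IH; rewrite ge_min => /orP[H|H]; apply/orP; lra.
by move: IH; rewrite ge_min => /orP[H|H]; apply/orP; right; rewrite addr0; lra.
Qed.

(* Layer-cake: [k] is a limit of nonnegative combinations of indicators of intervals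
   ending at [t]. *)
Lemma weighted_Rintegral_ge0 t g k :
  mu.-integrable `]0, t[ (EFin \o g) ->
  mu.-integrable `]0, t[ (fun x => (g x * k x)%:E) ->
  (forall s, 0 <= s <= t -> 0 <= \int[mu]_(x in `]s, t[) g x) ->
  (forall x, 0 < x < t -> 0 <= k x) ->
  (forall c, 0 < c -> exists2 s, 0 <= s <= t & forall x, 0 < x < t -> (c < k x) = (s < x)) ->
  0 <= \int[mu]_(x in `]0, t[) (g x * k x).
Proof.
move=> ig igk g0 k0 Hk.
have mI : measurable (`]0, t[%classic : set (measurableTypeR R)) by [].
(* Levels spaced by [1 / (n + 1)] and reaching up to [n + 1], so that [kk n] lies below [k] and is
   within [1 / (n + 1)] of it once [n + 1] exceeds the value of [k]. *)
pose kk n x : R := n.+1%:R^-1 * \sum_(j < n.+1 * n.+1) (j.+1%:R / n.+1%:R < k x)%R%:R.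
have kkE n x : kk n x = n.+1%:R^-1 * \sum_(j < n.+1 * n.+1) (j.+1%:R < n.+1%:R * k x)%R%:R.
  by congr (_ * _); apply: eq_bigr => j _; rewrite ltr_pdivrMr// mulrC.
have kk_ub n x : 0 < x < t -> 0 <= kk n x <= k x.
  move=> /k0 kx; rewrite kkE; apply/andP; split.
    by rewrite mulr_ge0// sumr_ge0.
  by rewrite ler_pdivrMl// count_ub// mulr_ge0.
have kk_cvg x : 0 < x < t -> kk ^~ x @ \oo --> k x.
  move=> xt; apply/cvgrPdist_le => e e0; near=> n.
  have /andP[_ u] := kk_ub n x xt.
  rewrite ger0_norm ?subr_ge0// lerBlDr -lerBlDl.
  have nk : n.+1%:R * k x <= (n.+1 * n.+1)%:R.
    rewrite natrM ler_pM2l//; near: n; exists (Num.trunc `|k x|) => // n /= kn.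
    apply: le_trans (ler_norm _) _; apply: le_trans (ltW (truncnS_gt _)) _.
    by rewrite ler_nat ltnS.
  rewrite kkE; have := count_lb nk; set S := \sum_(_ < _) _ => HS.
  rewrite ler_pdivlMl//; apply: le_trans HS.
  have ne : n.+1%:R^-1 <= e.
    near: n; have [m Hm] := ltr_add_invr e0; rewrite add0r in Hm; exists m => // n /= mn.
    by apply: le_trans (ltW Hm); rewrite lef_pV2 ?posrE// ler_nat.
  rewrite mulrBr lerD2l lerN2.
  by rewrite -ler_pdivrMl// mulr1.
pose G n j x : R := g x * (j.+1%:R / n.+1%:R < k x)%R%:R.
have GE n j : exists2 s, 0 <= s <= t & forall x, 0 < x < t -> G n j x = (g \_ `]s, +oo[) x.
  have [|s s0 Hs] := Hk (j.+1%:R / n.+1%:R); first by rewrite divr_gt0.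
  exists s => // x xt; rewrite /G Hs// patchE mem_setE in_itv/= andbT.
  by case: ifP => _; rewrite ?mulr1 ?mulr0.
have iG n j : mu.-integrable `]0, t[ (EFin \o G n j).
  have [s s0 E] := GE n j.
  apply: (@eq_integrable _ _ _ _ _ mI (EFin \o (g \_ `]s, +oo[))).
    by move=> x; rewrite inE/= in_itv/= => xt; rewrite E.
  rewrite -restrict_EFin; apply/integrable_restrict => //.
  by apply: (integrableS mI) => //; exact: measurableI.
have G0 n j : 0 <= \int[mu]_(x in `]0, t[) G n j x.
  have [s /andP[s0 st] E] := GE n j.
  have -> : \int[mu]_(x in `]0, t[) G n j x = \int[mu]_(x in `]0, t[) (g \_ `]s, +oo[) x.
    apply: eq_Rintegral; by move=> x; rewrite inE/= in_itv/= => xt; rewrite E.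
  rewrite -Rintegral_mkcondr (_ : _ `&` _ = `]s, t[%classic); first by rewrite g0// s0.
  apply/seteqP; split => x /=; rewrite !in_itv/=; first by case=> /andP[_ ->]; rewrite andbT => ->.
  by move=> /andP[sx ->]; rewrite sx (le_lt_trans s0).
have gkkE n x : g x * kk n x = n.+1%:R^-1 * \sum_(j < n.+1 * n.+1) G n j x.
  by rewrite /kk mulrCA mulr_sumr.
have iS n : mu.-integrable `]0, t[ (fun x => (\sum_(j < n.+1 * n.+1) G n j x)%:E).
  rewrite (_ : (fun x => _) = (fun x => \sum_(j < n.+1 * n.+1) (EFin \o G n j) x)%E).
    exact: integrable_sum.
  by apply/funext => x; rewrite -sumEFin.
have gkk0 n : (0 <= \int[mu]_(x in `]0%R, t[) (g x * kk n x)%:E)%E.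
  under eq_integral do rewrite gkkE EFinM.
  rewrite integralZl//; apply: mule_ge0; first by rewrite lee_fin.
  under eq_integral do rewrite -sumEFin.
  rewrite integral_sum//; last by move=> j; exact: iG.
  apply: sume_ge0 => j _; rewrite -[leRHS]fineK; first by rewrite lee_fin; exact: G0.
  by apply: integrable_fin_num => //; exact: iG.
have [|||||_ _ H] := @dominated_convergence _ _ _ mu _ mI (fun n x => (g x * kk n x)%:E)
   (fun x => (g x * k x)%:E) (fun x => `|(g x * k x)%:E|%E).
- move=> n; rewrite (_ : (fun x => _) = (fun x => n.+1%:R^-1%:E * (\sum_(j < n.+1 * n.+1) G n j
  x)%:E)%E); last first.
    by apply/funext => x; rewrite gkkE.
  by apply: measurable_funeM; exact: (measurable_int mu (iS n)).
- exact: (measurable_int mu igk).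
- apply: aeW => x; rewrite /= in_itv/= => xt; apply: cvg_EFin; first exact: nearW.
  by apply: cvgMr; exact: kk_cvg.
- exact: integrable_abse.
- apply: aeW => x n; rewrite /= in_itv/= => xt; rewrite lee_fin normrM [leRHS]normrM ler_wpM2l//.
  by have /andP[? ?] := kk_ub n x xt; rewrite [leRHS]ger0_norm ?ger0_norm// k0.
by rewrite fine_ge0//; apply: cvge_ge H; exact: nearW.
Unshelve. all: end_near. Qed.

(** The kernel is nonnegative and increases towards [t], hence is a superposition of indicators of
    intervals []s, t[]; over each of these the derivative integrates to [f t - f s], which is
    nonnegative at a maximum over the past. *)
Lemma caputo_extremum b rho t f : 0 < rho -> abs_continuous 0 b f ->
  0 < t <= b -> has_caputo rho f t -> (forall s, 0 <= s <= t -> f s <= f t) ->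
  0 <= caputo rho f t.
Proof.
move=> rho0 acf /andP[t0 tb] hf fmax.
have b0 : 0 < b by exact: lt_le_trans tb.
have mI : measurable (`]0, t[%classic : set (measurableTypeR R)) by [].
rewrite /caputo mulr_ge0//.
  rewrite invr_ge0; apply: Rintegral_ge0 => x _.
  by rewrite mulr_ge0 ?powR_ge0 ?expR_ge0.
have [g [ig gE]] := ac_density b0 acf.
pose k x := (t - x) `^ (- rho).
have mgk : measurable_fun `]0, t[ (fun x => (g x * k x)%:E).
  apply/measurable_EFinP; apply: measurable_funM.
    by apply/measurable_EFinP; apply: measurable_funTS; exact: (measurable_int mu ig).
  apply: (measurableT_comp (measurable_powR (- rho))).
  exact: measurable_funB.
have egk : ae_eq mu (`]0, t[%classic : set (measurableTypeR R)) (fun x => (g x * k x)%:E)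
    (fun x => (caputo_integrand rho f t x)%:E).
  have [A [mA A0 HA]] := density_derive b0 ig gE.
  exists A; split => // x Hx; apply: HA => H; apply: Hx; rewrite /= in_itv/= => /andP[x0 xt].
  have [|_ df] := H; first by rewrite x0 (lt_le_trans xt).
  by rewrite /caputo_integrand derive1E df /k powRN.
have [igk Egk] := ae_eq_integrable mI mgk hf egk.
rewrite /Rintegral -Egk; apply: weighted_Rintegral_ge0.
- exact: (integrableS measurableT).
- exact: igk.
- move=> s /andP[s0 st].
  rewrite Rintegral_itv_bndo_bndc; last exact: (integrableS measurableT).
  by rewrite -gE ?subr_ge0 ?fmax ?s0.
- by move=> x _; exact: powR_ge0.
move=> c c0; exists (Num.max 0 (t - c `^ (- rho^-1))).
  by rewrite le_max lexx ge_max (ltW t0) lerBlDr lerDl powR_ge0.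
move=> x /andP[x0 xt]; rewrite gt_max x0/= ltrBlDr -ltrBlDl /k.
have tx0 : 0 < t - x by rewrite subr_gt0.
have [d [d0 dE cE]] : exists d, [/\ 0 < d, d = c `^ (- rho^-1) & c = d `^ (- rho)].
  exists (c `^ (- rho^-1)); split; rewrite ?powR_gt0//.
  by rewrite -powRrM mulrNN mulVf ?gt_eqF// powRr1 ?ltW.
rewrite -dE cE !powRN ltf_pV2 ?posrE ?powR_gt0//.
have dn : d \is Num.nneg by rewrite nnegrE ltW.
have xn : t - x \is Num.nneg by rewrite nnegrE ltW.
apply/idP/idP; last exact: gt0_ltr_powR.
by apply: contraTT; rewrite -!leNgt; apply: ge0_ler_powR => //; exact: ltW.
Qed.

End caputo_extremum.

(** * Maximum principle for positive times *)

Section fractional_maximum.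
Context {R : realType} (N : nat).
Hypothesis hN : (0 < N)%N.
Variables (Omega : set 'rV[R]_N) (rho beta : R) (z : 'rV[R]_N -> R -> R).
Hypotheses (bO : bounded_set Omega) (oO : open Omega).
Hypotheses (rho0 : 0 < rho) (beta0 : 0 < beta).
Hypothesis cz : {within closure Omega `*` `[0, beta], continuous (fun p => z p.1 p.2)}.
Hypothesis zb : forall x t, bnd Omega x -> 0 <= t <= beta -> z x t = 0.
Hypothesis z0 : forall x, closure Omega x -> z x 0 = 0.
Hypothesis zac : forall x, Omega x -> abs_continuous 0 beta (z x).
Hypothesis zl : forall x t, Omega x -> 0 < t <= beta -> has_laplacian (z^~ t) x.
Hypothesis zh : forall x t, Omega x -> 0 < t <= beta -> has_caputo rho (z x) t.
Hypothesis zE : forall x t, Omega x -> 0 < t <= beta ->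
  caputo rho (z x) t = laplacian (z^~ t) x.

Let K := closure Omega `*` `[0, beta]%classic.

(* At an interior maximum of [z + e |x|^2] the Laplacian of [z] is at most [- 2 N e], while its
   Caputo derivative is nonnegative. *)
Lemma fractional_maximum_principle x t : closure Omega x -> 0 <= t <= beta -> z x t <= 0.
Proof.
move=> Ox tb; rewrite leNgt; apply/negP => zxt.
have cK : compact K.
  by apply: compact_setX; [exact: compact_closure_bounded|exact: segment_compact].
have [M M0 HM] : exists2 M : R, 0 < M & forall y, closure Omega y -> sqn y <= M.
  have [M [_ HM]] : bounded_set (@sqn R N @` closure Omega).
    apply/compact_bounded/continuous_compact; last exact: compact_closure_bounded.
    exact/continuous_subspaceT/continuous_sqn.
  exists (Num.max M 0 + 1); first by rewrite ltr_wpDl// le_max lexx orbT.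
  move=> y Oy; apply: le_trans (ler_norm _) _; apply: HM; last by exists y.
  by rewrite ltr_pwDr// le_max lexx.
(* The perturbation adds at most [e * M], half of the supposed positive value, so that [z] itself is
   still positive at the maximum of the perturbed function; this excludes the boundary and time
   0. *)
pose e := z x t / (2 * M).
have e0 : 0 < e by rewrite divr_gt0// mulr_gt0.
have eM : e * M < z x t.
  have -> : e * M = z x t / 2 by rewrite /e; field; rewrite gt_eqF.
  by lra.
pose w (p : 'rV[R]_N * R) := z p.1 p.2 + e * sqn p.1.
have cw : {within K, continuous w}.
  move=> p; apply: (@continuousD _ _ _ (fun p : subspace K => z p.1 p.2) (fun p => e * sqn p.1));
    first exact: cz.
  apply: continuous_subspaceT => q.
  apply: (@continuousM _ _ (cst e) (fun p => sqn p.1)); first exact: cst_continuous.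
  by apply: continuous_comp; [exact: cvg_fst|exact: continuous_sqn].
have Kxt : K (x, t) by split.
have [[x0 t0] Kp wmax] := compact_EVT_max (ex_intro _ _ Kxt) cK cw.
move: Kp; rewrite inE => -[/= Ox0]; rewrite in_itv/= => t0b.
have wxt : z x t <= z x0 t0 + e * sqn x0.
  apply: le_trans (wmax (x, t) _); last by rewrite inE.
  by rewrite /w/= lerDl mulr_ge0 ?sqn_ge0// ltW.
have zpos : 0 < z x0 t0.
  have : e * sqn x0 <= e * M by rewrite ler_pM2l// HM.
  by lra.
have Oi : Omega x0.
  by apply: contrapT => nO; move: zpos; rewrite zb ?ltxx//.
have t0b' : 0 < t0 <= beta.
  case/andP: t0b => t00 ->; rewrite andbT lt_neqAle t00 andbT.
  by apply/negP => /eqP E; move: zpos; rewrite -E z0 ?ltxx.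
(* At the fixed point [x0] the perturbation does not depend on time, so [z x0] is itself maximal at
   [t0] over the past. *)
have c0 : 0 <= caputo rho (z x0) t0.
  apply: (caputo_extremum rho0 (zac Oi) t0b' (zh Oi t0b')) => s /andP[s0 st].
  have := wmax (x0, s); rewrite /w/= lerD2r; apply.
  by rewrite inE; split => //=; rewrite in_itv/= s0 (le_trans st)//; case/andP: t0b.
(* Tolerance for the discrete Laplacian: it lies below [- 2 * N * e], so an error of [N * e] still
   contradicts a nonnegative Caputo derivative. *)
have Ne : 0 < N%:R * e by rewrite mulr_gt0// ltr0n.
have [r r0 Hr] := dlap_cvg (zl Oi t0b') Ne.
have [r' r'0 Hr'] := nbhs_evec (open_nbhs_nbhs (conj oO Oi)).
pose h := Num.min r r'.
have h0 : 0 < h by rewrite lt_min r0.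
have := Hr h h0; rewrite ge_min lexx => /(_ isT).
rewrite -(zE Oi t0b').
have : dlap h (z^~ t0) x0 <= - (2 * (N%:R * e)).
  apply: (@le_trans _ _ (\sum_(i < N) (- (2 * e)))); last first.
    by rewrite sumr_const card_ord -mulr_natl; lra.
  apply: ler_sum => i _.
  have hs (s : R) : `|s| <= h -> z (x0 + s *: evec i) t0 + e * sqn (x0 + s *: evec i) <= z x0 t0 +
    e * sqn x0.
    move=> sh; apply: (wmax (x0 + s *: evec i, t0)); rewrite inE; split => /=; last by rewrite
      ?in_itv/=.
    by apply: subset_closure; apply: Hr'; rewrite (le_trans sh)// ge_min lexx orbT.
  have h1 := hs h; have h2 := hs (- h); rewrite normrN gtr0_norm// in h1 h2.
  have {}h1 := h1 (lexx _); have {}h2 := h2 (lexx _).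
  rewrite scaleNr in h2.
  have := @diff2_sqn R N h i x0; rewrite gt_eqF// => /(_ isT).
  rewrite /diff2 => /(canRL (divfK _)); rewrite gt_eqF ?exprn_gt0// => /(_ isT) H.
  rewrite ler_pdivrMr ?exprn_gt0//.
  have : e * (sqn (x0 + h *: evec i) + sqn (x0 - h *: evec i) - 2 * sqn x0) = e * (2 * h ^+ 2) by
    rewrite H.
  rewrite mulrBr mulrDr; lra.
by move=> H1 /ler_normlP[H2 H3]; lra.
Qed.

End fractional_maximum.

(** * Uniqueness *)

Lemma within_continuous_lin (R : realType) (S : topologicalType) (A : set S)
    (f g h : S -> R) (p q : R) :
  {within A, continuous f} -> {within A, continuous g} ->
  (forall x, A x -> h x = p * f x + q * g x) -> {within A, continuous h}.
Proof.
move=> cf cg hE.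
apply: (@subspace_eq_continuous _ A _ (fun x => p * f x + q * g x : R)).
  by move=> x; rewrite inE => Ax; exact/esym/hE.
move=> x; apply: (@continuousD _ _ _ (fun x : subspace A => p * f x) (fun x => q * g x)).
  by apply: (@continuousM _ _ (cst p) (f : subspace A -> R)); [exact: cst_continuous|exact: cf].
by apply: (@continuousM _ _ (cst q) (g : subspace A -> R)); [exact: cst_continuous|exact: cg].
Qed.

Section linearity.
Context {R : realType} (N : nat).
Implicit Types (f g : 'rV[R]_N -> R) (x : 'rV[R]_N) (p q : R).

Let is_derive_lin (V : normedModType R) (f g : V -> R) (x d : V) p q :
  derivable f x d -> derivable g x d ->
  is_derive x d (fun y => p * f y + q * g y) (p * 'D_d f x + q * 'D_d g x).
Proof.
move=> df dg.
have H1 : is_derive x d f ('D_d f x) by exact/derivableP.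
have H2 : is_derive x d g ('D_d g x) by exact/derivableP.
by apply: is_deriveD; exact: is_deriveZ.
Qed.

Lemma laplacian_lin f g x p q : has_laplacian f x -> has_laplacian g x ->
  let h y := p * f y + q * g y in
  has_laplacian h x /\ laplacian h x = p * laplacian f x + q * laplacian g x.
Proof.
move=> lf lg h.
have H i : is_derive x (evec i) (partial i h)
    (p * partial i (partial i f) x + q * partial i (partial i g) x).
  have [df ddf] := lf i; have [dg ddg] := lg i.
  have [D1 D2] := is_derive_lin p q ddf ddg.
  have E : {near x, (fun y => p * partial i f y + q * partial i g y) =1 partial i h}.
    apply: filterS2 df dg => y dfy dgy.
    by have [_] := is_derive_lin p q dfy dgy.
  apply: DeriveDef; first exact: near_eq_derivable E D1.
  by rewrite -(near_eq_derive _ E).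
split.
  move=> i; split; last by have [] := H i.
  have [df _] := lf i; have [dg _] := lg i.
  apply: filterS2 df dg => y dfy dgy.
  by have [] := is_derive_lin p q dfy dgy.
rewrite /laplacian !mulr_sumr -big_split/=; apply: eq_bigr => i _.
by have [_] := H i.
Qed.

Variables (rho alpha beta : R) (Omega : set 'rV[R]_N).
Implicit Types (u w F G H : 'rV[R]_N -> R -> R).
Hypothesis beta0 : 0 < beta.

Lemma dezin_solution_lin (lambda p q : R) F G H u w :
  dezin_solution rho alpha beta Omega lambda F u ->
  dezin_solution rho alpha beta Omega lambda G w ->
  (forall x t, H x t = p * F x t + q * G x t) ->
  dezin_solution rho alpha beta Omega lambda H (fun x t => p * u x t + q * w x t).
Proof.
move=> [[cu au [lu [gu cgu guE]] [hu ccu] [du cdu]] [Eu1 Eu2 Eu3 Eu4 Eu5]].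
move=> [[cw aw [lw [gw cgw gwE]] [hw ccw] [dw cdw]] [Ew1 Ew2 Ew3 Ew4 Ew5]] HE.
have sO x : Omega x -> closure Omega x by exact: subset_closure.
have pos t : 0 < t <= beta -> nonzero_times alpha beta t by right; rewrite /= in_itv.
have neg t : - alpha < t < 0 -> nonzero_times alpha beta t by left; rewrite /= in_itv.
have cap x t : closure Omega x -> 0 < t <= beta ->
    has_caputo rho (fun s => p * u x s + q * w x s) t /\
    caputo rho (fun s => p * u x s + q * w x s) t =
    p * caputo rho (u x) t + q * caputo rho (w x) t.
  move=> Ox tb; have /andP[_ tb'] := tb.
  exact: (caputo_lin p q beta0 (au x Ox) (aw x Ox) tb' (hu _ _ Ox tb) (hw _ _ Ox tb)).
have der x t : closure Omega x -> - alpha < t < 0 ->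
    is_derive t 1 (fun s => p * u x s + q * w x s) (p * derive1 (u x) t + q * derive1 (w x) t).
  by move=> Ox ta; rewrite !derive1E; apply: is_derive_lin; [exact: du|exact: dw].
split.
  split.
  - exact: within_continuous_lin cu cw _.
  - by move=> x Ox; apply: abs_continuous_lin; [exact: au|exact: aw].
  - split.
      by move=> x t Ox nt; have [] := laplacian_lin p q (lu x t Ox nt) (lw x t Ox nt).
    exists (fun z => p * gu z + q * gw z); first exact: within_continuous_lin cgu cgw _.
    move=> x t Ox nt; rewrite guE// gwE//.
    by have [] := laplacian_lin p q (lu x t Ox nt) (lw x t Ox nt).
  - split; first by move=> x t Ox tb; have [] := cap x t Ox tb.
    apply: (within_continuous_lin (p := p) (q := q) ccu ccw) => -[x t] /= [Ox].
    by rewrite /= in_itv/= => tb; have [] := cap x t Ox tb.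
  - split; first by move=> x t Ox ta; have [] := der x t Ox ta.
    apply: (within_continuous_lin (p := p) (q := q) cdu cdw) => -[x t] /= [Ox].
    by rewrite /= in_itv/= => ta; have [_] := der x t Ox ta; rewrite -derive1E.
split.
- move=> x t Ox tb; have [_ ->] := cap x t (sO x Ox) tb.
  have [_ ->] := laplacian_lin p q (lu x t Ox (pos t tb)) (lw x t Ox (pos t tb)).
  rewrite HE -Eu1// -Ew1// !mulrBr addrACA opprD; exact: erefl.
- move=> x t Ox ta; have [_] := der x t (sO x Ox) ta; rewrite -derive1E => ->.
  have [_ ->] := laplacian_lin p q (lu x t Ox (neg t ta)) (lw x t Ox (neg t ta)).
  rewrite HE -Eu2// -Ew2// !mulrDr addrACA; exact: erefl.
- by move=> x t bx tb; rewrite Eu3// Ew3// !mulr0 addr0.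
- move=> x Ox; have [l [l1 l2]] := Eu4 x Ox; have [l' [l'1 l'2]] := Ew4 x Ox.
  by exists (p * l + q * l'); split; apply: cvgD; apply: cvgMr.
- by move=> x Ox; rewrite Eu5// Ew5// mulrDr !(mulrCA lambda).
Qed.

End linearity.

Section homogeneous_uniqueness.
Context {R : realType} (N : nat).
Variables (rho alpha beta lambda : R) (Omega : set 'rV[R]_N).
Variables (v : nat -> 'rV[R]_N -> R) (lam : nat -> R).
Hypotheses (hN : (0 < N)%N) (rho0 : 0 < rho) (alpha0 : 0 < alpha) (beta0 : 0 < beta).
Hypotheses (oO : open Omega) (bO : bounded_set Omega).
Hypothesis hv : forall k, dirichlet_eigenfunction Omega (lam k) (v k).
Hypothesis hcomplete : complete_orthonormal_system Omega v.
Hypothesis delta : forall k, expR (- lam k * alpha) - lambda != 0.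
Implicit Types z : 'rV[R]_N -> R -> R.
Local Notation homogeneous := (dezin_solution rho alpha beta Omega lambda (fun _ _ => 0)).

Let sub_times z a b : - alpha <= a -> b <= beta ->
  {within closure Omega `*` `[- alpha, beta], continuous (fun p => z p.1 p.2)} ->
  {within closure Omega `*` `[a, b], continuous (fun p => z p.1 p.2)}.
Proof.
move=> a0 b0; apply: continuous_subspaceW => -[x t] [/= Ox]; rewrite !in_itv/= => /andP[ta tb].
by split => //; rewrite (le_trans a0 ta) (le_trans tb b0).
Qed.

Lemma homogeneous_backward_eq0 z x t : homogeneous z -> closure Omega x ->
  - alpha <= t <= 0 -> z x t = 0.
Proof.
move=> [[cz _ [lz [g cg gE]] _ [dz cdz]] [_ E2 E3 _ E5]] Ox tb.
have cz0 := sub_times (lexx _) (ltW beta0) cz.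
have neg s : - alpha < s < 0 -> nonzero_times alpha beta s by left; rewrite /= in_itv.
have sO y : Omega y -> closure Omega y by exact: subset_closure.
have zb y s : bnd Omega y -> - alpha <= s <= 0 -> z y s = 0.
  by move=> yb /andP[s1 s2]; apply: E3 => //; rewrite s1 (le_trans s2)// ltW.
have csl s : - alpha <= s <= 0 -> {within closure Omega, continuous (z^~ s)}.
  by move=> ?; apply: (within_continuous_slice (t := s) cz0); rewrite /= in_itv.
have cg' : {within closure Omega `*` `]- alpha, 0[, continuous g}.
  by apply: continuous_subspaceW cg => -[y s] [Oy ?]; split => //; left.
apply: (complete_eq0 oO bO hcomplete (csl t tb)) => // [y yb|k]; first exact: zb.
pose T s := \int[lebesgue_rV N]_x (zext Omega (z^~ s) x * zext Omega (v k) x).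
have TE s : - alpha <= s <= 0 -> T s = T (- alpha) * expR (lam k * (s + alpha)).
  apply: (backward_mode oO bO (hv k) cz0 zb _ cg' _ dz cdz) => // y r Oy rb.
  - by apply: lz => //; exact: neg.
  - by apply: gE => //; exact: neg.
have tz s : - alpha <= s <= 0 -> tame (zext Omega (z^~ s)).
  by move=> sb; apply: tame_zext => //; exact: csl.
have tV : tame (zext Omega (v k)).
  by have [L _] := eigenfunction_lap_on oO bO (hv k); exact: (lap_tameZ bO L).
have a0 : - alpha <= 0 <= (0 : R) by rewrite lexx oppr_le0 ltW.
have aa : - alpha <= - alpha <= (0 : R) by rewrite lexx oppr_le0 ltW.
have Ta : T (- alpha) = lambda * T 0.
  rewrite /T -RintegralZl//; last exact: tame_integrable (tameMr (tz _ a0) tV).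
  apply: eq_Rintegral => y _; rewrite mulrA; congr (_ * _).
  have [Oy|Oy] := pselect (Omega y); first by rewrite !zextE// E5.
  by rewrite !zext0// mulr0.
suff T0 : T 0 = 0 by have := TE t tb; rewrite Ta T0 mulr0 mul0r.
have := TE 0 a0; rewrite Ta add0r => T0E.
have : (expR (- lam k * alpha) - lambda) * T 0 = 0.
  rewrite mulrBl {1}T0E mulrCA mulNr expRN mulVf ?mulr1 ?subrr//.
  by rewrite gt_eqF ?expR_gt0.
by move=> /eqP; rewrite mulf_eq0 (negbTE (delta k)) => /eqP.
Qed.

Let homogeneous_forward_le0 z x t : homogeneous z -> closure Omega x ->
  0 <= t <= beta -> z x t <= 0.
Proof.
move=> hz Ox tb; have [[cz az [lz _] [hc _] _] [E1 _ E3 _ _]] := hz.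
have a0 : - alpha <= 0 by rewrite oppr_le0 ltW.
have sO y : Omega y -> closure Omega y by exact: subset_closure.
apply: (@fractional_maximum_principle R N hN Omega rho beta z) => //.
- exact: sub_times (lexx _) cz.
- by move=> y s yb /andP[s0 s1]; apply: E3 => //; rewrite (le_trans a0).
- by move=> y Oy; apply: homogeneous_backward_eq0 => //; rewrite lexx a0.
- by move=> y Oy; apply/az/sO.
- by move=> y s Oy sb; apply: lz => //; right; rewrite /= in_itv.
- by move=> y s Oy sb; apply: hc => //; exact: sO.
- by move=> y s Oy sb; apply/eqP; rewrite -subr_eq0 E1.
Qed.

Lemma homogeneous_eq0 z x t : homogeneous z -> closure Omega x ->
  - alpha <= t <= beta -> z x t = 0.
Proof.
move=> hz Ox /andP[at_ tb]; have [t0|t0] := leP t 0.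
  by apply: homogeneous_backward_eq0 => //; rewrite at_.
have tb' : 0 <= t <= beta by rewrite ltW.
apply/eqP; rewrite eq_le (homogeneous_forward_le0 hz)//=.
(* The negative of [z], as a degenerate linear combination; the maximum principle applied to it
   gives the lower bound. *)
have hz' : homogeneous (fun x t => -1 * z x t + 0 * z x t).
  by apply: (dezin_solution_lin beta0 hz hz) => *; rewrite !mulr0 addr0.
by have := homogeneous_forward_le0 hz' Ox tb'; rewrite mul0r addr0 mulN1r oppr_le0.
Qed.

Lemma dezin_uniqueness F : dezin_unique rho alpha beta Omega lambda F.
Proof.
move=> u w hu hw x t Ox tb.
have hz : homogeneous (fun x t => 1 * u x t + -1 * w x t).
  apply: (dezin_solution_lin beta0 hu hw) => y s; rewrite mul1r mulN1r subrr//.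
by have := homogeneous_eq0 hz Ox tb; rewrite mul1r mulN1r => /eqP; rewrite subr_eq0 => /eqP.
Qed.

End homogeneous_uniqueness.

(** * The Mittag-Leffler function *)


Section power_integrals.
Context {R : realType}.
Implicit Types (a b p t x : R) (f F : R -> R).
Local Notation mu := (@lebesgue_measure R).

(** The integrand may be unbounded at both ends; the theorem on closed subintervals and monotone
    convergence give the open interval. *)
Lemma FTC_oo a b f F : a < b -> (forall x, a < x < b -> 0 <= f x) ->
  (forall x, a < x < b -> {for x, continuous f}) ->
  (forall x, a < x < b -> is_derive x 1 F (f x)) ->
  F x @[x --> a^'+] --> F a -> F x @[x --> b^'-] --> F b ->
  (\int[mu]_(x in `]a, b[) (f x)%:E = (F b - F a)%:E)%E.
Proof.
move=> ab f0 cf dF Fa Fb.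
(* The shift to [n.+2] keeps [d n] below half the length, so that the interval is nondegenerate
   already for [n = 0]. *)
pose d n := (b - a) / 2 * n.+2%:R^-1.
have ba : 0 < (b - a) / 2 by rewrite divr_gt0// subr_gt0.
have d0 n : 0 < d n by rewrite /d mulr_gt0.
have dlt n : d n < (b - a) / 2 by rewrite /d gtr_pMr// invf_lt1// ltr1n.
have dd m n : (m <= n)%N -> d n <= d m.
  by move=> mn; rewrite /d ler_pM2l// lef_pV2 ?posrE// ler_nat.
have d_cvg : d @ \oo --> (0 : R).
  rewrite -[X in _ --> X](mulr0 ((b - a) / 2)); apply: cvgMr.
  have : (n.+1%:R^-1 : R) @[n --> \oo] --> (0 : R) by exact: cvg_harmonic.
  by move=> H; rewrite -(cvg_shiftS (fun n => n.+1%:R^-1 : R)) in H.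
pose I n := `[a + d n, b - d n]%classic.
have II : `]a, b[%classic = \bigcup_n I n.
  apply/seteqP; split => x /=; last first.
    move=> [n _]; rewrite /I/= !in_itv/= => /andP[h1 h2]; have := d0 n; move: h1 h2.
    by move: (d n) => e h1 h2 e0; apply/andP; split; lra.
  rewrite in_itv/= => /andP[ax xb].
  have /cvgrPdist_lt/(_ (Num.min (x - a) (b - x))) := d_cvg.
  rewrite lt_min !subr_gt0 ax xb => /(_ isT)[n _ /(_ n (leqnn _))]/=.
  rewrite sub0r normrN gtr0_norm// lt_min => /andP[h1 h2].
  exists n => //; rewrite /I/= in_itv/=; move: h1 h2; move: (d n) => e h1 h2.
  by apply/andP; split; lra.
have inI n x : I n x -> a < x < b.
  by move=> Ix; have : `]a, b[%classic x by rewrite II; exists n.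
have FTC n : (\int[mu]_(x in I n) (f x)%:E = (F (b - d n) - F (a + d n))%:E)%E.
  have ab' : a + d n < b - d n by have := dlt n; move: (d n) => e h; lra.
  rewrite EFinB; apply: (continuous_FTC2 ab').
  - by apply: continuous_in_subspaceT => x; rewrite inE => /inI; exact: cf.
  - have C x : I n x -> {for x, continuous F}.
      by move=> /inI/dF[dx _]; apply: differentiable_continuous; exact/derivable1_diffP.
    split.
    + move=> x; rewrite in_itv/= => /andP[x1 x2].
      by have [] := dF x; [apply: (inI n); rewrite /I/= in_itv/= !ltW|].
    + apply: cvg_at_right_filter; apply: C; rewrite /I/= in_itv/= lexx ltW//.
    + apply: cvg_at_left_filter; apply: C; rewrite /I/= in_itv/= lexx ltW//.
  - move=> x; rewrite in_itv/= => /andP[x1 x2]; rewrite derive1E.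
    by have [] := dF x; [apply: (inI n); rewrite /I/= in_itv/= !ltW|].
rewrite II; apply: (@cvg_unique _ _ (\int[mu]_(x in I n) (f x)%:E @[n --> \oo])%E) => //.
- apply: ge0_nondecreasing_set_cvg_integral.
  + move=> m n /dd mn; apply/subsetPset => x; rewrite /I/= !in_itv/= => /andP[h1 h2].
    by move: mn h1 h2; move: (d n) (d m) => e e' ? ? ?; apply/andP; split; lra.
  + by move=> n; exact: measurable_itv.
  + move=> n; apply/measurable_EFinP; apply: subspace_continuous_measurable_fun; first exact:
    measurable_itv.
    by apply: continuous_in_subspaceT => x; rewrite inE => /inI; exact: cf.
  + by move=> n x /inI; rewrite lee_fin; exact: f0.
rewrite /= (_ : (fun n => _) = (fun n => (F (b - d n) - F (a + d n))%:E)); last first.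
  by apply/funext => n; exact: FTC.
apply: cvg_EFin; first exact: nearW.
apply: cvgB.
  have /cvg_at_leftP := Fb; apply; split; first by move=> n; rewrite ltrBlDr ltrDl.
  by rewrite -[X in _ --> X]subr0; apply: cvgB => //; exact: cvg_cst.
have /cvg_at_rightP := Fa; apply; split; first by move=> n; rewrite ltrDl.
by rewrite -[X in _ --> X]addr0; apply: cvgD => //; exact: cvg_cst.
Qed.

Lemma integral_powR p a b : 0 < p -> 0 <= a -> a < b ->
  (\int[mu]_(x in `]a, b[) (p * x `^ (p - 1))%:E = (b `^ p - a `^ p)%:E)%E.
Proof.
move=> p0 a0 ab; have b0 : 0 < b by exact: le_lt_trans ab.
have pos x : a < x -> 0 < x by exact: le_lt_trans.
have D q x : 0 < x -> is_derive x 1 (fun x : R => x `^ q) (q * x `^ (q - 1)) by move=> x0; exact: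
  is_derive1_powR.
have C q x : 0 < x -> {for x, continuous (fun x => x `^ q)}.
  move=> /(D q)[dx _]; apply: differentiable_continuous; exact/derivable1_diffP.
apply: (@FTC_oo a b _ (fun x => x `^ p)) => //.
- by move=> x _; rewrite mulr_ge0 ?powR_ge0// ltW.
- move=> x /andP[/pos x0 _]; apply: (@continuousM _ _ (cst p) (fun x => x `^ (p - 1)) x); first
  exact: cst_continuous.
  exact: C.
- by move=> x /andP[/pos x0 _]; exact: D.
- move: a0; rewrite le_eqVlt => /predU1P[<-|a0].
    by rewrite powR0 ?gt_eqF//; exact: powR_cvg0.
  exact/cvg_at_right_filter/C.
- exact/cvg_at_left_filter/C.
Qed.

Lemma integral_powR_reflect p b : 0 < p -> 0 < b ->
  (\int[mu]_(x in `]0%R, b[) (p * (b - x) `^ (p - 1))%:E = (b `^ p)%:E)%E.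
Proof.
move=> p0 b0; have pos x : x < b -> 0 < b - x by rewrite subr_gt0.
have D q x : x < b -> is_derive x 1 (fun x => (b - x) `^ q) (- (q * (b - x) `^ (q - 1))).
  move=> /pos bx; have H1 := is_derive1_powR q bx.
  have H2 : is_derive x 1 (fun x : R => b - x) (- 1) by rewrite -[- 1]sub0r; apply: (@is_deriveB _
    _ _ (cst b) id).
  have := @is_derive1_comp _ (fun x : R => x `^ q) (fun x => b - x) x _ _ H1 H2.
  by rewrite mulrN1.
have C q x : x < b -> {for x, continuous (fun x => (b - x) `^ q)}.
  move=> /(D q)[dx _]; apply: differentiable_continuous; exact/derivable1_diffP.
have -> : b `^ p = - (b - b) `^ p - (- (b - 0) `^ p).
  by rewrite subrr powR0 ?gt_eqF// subr0 opprK oppr0 add0r.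
apply: (@FTC_oo 0 b _ (fun x => - (b - x) `^ p)) => //.
- by move=> x _; rewrite mulr_ge0 ?powR_ge0// ltW.
- move=> x /andP[_ xb]; apply: (@continuousM _ _ (cst p) (fun x => (b - x) `^ (p - 1)) x); first
  exact: cst_continuous.
  exact: C.
- by move=> x /andP[_ xb]; rewrite -[p * _]opprK; apply: is_deriveN; exact: D.
- by apply: cvgN; exact/cvg_at_right_filter/C.
- apply: cvgN; rewrite subrr powR0 ?gt_eqF//.
  apply/cvg_at_leftP => u [ub uc].
  have H := powR_cvg0 p0; move/cvg_at_rightP: H; apply; split; first by move=> n; exact: pos.
  by rewrite -[X in _ --> X](subrr b); apply: cvgB => //; exact: cvg_cst.
Qed.

(** The image of Lebesgue measure under [x |-> a * x], multiplied by [a], has the right value on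
    half-open intervals and so is Lebesgue measure. *)
Lemma ge0_integral_scale a b f : 0 < a -> measurable_fun setT f -> (forall x, 0 <= f x) ->
  (\int[mu]_(x in `]0%R, (a * b)%R[) (f x)%:E =
   a%:E * \int[mu]_(x in `]0%R, b[) (f (a * x))%:E)%E.
Proof.
move=> a0 mf f0.
have ms : measurable_fun setT ((fun x => a * x) : measurableTypeR R -> measurableTypeR R).
  exact: measurable_funM.
pose m1 := measure_function_pushforward__canonical__measure_function_Measure
  (@lebesgue_measure R) ms.
have a0' : 0 <= a by exact: ltW.
pose m := mscale (NngNum a0') m1.
have mE (A : set R) : measurable A -> m A = mu A.
  move=> mA; apply/esym; apply: (@lebesgue_measure_unique R m) => //= _ [[x y]] _ <-.
  rewrite /m /= /mscale/= /pushforward (_ : _ @^-1` _ = `]x / a, y / a]%classic); last first.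
    by apply/seteqP; split => z /=; rewrite !in_itv/= ltr_pdivrMr// ler_pdivlMr// mulrC.
  rewrite !lebesgue_measure_itv/= !lte_fin ltr_pM2r ?invr_gt0//.
  case: ifP => _; last by rewrite mule0.
  rewrite -!EFinB -EFinM; congr EFin; rewrite mulrBr !(mulrC a) !divfK// gt_eqF//.
transitivity (\int[m]_(x in `]0%R, (a * b)%R[) (f x)%:E)%E.
  by apply: eq_measure_integral => A mA _; apply/esym; exact: mE.
have mfE : measurable_fun (`]0, (a * b)[%classic : set (measurableTypeR R)) (EFin \o f).
  by apply/measurable_EFinP; exact: measurable_funTS.
rewrite ge0_integral_mscale//=; last by move=> x _; rewrite lee_fin.
congr (_ * _)%E; rewrite ge0_integral_pushforward//=; last by move=> x _; rewrite lee_fin.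
rewrite (_ : _ @^-1` _ = `]0%R, b[%classic)//.
apply/seteqP; split => z /=; rewrite !in_itv/= ltr_pM2l//.
  by rewrite pmulr_rgt0.
by rewrite pmulr_rgt0.
Qed.

End power_integrals.


(** * The Caputo kernel acting on powers *)

Section fractional_kernel.
Context {R : realType}.
Variable rho : R.
Hypotheses (rho01 : 0 < rho < 1).
Implicit Types (p t x : R).
Local Notation mu := (@lebesgue_measure R).

Let rho0 : 0 < rho. Proof. by case/andP: rho01. Qed.
Let rho1 : 0 < 1 - rho. Proof. by case/andP: rho01 => _; rewrite subr_gt0. Qed.

(** A divergent integral would make the real-valued [Gamma] equal to 0, so finiteness is part of the
    claim: near 0 the power is integrable, beyond 1 the exponential dominates. *)
Lemma Gamma_gt0 : 0 < Gamma (1 - rho).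
Proof.
pose G x := x `^ (1 - rho - 1) * expR (- x).
have G0 x : 0 <= G x by rewrite mulr_ge0 ?powR_ge0 ?expR_ge0.
have mG : measurable_fun setT G.
  apply: measurable_funM; first exact: measurable_powR.
  by apply: measurableT_comp => //; exact: measurableT_comp.
have mGE D : measurable D -> measurable_fun (D : set (measurableTypeR R)) (EFin \o G).
  by move=> mD; apply/measurable_EFinP; exact: measurable_funTS.
pose I D := (\int[mu]_(x in D) (G x)%:E)%E.
have m01 : measurable (`]0, 1[%classic : set (measurableTypeR R)) by [].
have m1y : measurable (`[1, +oo[%classic : set (measurableTypeR R)) by [].
have m0y : measurable (`]0, +oo[%classic : set (measurableTypeR R)) by [].
have I1 : (I `]0%R, 1%R[%classic < +oo)%E.
  apply: (@le_lt_trans _ _ (\int[mu]_(x in `]0%R, 1%R[) ((1 - rho)^-1%:E * ((1 - rho) * x `^ (1 -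
    rho - 1))%:E))%E).
    apply: ge0_le_integral => //.
    - by move=> x _; rewrite lee_fin.
    - exact: mGE.
    - apply/measurable_funeM/measurable_EFinP; apply: measurable_funM => //.
      exact: (measurable_funTS (@measurable_powR R _)).
    move=> x; rewrite /= in_itv/= => /andP[x0 x1].
    rewrite -EFinM lee_fin mulKf ?gt_eqF//.
    by rewrite ger_pMr ?powR_gt0// expR_le1 oppr_le0 ltW.
  rewrite ge0_integralZl//.
  - by rewrite integral_powR// -EFinM ltry.
  - apply/measurable_EFinP; apply: measurable_funM => //.
    exact: (measurable_funTS (@measurable_powR R _)).
  - by move=> x _; rewrite lee_fin mulr_ge0 ?powR_ge0// ltW.
  - by rewrite lee_fin invr_ge0 ltW.
have I2 : (I `[1%R, +oo[%classic < +oo)%E.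
  have /integrableP[_ H] := integrable_exponential_pdf (@ltr01 R).
  apply: le_lt_trans H.
  have mE : measurable_fun setT (fun x => `|(EFin \o exponential_pdf (1 : R)) x|)%E.
    by apply: measurableT_comp => //; apply/measurable_EFinP; exact: measurable_exponential_pdf.
  apply: (@le_trans _ _ (\int[mu]_(x in `[1%R, +oo[) `|(EFin \o exponential_pdf (1 : R)) x|)%E);
    last first.
    exact: ge0_subset_integral.
  apply: ge0_le_integral => //.
  - by move=> x _; rewrite lee_fin.
  - exact: mGE.
  - exact: measurable_funTS.
  move=> x; rewrite /= in_itv/= andbT => x1.
  have x0 : 0 <= x by exact: le_trans x1.
  rewrite lee_fin exponential_pdfE// mul1r mulN1r ger0_norm ?expR_ge0//.
  rewrite ler_piMl ?expR_ge0// -[leRHS](powRr0 x) ler_powR//.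
  by have := rho0; lra.
have E : I `]0, +oo[%classic = (I `]0%R, 1%R[%classic + I `[1%R, +oo[%classic)%E.
  rewrite -ge0_integral_setU//=.
  - congr (I _); apply/seteqP; split => x; rewrite /= !in_itv/= !andbT.
      by move=> x0; have [_|_] := ltP x 1; [left|right]; rewrite ?x0.
    by case=> [/andP[]//|]; exact: lt_le_trans.
  - by apply: mGE; exact: measurableU.
  - by move=> x _; rewrite lee_fin.
  - apply/disj_setPS => x [/=]; rewrite !in_itv/= andbT => /andP[_ h1 h2].
    by have := lt_le_trans h1 h2; rewrite ltxx.
have GE : Gamma (1 - rho) = fine (I `]0, +oo[%classic) by [].
rewrite GE fine_gt0//; apply/andP; split; last by rewrite E lte_add_pinfty.
rewrite E; apply: (@lt_le_trans _ _ (I `]0%R, 1%R[%classic)); last first.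
  by rewrite leeDl//; apply: integral_ge0 => x _; rewrite lee_fin.
(* On []0, 1[] the power is at least 1 because its exponent [- rho] is negative. *)
apply: (@lt_le_trans _ _ (\int[mu]_(x in `]0%R, 1%R[) (cst (expR (-1))%:E) x)%E).
  rewrite integral_cst//.
  rewrite [X in (_ * X)%E](_ : _ = 1%:E); first by rewrite mule1 lte_fin expR_gt0.
  by apply: etrans (lebesgue_measure_itv `]0, 1[) _; rewrite /= lte_fin ltr01 oppr0 adde0.
apply: ge0_le_integral => //.
- by move=> x _; rewrite lee_fin expR_ge0.
- exact: mGE.
move=> x; rewrite /= in_itv/= => /andP[x0 x1].
rewrite lee_fin -[leLHS]mul1r ler_pM ?expR_ge0//; last by rewrite ler_expR lerN2 ltW.
by rewrite -[leLHS](powRr0 x) ger_powR ?x0 ?ltW//; have := rho0; lra.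
Qed.

(** The Caputo integrand of the power function with exponent [p]. *)
Definition frac_kernel p t x := p * x `^ (p - 1) / (t - x) `^ rho.

(** In terms of Euler's Beta function this is [p] times B(p, 1 - rho). *)
Definition frac_beta p := \int[mu]_(x in `]0, 1[) frac_kernel p 1 x.

Lemma measurable_frac_kernel p t : measurable_fun setT (frac_kernel p t).
Proof.
apply: measurable_funM.
  by apply: measurable_funM => //; exact: measurable_powR.
rewrite (_ : (fun x => _) = (fun x => (t - x) `^ (- rho))); last first.
  by apply/funext => x; rewrite powRN.
apply: (measurableT_comp (measurable_powR (- rho))).
exact: measurable_funB.
Qed.

Lemma frac_kernel_ge0 p t x : 0 < p -> 0 <= frac_kernel p t x.
Proof. by move=> p0; rewrite !mulr_ge0 ?invr_ge0 ?powR_ge0// ltW. Qed.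

Let mkE p t (D : set (measurableTypeR R)) : measurable D ->
  measurable_fun D (fun x => (frac_kernel p t x)%:E).
Proof.
by move=> mD; apply/measurable_EFinP; apply: measurable_funTS; exact: measurable_frac_kernel.
Qed.

Let m01 : measurable (`]0, 1[%classic : set (measurableTypeR R)). Proof. by []. Qed.

Let mpow p : measurable_fun (`]0, 1[%classic : set (measurableTypeR R)) (fun x => (p * x `^ (p -
  1))%:E).
Proof.
apply/measurable_EFinP; apply: measurable_funM => //.
exact: (measurable_funTS (@measurable_powR R _)).
Qed.

Let mpowr p : measurable_fun (`]0, 1[%classic : set (measurableTypeR R)) (fun x => (p * (1 - x) `^
  (p - 1))%:E).
Proof.
apply/measurable_EFinP; apply: measurable_funM => //.
apply: measurable_funTS; apply: (measurableT_comp (measurable_powR _)).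
exact: measurable_funB.
Qed.

Lemma frac_betaE p : 0 < p ->
  (\int[mu]_(x in `]0%R, 1%R[) (frac_kernel p 1 x)%:E = (frac_beta p)%:E)%E.
Proof.
move=> p0; rewrite /frac_beta /Rintegral fineK// ge0_fin_numE; last first.
  by apply: integral_ge0 => x _; rewrite lee_fin frac_kernel_ge0.
(* The two singularities are separated at 1/2: to the left [(1 - x)]^ (- rho) <= 2[, to the right]x
   [^ (p - 1) <= 2], and [c * (1 - rho) = 2 * p]. *)
pose c := 2 * p / (1 - rho).
have c0 : 0 <= c by rewrite /c !mulr_ge0 ?invr_ge0 ?ltW.
apply: (@le_lt_trans _ _ (\int[mu]_(x in `]0%R, 1%R[)
  (2%:E * (p * x `^ (p - 1))%:E + c%:E * ((1 - rho) * (1 - x) `^ (1 - rho - 1))%:E))%E).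
  apply: ge0_le_integral => //.
  - by move=> x _; rewrite lee_fin frac_kernel_ge0.
  - exact: mkE.
  - apply: emeasurable_funD; apply: measurable_funeM; [exact: mpow|exact: mpowr].
  move=> x; rewrite /= in_itv/= => /andP[x0 x1].
  rewrite -!EFinM -EFinD lee_fin /frac_kernel.
  have -> : 1 - rho - 1 = - rho by ring.
  rewrite powRN; have [h|h] := leP x 2^-1.
    apply: ler_wpDr.
      by rewrite !mulr_ge0 ?invr_ge0 ?powR_ge0// ltW.
    rewrite mulrC ler_wpM2r// ?mulr_ge0 ?powR_ge0// ?(ltW p0)//.
    rewrite invf_ple ?posrE ?powR_gt0// ?subr_gt0//.
    apply: (@le_trans _ _ (2^-1 `^ rho)).
      rewrite -[leLHS](@powRr1 _ 2^-1)// ger_powR//; last by have := rho1; lra.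
      by lra.
    by apply: ge0_ler_powR; rewrite ?nnegrE ?(ltW rho0)//; lra.
  apply: ler_wpDl; first by rewrite !mulr_ge0 ?powR_ge0 ?(ltW p0).
  rewrite mulrA (_ : c * (1 - rho) = 2 * p); last first.
    by rewrite /c divfK// gt_eqF.
  rewrite ler_wpM2r ?invr_ge0 ?powR_ge0// mulrC ler_wpM2r ?(ltW p0)//.
  apply: (@le_trans _ _ (x `^ (-1))).
    by rewrite ger_powR ?x0 ?(ltW x1)//; have := p0; lra.
  rewrite powR_inv1 ?(ltW x0)// invf_ple ?posrE// ltW//.
rewrite ge0_integralD//.
- rewrite !ge0_integralZl//.
  + by rewrite integral_powR// integral_powR_reflect// -!EFinM -EFinD ltry.
  + by move=> x _; rewrite lee_fin mulr_ge0 ?powR_ge0// ltW.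
  + by move=> x _; rewrite lee_fin mulr_ge0 ?powR_ge0// ltW.
- by move=> x _; rewrite -EFinM lee_fin !mulr_ge0 ?powR_ge0// ltW.
- by apply: measurable_funeM; exact: mpow.
- by move=> x _; rewrite -EFinM lee_fin mulr_ge0// mulr_ge0 ?powR_ge0// ltW.
- by apply: measurable_funeM; exact: mpowr.
Qed.

Lemma integral_frac_kernel p t : 0 < p -> 0 < t ->
  (\int[mu]_(x in `]0%R, t[) (frac_kernel p t x)%:E = (t `^ (p - rho) * frac_beta p)%:E)%E.
Proof.
move=> p0 t0; rewrite -[X in `]0%R, X[]mulr1 ge0_integral_scale//; last 2 first.
- exact: measurable_frac_kernel.
- by move=> x; exact: frac_kernel_ge0.
have t1 : 0 <= t `^ (p - 1) / t `^ rho by rewrite divr_ge0 ?powR_ge0.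
have -> : (\int[mu]_(x in `]0%R, 1%R[) (frac_kernel p t (t * x))%:E =
    \int[mu]_(x in `]0%R, 1%R[) ((t `^ (p - 1) / t `^ rho)%:E * (frac_kernel p 1 x)%:E))%E.
  apply: eq_integral => x; rewrite inE/= in_itv/= => /andP[x0 x1].
  rewrite -EFinM; congr EFin; rewrite /frac_kernel.
  rewrite powRM ?(ltW t0) ?(ltW x0)//.
  rewrite (_ : t - t * x = t * (1 - x)); last by rewrite mulrBr mulr1.
  rewrite powRM ?(ltW t0)// ?subr_ge0 ?(ltW x1)// invfM.
  by rewrite [RHS]mulrACA; congr (_ * _); rewrite mulrCA.
rewrite ge0_integralZl//; last 2 first.
- exact: mkE.
- by move=> x _; rewrite lee_fin frac_kernel_ge0.
rewrite frac_betaE// -!EFinM; congr EFin; rewrite !mulrA; congr (_ * _).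
by rewrite mulr_powRB1 ?(ltW t0)// powRB// (gt_eqF t0) implybT.
Qed.

Lemma frac_beta_ge M : 0 < M -> exists2 P, 0 < P & forall p, P <= p -> M <= frac_beta p.
Proof.
move=> M0; pose L := 2 * M.
have L0 : 0 < L by rewrite mulr_gt0.
pose d := Num.min (2^-1) (L `^ (- rho^-1)).
have d0 : 0 < d by rewrite lt_min powR_gt0// andbT.
have d2 : d <= 2^-1 by rewrite ge_min lexx.
have q0 : 0 < 1 - d < 1 by apply/andP; split; lra.
have lnq : ln (1 - d) < 0 by rewrite ln_lt0.
have ln2 : 0 < ln (2 : R) by rewrite ln_gt0// ltr1n.
exists (ln 2 / - ln (1 - d)); first by rewrite divr_gt0// oppr_gt0.
move=> p; rewrite ler_pdivrMr ?oppr_gt0// mulrN lerNr => Pp.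
have p0 : 0 < p by move: lnq ln2 Pp; nra.
have qp : (1 - d) `^ p <= 2^-1.
  rewrite /powR gt_eqF; last by case/andP: q0.
  by rewrite -[leRHS](@lnK _ 2^-1) ?posrE// ler_expR lnV ?posrE.
rewrite -lee_fin -frac_betaE//.
apply: (@le_trans _ _ (\int[mu]_(x in `](1 - d)%R, 1%R[) (L%:E * (p * x `^ (p - 1))%:E))%E).
  rewrite ge0_integralZl//; last 3 first.
  - apply/measurable_EFinP; apply: measurable_funM => //.
    exact: (measurable_funTS (@measurable_powR R _)).
  - by move=> x _; rewrite lee_fin mulr_ge0 ?powR_ge0// ltW.
  - by rewrite lee_fin ltW.
  rewrite integral_powR//; [|by case/andP: q0; lra|by case/andP: q0].
  rewrite powR1 -EFinM lee_fin /L; move: qp; set y := _ `^ _ => qp.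
  by move: M0; nra.
apply: (@le_trans _ _ (\int[mu]_(x in `](1 - d)%R, 1%R[) (frac_kernel p 1 x)%:E)%E); last first.
  apply: ge0_subset_integral => //.
  - exact: mkE.
  - by move=> x _; rewrite lee_fin frac_kernel_ge0.
  - move=> x; rewrite /= !in_itv/= => /andP[h1 ->]; rewrite andbT.
    by case/andP: q0 => h _; exact: lt_trans h1.
apply: ge0_le_integral => //.
- by move=> x _; rewrite -EFinM lee_fin !mulr_ge0 ?powR_ge0// ltW.
- apply: measurable_funeM; apply/measurable_EFinP; apply: measurable_funM => //.
  exact: (measurable_funTS (@measurable_powR R _)).
- exact: mkE.
move=> x; rewrite /= in_itv/= => /andP[x0 x1].
rewrite -EFinM lee_fin mulrC /frac_kernel ler_wpM2l ?mulr_ge0 ?powR_ge0 ?(ltW p0)//.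
have x1' : 0 < 1 - x by rewrite subr_gt0.
rewrite -[leLHS]invrK lef_pV2 ?posrE ?powR_gt0 ?invr_gt0//.
have -> : L^-1 = (L `^ (- rho^-1)) `^ rho.
  by rewrite -powRrM mulNr mulVf ?gt_eqF// powR_inv1// ltW.
apply: ge0_ler_powR; rewrite ?nnegrE ?powR_ge0 ?(ltW rho0) ?(ltW x1')//.
apply: (@le_trans _ _ d); first by lra.
by rewrite ge_min lexx orbT.
Qed.

Lemma frac_beta_ge1 p : 0 < p -> 1 <= frac_beta p.
Proof.
move=> p0; rewrite -lee_fin -frac_betaE//.
have -> : 1%:E = (\int[mu]_(x in `]0%R, 1%R[) (p * x `^ (p - 1))%:E)%E.
  by rewrite integral_powR// powR1 powR0 ?subr0// gt_eqF.
apply: ge0_le_integral => //.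
- by move=> x _; rewrite lee_fin mulr_ge0 ?powR_ge0// ltW.
- exact: mkE.
move=> x; rewrite /= in_itv/= => /andP[x0 x1].
have x1' : 0 < 1 - x by rewrite subr_gt0.
rewrite lee_fin ler_pMr ?mulr_gt0 ?powR_gt0//.
rewrite invf_ge1 ?powR_gt0// -[leRHS](powRr0 (1 - x)) ger_powR// ?(ltW rho0)//.
by apply/andP; split; lra.
Qed.

End fractional_kernel.


(** * Ratio test and termwise integration *)

Section series_integral.
Context {R : realType}.
Local Notation mu := (@lebesgue_measure R).

(** The quantity [a n * 2 ^+ n] does not increase from [K] on, so the sum [C] of its first values
    bounds it throughout and a geometric series dominates. *)
Lemma ratio_test (a : nat -> R) (K : nat) : (forall n, 0 <= a n) ->
  (forall n, (K <= n)%N -> a n.+1 <= 2^-1 * a n) -> cvgn (series a).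
Proof.
move=> a0 aK; pose C := \sum_(j < K.+1) a j * 2 ^+ j.
have b0 j : 0 <= a j * 2 ^+ j by rewrite mulr_ge0 ?exprn_ge0.
have aC n : a n * 2 ^+ n <= C.
  have base m : (m <= K)%N -> a m * 2 ^+ m <= C.
    move=> mK; have mK' : (m < K.+1)%N by [].
    by rewrite /C (bigD1 (Ordinal mK'))//= lerDl sumr_ge0.
  elim: n => [|n IH]; first exact: base.
  have [nK|Kn] := ltnP n K; first exact: base.
  apply: le_trans IH; rewrite exprS mulrA ler_wpM2r ?exprn_ge0//.
  by rewrite mulrC -ler_pdivlMl// aK.
apply: (@series_le_cvg _ _ (geometric C 2^-1)) => //.
- by move=> n; apply: geometric_ge0 => //; exact: sumr_ge0.
- by move=> n /=; rewrite exprVn ler_pdivlMr ?exprn_gt0.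
apply: is_cvg_geometric_series; rewrite ger0_norm//; lra.
Qed.

(** Dominated convergence for the partial sums, with the sum of the absolute values as majorant;
    that sum is integrable by monotone convergence and the hypothesis on [|a k| * I k]. *)
Lemma integral_series (D : set (measurableTypeR R)) (phi : nat -> R -> R) (a I : nat -> R) (h : R
  -> R) :
  measurable D -> (forall k, measurable_fun D (phi k)) ->
  (forall k x, D x -> 0 <= phi k x) ->
  (forall k, (\int[mu]_(x in D) (phi k x)%:E = (I k)%:E)%E) ->
  cvgn (series (fun k => `|a k| * I k)) ->
  (forall x, D x -> series (fun k => a k * phi k x) @ \oo --> h x) ->
  mu.-integrable D (EFin \o h) /\
  series (fun k => a k * I k) @ \oo --> \int[mu]_(x in D) h x.
Proof.
move=> mD mphi phi0 phiI cI ch.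
have iphi k : mu.-integrable D (EFin \o phi k).
  apply/integrableP; split; first exact/measurable_EFinP.
  rewrite (_ : (\int[mu]_(x in D) _ = (I k)%:E)%E); first exact: ltry.
  by rewrite -phiI; apply: eq_integral => x; rewrite inE => Dx; rewrite /= ger0_norm ?phi0.
have mh : measurable_fun D h.
  apply: (@measurable_fun_cvg _ _ _ _ (fun n x => series (fun k => a k * phi k x) n)) => //.
  move=> n; apply: measurable_sum => k; apply: measurable_funM => //; exact: mphi.
pose G x := (\sum_(k <oo) (`|a k| * phi k x)%:E)%E.
have mak k : measurable_fun D (fun x => (`|a k| * phi k x)%:E).
  by apply/measurable_EFinP; exact: measurable_funM.
have ak0 k x : D x -> (0 <= (`|a k| * phi k x)%:E)%E.
  by move=> Dx; rewrite lee_fin mulr_ge0// phi0.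
have G0 x : D x -> (0 <= G x)%E by move=> Dx; apply: nneseries_ge0 => k _ _; exact: ak0.
have iG : mu.-integrable D G.
  apply/integrableP; split.
    by apply: (@ge0_emeasurable_sum _ _ _ _ (fun k x => (`|a k| * phi k x)%:E) xpredT) => *;
      [exact: ak0|exact: mak].
  rewrite (_ : (\int[mu]_(x in D) _ = \int[mu]_(x in D) G x)%E); last first.
    by apply: eq_integral => x; rewrite inE => Dx; rewrite gee0_abs// G0.
  rewrite integral_nneseries//.
  rewrite (_ : (fun n => _) = (fun n => \sum_(0 <= k < n) (`|a k| * I k)%:E))%E; last first.
    apply/funext => n; apply: eq_bigr => k _.
    under eq_integral do rewrite EFinM.
    by rewrite ge0_integralZl_EFin// ?phiI//; [move=> x Dx; rewrite lee_fin
      phi0|exact/measurable_EFinP].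
  under eq_fun do rewrite sumEFin.
  by rewrite EFin_lim// ltry.
have [|||||ih _ H] := @dominated_convergence _ _ _ mu D mD
  (fun n x => (series (fun k => a k * phi k x) n)%:E) (EFin \o h) G.
- move=> n; apply/measurable_EFinP; apply: measurable_sum => k; apply: measurable_funM => //;
  exact: mphi.
- exact/measurable_EFinP.
- by apply: aeW => x Dx; apply: cvg_EFin; [exact: nearW|exact: ch].
- exact: iG.
- apply: aeW => x n Dx; apply: le_trans (nneseries_lim_ge n _); last by move=> k _ _; exact: ak0.
  rewrite /= sumEFin lee_fin; apply: le_trans (ler_norm_sum _ _ _) _.
  by apply: ler_sum => k _; rewrite normrM (ger0_norm (phi0 k x Dx)).
split=> //.
have E n : (\int[mu]_(x in D) (series (fun k => a k * phi k x) n)%:E = (series (fun k => a k * I k)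
  n)%:E)%E.
  under eq_integral do rewrite /series/= -sumEFin.
  rewrite integral_sum//.
    rewrite /series/= -sumEFin; apply: eq_bigr => k _.
    under eq_integral do rewrite EFinM.
    by rewrite integralZl// ?phiI//; exact: iphi.
  by move=> k; apply: (integrableZl mD (a k) (iphi k)).
move: H; rewrite (_ : (fun n => _) = (fun n => (series (fun k => a k * I k) n)%:E)); last first.
  by apply/funext => n; rewrite /= E.
rewrite -[X in _ --> X]fineK; last exact: integrable_fin_num ih.
by move/fine_cvg.
Qed.

End series_integral.


Section mittag_leffler.
Context {R : realType}.
Implicit Types (a b t x y : R) (f g : R -> R).
Local Notation mu := (@lebesgue_measure R).

Lemma integral_abs_continuous a b f g : mu.-integrable setT (EFin \o g) ->
  (forall x y, a <= x -> x <= y -> y <= b -> f y - f x = \int[mu]_(t in `]x, y[) g t) ->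
  abs_continuous a b f.
Proof.
move=> ig fE e e0; have [d [d0 Hd]] := integral_normr_continuous ig e0.
exists d => // n l r lr tlr ld.
pose A := \big[setU/set0]_(i < n) (`]l i, r i[%classic : set (measurableTypeR R)).
have mA : measurable A by exact: bigsetU_measurable.
have mI (i : 'I_n) : measurable (`]l i, r i[%classic : set (measurableTypeR R)) by [].
have muI i : (mu `]l i, r i[%classic = (r i - l i)%:E)%E.
  apply: etrans (lebesgue_measure_itv `]l i, r i[) _.
  have [_ [lri _]] := lr i.
  rewrite /= lte_fin lt_neqAle lri andbT; case: eqVneq => [->|_]/=; by rewrite ?subrr// EFinB.
have muA : (mu A < d%:E)%E.
  rewrite /A (@measure_semi_additive_ord _ _ _ mu n (fun i => `]l i, r i[%classic))//.
  rewrite (_ : \sum_(i < n) _ = (\sum_(i < n) (r i - l i))%:E) ?lte_fin//.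
  by rewrite -sumEFin; apply: eq_bigr => i _; exact: muI.
apply: le_lt_trans (Hd A mA muA).
have -> : \int[mu]_(x in A) `|g x| = \sum_(i < n) \int[mu]_(x in `]l i, r i[) `|g x|.
  rewrite /Rintegral /A (@ge0_integral_bigsetU _ _ _ mu _ (fun i => `]l i, r i[%classic : set
    (measurableTypeR R)))//.
  - rewrite sum_fine// => i _; apply: integrable_fin_num => //.
    by apply: integrable_norm; exact: (integrableS measurableT).
  - exact: index_enum_uniq.
  - by apply: sub_trivIset tlr.
  - apply/measurable_EFinP/measurable_funTS/(measurableT_comp (@normr_measurable R setT)).
    by apply/measurable_EFinP; exact: measurable_int ig.
apply: ler_sum => i _; have [al [lri rb]] := lr i.
rewrite fE//; apply: le_normr_Rintegral => //.
exact: (integrableS measurableT).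
Qed.

Variables (rho lam : R).
Hypothesis rho01 : 0 < rho < 1.

Let rho0 : 0 < rho. Proof. by case/andP: rho01. Qed.
Let G := Gamma (1 - rho).
Let G0 : 0 < G. Proof. exact: Gamma_gt0. Qed.

Let B (k : nat) := frac_beta rho (rho * k.+1%:R).
Let B1 k : 1 <= B k. Proof. by apply: frac_beta_ge1 => //; rewrite mulr_gt0. Qed.
Let B0 k : 0 < B k. Proof. exact: lt_le_trans (B1 k). Qed.

(* Chosen so that the Caputo derivative of c_(k+1) t^(rho (k+1)) is - lam c_k t^(rho k). *)
Fixpoint ml_coef (k : nat) : R :=
  if k is k'.+1 then - lam * G / B k' * ml_coef k' else 1.

Local Notation c := ml_coef.

(** The factor [k.+1] lets the same majorant serve the termwise derivative. The ratio of consecutive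
    terms is at most [2 * |lam| * G * y / B n], hence at most 1/2 as soon as [B n] reaches the
    constant [M]. *)
Let ml_series_cvg y : 0 <= y -> cvgn (series (fun k => `|c k| * k.+1%:R * y ^+ k)).
Proof.
move=> y0; pose M := 4 * `|lam| * G * y + 1.
have M0 : 0 < M by rewrite ltr_wpDl// !mulr_ge0// ltW.
have [P P0 HP] := frac_beta_ge rho01 M0.
apply: (@ratio_test _ _ (Num.trunc (P / rho))) => [n|n Pn].
  by rewrite !mulr_ge0// exprn_ge0.
have BM : M <= B n.
  apply: HP; rewrite mulrC -ler_pdivrMr//; apply: le_trans (ltW (truncnS_gt _)) _.
  by rewrite ler_nat ltnS.
rewrite /= !normrM normrN (gtr0_norm G0) normfV (gtr0_norm (B0 n)) exprS.
have n2 : n.+2%:R <= 2 * n.+1%:R :> R by rewrite -natrM ler_nat mul2n -addnn addnS ltnS leq_addr.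
have [w wE] : exists w, w = `|c n| * y ^+ n by exists (`|c n| * y ^+ n).
have w0 : 0 <= w by rewrite wE mulr_ge0// exprn_ge0.
rewrite (_ : _ * (y * y ^+ n) = (`|lam| * G * y * n.+2%:R) / B n * w); last first.
  by rewrite wE; ring.
rewrite (_ : 2^-1 * _ = (n.+1%:R / 2) * w); last by rewrite wE; ring.
rewrite ler_wpM2r// ler_pdivrMr//.
have q0 : 0 <= `|lam| * G * y by rewrite !mulr_ge0// ltW.
apply: (@le_trans _ _ (`|lam| * G * y * (2 * n.+1%:R))); first by rewrite ler_wpM2l.
have : `|lam| * G * y * (2 * n.+1%:R) <= n.+1%:R / 2 * M.
  rewrite /M; have : 0 <= n.+1%:R / 2 :> R by [].
  move: q0; set q := `|lam| * G * y => q0 n0.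
  by rewrite (_ : 4 * _ * _ * _ = 4 * q); [nra|rewrite /q; ring].
by move/le_trans; apply; rewrite ler_wpM2l.
Qed.

Let p (k : nat) : R := rho * k.+1%:R.
Let p0 k : 0 < p k. Proof. by rewrite mulr_gt0. Qed.
Let phi k x := p k * x `^ (p k - 1).
Let phi0 k x : 0 <= phi k x. Proof. by rewrite mulr_ge0 ?powR_ge0// ltW. Qed.
(** The termwise derivative of the Mittag-Leffler series; it has an integrable singularity at 0
    because [rho < 1]. *)
Let h x := limn (series (fun k => c k.+1 * phi k x)).

Let powk k x : x `^ (rho * k%:R) = (x `^ rho) ^+ k.
Proof. by rewrite powRrM powR_mulrn// powR_ge0. Qed.

Let powp k t : 0 < t -> t `^ (p k - rho) = (t `^ rho) ^+ k.
Proof. by move=> t0; rewrite -powk /p -natr1 mulrDr mulr1 addrK. Qed.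

Let phiE k x : 0 < x -> phi k x = rho * x `^ (rho - 1) * (k.+1%:R * (x `^ rho) ^+ k).
Proof.
move=> x0; rewrite /phi -powk (_ : p k - 1 = (rho - 1) + rho * k%:R); last first.
  by rewrite /p -natr1; ring.
by rewrite powRD ?(gt_eqF x0) ?implybT// /p; ring.
Qed.

Let coefS k : `|c k.+1| <= `|lam| * G * `|c k|.
Proof.
rewrite /= !normrM normrN (gtr0_norm G0) normfV (gtr0_norm (B0 k)) ler_wpM2r//.
by rewrite ler_pdivrMr// ler_peMr// mulr_ge0// ltW.
Qed.

Let ml_cvg (w : nat -> R) K y : 0 <= y -> (forall k, 0 <= w k) ->
  (forall k, w k <= K * (`|c k| * k.+1%:R * y ^+ k)) -> cvgn (series w).
Proof.
move=> y0 w0 wK; pose K' := `|K|.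
have t0 k : 0 <= `|c k| * k.+1%:R * y ^+ k by rewrite mulr_ge0 ?exprn_ge0// mulr_ge0.
apply: (@series_le_cvg _ _ (fun k => K' * (`|c k| * k.+1%:R * y ^+ k))) => //.
- by move=> k; exact: mulr_ge0 (normr_ge0 _) (t0 k).
- by move=> k; apply: le_trans (wK k) _; rewrite ler_wpM2r// ler_norm.
exact: (@is_cvg_seriesZ _ _ K' (ml_series_cvg y0)).
Qed.

Let h_cvg x : 0 < x -> series (fun k => c k.+1 * phi k x) @ \oo --> h x.
Proof.
move=> x0; apply: normed_cvg.
apply: (@ml_cvg _ (`|lam| * G * rho * x `^ (rho - 1)) (x `^ rho)) => [|k|k]; rewrite ?powR_ge0//=.
rewrite normrM (ger0_norm (phi0 k x)) phiE//.
apply: (@le_trans _ _ (`|lam| * G * `|c k| * (rho * x `^ (rho - 1) * (k.+1%:R * (x `^ rho) ^+ k)))).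
  by rewrite ler_wpM2r ?coefS// -phiE.
rewrite le_eqVlt; apply/orP; left; apply/eqP.
by move: (x `^ (rho - 1)) ((x `^ rho) ^+ k) => u w; ring.
Qed.

Let mt t : measurable (`]0, t[%classic : set (measurableTypeR R)). Proof. by []. Qed.

Let h_int t : 0 < t -> mu.-integrable `]0, t[ (EFin \o h) /\
  series (fun k => c k.+1 * (t `^ rho) ^+ k.+1) @ \oo --> \int[mu]_(x in `]0, t[) h x.
Proof.
move=> t0; apply: (integral_series (phi := phi)) => //.
- by move=> k; apply: measurable_funM => //; exact: (measurable_funTS (@measurable_powR R _)).
- move=> k; have /= := integral_powR (p0 k) (lexx 0) t0.
  by rewrite powR0 ?gt_eqF// subr0 /p powk.
- have y0 : 0 <= t `^ rho by rewrite powR_ge0.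
  apply: (@ml_cvg _ (`|lam| * G * t `^ rho) (t `^ rho)) => [//|k|k]; first by rewrite mulr_ge0//
    exprn_ge0.
  apply: (@le_trans _ _ (`|lam| * G * `|c k| * (t `^ rho) ^+ k.+1)).
    by rewrite ler_wpM2r ?exprn_ge0// coefS.
  rewrite exprS; have k1 : 1 <= k.+1%:R :> R by rewrite ler1n.
  have : 0 <= `|lam| * G * `|c k| * (t `^ rho * (t `^ rho) ^+ k).
    by rewrite !mulr_ge0 ?exprn_ge0// ltW.
  move: k1; move: (k.+1%:R) (t `^ rho) => w u w1 H.
  rewrite (_ : _ * (_ * w * _) = `|lam| * G * `|c k| * (u * u ^+ k) * w); last by ring.
  by rewrite ler_peMr.
- by move=> x; rewrite /= in_itv/= => /andP[x0 _]; exact: h_cvg.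
Qed.

Let h_kernel t : 0 < t ->
  mu.-integrable `]0, t[ (fun x => (h x / (t - x) `^ rho)%:E) /\
  series (fun k => c k.+1 * ((t `^ rho) ^+ k * B k)) @ \oo -->
    \int[mu]_(x in `]0, t[) (h x / (t - x) `^ rho).
Proof.
move=> t0; apply: (integral_series (phi := fun k => frac_kernel rho (p k) t)) => //.
- by move=> k; apply: measurable_funTS; exact: measurable_frac_kernel.
- by move=> k x _; exact: frac_kernel_ge0.
- by move=> k; rewrite integral_frac_kernel// powp.
- have y0 : 0 <= t `^ rho by rewrite powR_ge0.
  apply: (@ml_cvg _ (`|lam| * G) (t `^ rho)) => [//|k|k].
    by rewrite !mulr_ge0 ?exprn_ge0// ltW.
  rewrite /= !normrM normrN (gtr0_norm G0) normfV (gtr0_norm (B0 k)).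
  rewrite (_ : _ * (_ * B k) = `|lam| * G * (`|c k| * (t `^ rho) ^+ k)); last first.
    by field; rewrite gt_eqF.
  rewrite ler_wpM2l// ?mulr_ge0// ?(ltW G0)// mulrAC ler_peMr ?ler1n//.
  by rewrite mulr_ge0// exprn_ge0.
- move=> x; rewrite /= in_itv/= => /andP[x0 _].
  rewrite (_ : series _ = (fun n => series (fun k => c k.+1 * phi k x) n * ((t - x) `^ rho)^-1)).
    by apply: cvgMl; exact: h_cvg.
  apply/funext => n; rewrite /series/= mulr_suml; apply: eq_bigr => k _.
  by rewrite /frac_kernel /phi mulrA.
Qed.

Definition ml t : R := 1 + \int[mu]_(x in `]0, t[) h x.

Let ml_cvgE t : 0 < t -> series (fun k => c k * (t `^ rho) ^+ k) @ \oo --> ml t.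
Proof.
move=> /h_int[_ H]; rewrite -(cvg_shiftS (series _)).
rewrite (_ : (fun n => _) = (fun n => 1 + series (fun k => c k.+1 * (t `^ rho) ^+ k.+1) n)).
  by apply: cvgD => //; exact: cvg_cst.
by apply/funext => n; rewrite /series/= big_nat_recl//= expr0 mulr1.
Qed.

Lemma ml0 : ml 0 = 1.
Proof. by rewrite /ml set_itvoo0 Rintegral_set0 addr0. Qed.

Lemma ml_density beta : 0 < beta -> mu.-integrable setT (EFin \o (h \_ `]0, beta[)) /\
  forall x y, 0 <= x -> x <= y -> y <= beta ->
    ml y - ml x = \int[mu]_(t in `]x, y]) (h \_ `]0, beta[) t.
Proof.
move=> beta0; have [ih _] := h_int beta0.
have iH : mu.-integrable setT (EFin \o (h \_ `]0, beta[)).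
  by rewrite -restrict_EFin; apply/(integrable_mkcond _ (mt beta)).
have iHI (I : interval R) : mu.-integrable [set` I] (EFin \o (h \_ `]0, beta[)).
  exact: (integrableS measurableT).
have mlE y : 0 <= y <= beta -> ml y = 1 + \int[mu]_(t in `]0, y]) (h \_ `]0, beta[) t.
  move=> /andP[y0 yb]; rewrite -Rintegral_itv_bndo_bndc; last exact: iHI.
  congr (1 + _); apply: eq_Rintegral => t; rewrite inE/= in_itv/= => /andP[t0 ty].
  by rewrite patchE mem_set//= in_itv/= t0 (lt_le_trans ty).
split=> // x y x0 xy yb; rewrite !mlE ?x0 ?yb ?(le_trans xy) ?(le_trans x0)//.
by rewrite opprD addrACA subrr add0r Rintegral_itvB.
Qed.

Lemma ml_abs_continuous beta : 0 < beta -> abs_continuous 0 beta ml.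
Proof.
move=> /ml_density[iH HE]; apply: (integral_abs_continuous iH) => x y x0 xy yb.
by rewrite HE// Rintegral_itv_bndo_bndc//; exact: (integrableS measurableT).
Qed.

(** Integrating [h] termwise against the kernel multiplies the coefficient [c k.+1] by [B k], which
    the recursion turns into [- lam * G * c k]; the prefactor of the Caputo derivative removes
    [G]. *)
Lemma ml_caputo t : 0 < t -> has_caputo rho ml t /\ caputo rho ml t = - lam * ml t.
Proof.
move=> t0; have [ih hE] := h_kernel t0; have [iH HE] := ml_density t0.
have acml := ml_abs_continuous t0.
have mc : measurable_fun `]0, t[ (fun x => (caputo_integrand rho ml t x)%:E).
  by apply/measurable_EFinP; exact: (measurable_caputo_integrand rho t0).
have E : ae_eq mu (`]0, t[%classic : set (measurableTypeR R))
    (fun x => (caputo_integrand rho ml t x)%:E) (fun x => (h x / (t - x) `^ rho)%:E).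
  have [A [mA A0 HA]] := density_derive t0 iH HE.
  exists A; split => // x Hx; apply: HA => H; apply: Hx; rewrite /= in_itv/= => x0t.
  have [_ df] := H x0t.
  by rewrite /caputo_integrand derive1E df patchE mem_set//= in_itv.
have [ic Ec] := ae_eq_integrable (mt t) mc ih E; split; first exact: ic.
rewrite /caputo /Rintegral Ec -/(Rintegral _ _ _).
have -> : \int[mu]_(x in `]0, t[) (h x / (t - x) `^ rho) = - lam * G * ml t.
  apply: (cvg_unique _ hE) => //.
  rewrite (_ : series _ = (fun n => - lam * G * series (fun k => c k * (t `^ rho) ^+ k) n)).
    by apply: cvgMr; exact: ml_cvgE.
  apply/funext => n; rewrite /series/= mulr_sumr; apply: eq_bigr => k _.
  by move: (t `^ rho) (B0 k) => u Bk; field; rewrite gt_eqF.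
by rewrite mulrA mulrCA mulVf ?mulr1// gt_eqF.
Qed.

End mittag_leffler.

(** * Nonuniqueness *)

Lemma within_continuousM (R : realType) (S T : topologicalType) (A : set S) (B : set T)
    (f : S -> R) (g : T -> R) : {within A, continuous f} -> {within B, continuous g} ->
  {within A `*` B, continuous (fun p => f p.1 * g p.2)}.
Proof.
move=> /subspace_continuousP cf /subspace_continuousP cg.
apply/subspace_continuousP => -[x t] [/= Ax Bt]; apply: cvgM.
- apply: cvg_trans (cf x Ax) => P /= nP.
  exists ([set y | A y -> P (f y)], setT) => /=; first by split=> //; exact: filterT.
  by move=> [y s] [/= H _] [/= Ay _]; exact: H.
- apply: cvg_trans (cg t Bt) => P /= nP.
  exists (setT, [set s | B s -> P (g s)]) => /=; first by split=> //; exact: filterT.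
  by move=> [y s] [/= _ H] [/= _ Bs]; exact: H.
Qed.

Section nonuniqueness.
Context {R : realType} (N : nat).
Variables (rho alpha beta lambda lam : R) (Omega : set 'rV[R]_N) (v : 'rV[R]_N -> R).
Hypotheses (rho01 : 0 < rho < 1) (alpha0 : 0 < alpha) (beta0 : 0 < beta).
Hypothesis oO : open Omega.
Hypothesis hv : dirichlet_eigenfunction Omega lam v.

Let T (t : R) : R := if t < 0 then expR (lam * t) else ml rho lam t.

Let Tneg t : t < 0 -> T t = expR (lam * t). Proof. by rewrite /T => ->. Qed.
Let Tpos t : 0 <= t -> T t = ml rho lam t. Proof. by rewrite /T leNgt => /negbTE ->. Qed.
Let T0 : T 0 = 1. Proof. by rewrite Tpos// ml0. Qed.

Let acT : abs_continuous 0 beta T.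
Proof.
move=> e e0; have [d d0 H] := ml_abs_continuous lam rho01 beta0 e0.
exists d => // n l r lr tlr ld; have := H n l r lr tlr ld.
congr (_ < _); apply: eq_bigr => i _; have [al [lri _]] := lr i.
by rewrite !Tpos// (le_trans al).
Qed.

Let cT : {within `[- alpha, beta], continuous T}.
Proof.
pose E (t : R) := expR (lam * Num.min t 0).
pose M (t : R) := ml rho lam (Num.max t 0).
(* Both branches equal 1 at 0, so [T] is a sum of two functions each frozen on one half-line;
   continuity then needs no case distinction at 0. *)
have TE t : T t = E t + M t - 1.
  have [t0|t0] := ltP t 0.
    by rewrite Tneg// /E /M (min_idPl (ltW t0)) (max_idPr (ltW t0)) ml0 addrK.
  by rewrite Tpos// /E /M (min_idPr t0) (max_idPl t0) mulr0 expR0 addrC addKr.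
have cE : continuous E.
  move=> t; apply: continuous_comp; last exact: continuous_expR.
  apply: (@continuousM R R (cst lam) (fun t : R => Num.min t 0) t); first exact: cst_continuous.
  by apply: continuous_min => //; exact: cst_continuous.
apply/subspace_continuousP => t; rewrite /= in_itv/= => /andP[at_ tb].
rewrite (_ : T = fun t => E t + M t - 1); last by apply/funext => s; exact: TE.
apply: cvgB; last exact: cvg_cst.
apply: cvgD; first by apply: (cvg_trans _ (cE t)); apply: cvg_app; exact: cvg_within.
apply/cvgrPdist_le => e e0.
have [d d0 Hd] := abs_continuous_cont (ml_abs_continuous lam rho01 beta0) e0.
rewrite near_withinE; apply/nbhs_ballP; exists d => // s; rewrite /ball/= => sd.
rewrite in_itv/= => /andP[as_ sb].
have max_in (r : R) : r <= beta -> 0 <= Num.max r 0 <= beta.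
  by move=> rb; rewrite le_max lexx orbT/= ge_max rb ltW.
have max_lip (r q : R) : r <= q -> Num.max r 0 <= Num.max q 0 /\ Num.max q 0 - Num.max r 0 <= q - r.
  by move=> rq; case: (leP r 0); case: (leP q 0) => *; split; lra.
have /andP[t1 t2] := max_in t tb; have /andP[s1 s2] := max_in s sb.
have [ts|st] := leP t s.
  have [h1 h2] := max_lip t s ts; rewrite distrC; apply: Hd => //.
  by apply: le_lt_trans h2 _; apply: le_lt_trans (ler_norm _) _; rewrite distrC.
have [h1 h2] := max_lip s t (ltW st); apply: Hd => //.
by apply: le_lt_trans h2 _; apply: le_lt_trans (ler_norm _) _.
Qed.

Let derT (t : R) : t < 0 -> is_derive t 1 T (lam * expR (lam * t)).
Proof.
move=> t0.
have dE : is_derive t 1 (fun s : R => expR (lam * s)) (lam * expR (lam * t)).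
  rewrite mulrC; apply: (@is_derive1_comp _ expR (fun s => lam * s)).
  by apply: is_derive_eq; rewrite /GRing.scale/= mulr1.
have [d1 d2] := dE.
have E : {near t, (fun s : R => expR (lam * s)) =1 T}.
  by near=> s; rewrite Tneg//; near: s; exact: lt_nbhsl.
by apply: DeriveDef; [exact: near_eq_derivable E d1|rewrite -(near_eq_derive _ E)].
Unshelve. all: end_near. Qed.

(** The Caputo integral sees only derivatives at positive times, near which [T] coincides with
    [ml]. *)
Let capT (t : R) : 0 < t <= beta -> has_caputo rho T t /\ caputo rho T t = - lam * T t.
Proof.
move=> /andP[t0 tb]; have [h1 h2] := ml_caputo lam rho01 t0.
have E (s : R) : 0 < s -> caputo_integrand rho (ml rho lam) t s = caputo_integrand rho T t s.
  move=> s0; rewrite /caputo_integrand !derive1E; congr (_ / _); apply: near_eq_derive.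
  by near=> r; rewrite Tpos//; apply: ltW; near: r; exact: lt_nbhsr.
split.
  apply: (@eq_integrable _ _ _ _ _ _ _ _ _ h1) => // s; rewrite inE/= in_itv/= => /andP[s0 _].
  by rewrite E.
rewrite Tpos; last exact: ltW.
rewrite -h2; apply: (congr1 (fun r => (Gamma (1 - rho))^-1 * r)); apply: eq_Rintegral => s.
by rewrite inE/= in_itv/= => /andP[s0 _]; rewrite E.
Unshelve. all: end_near. Qed.

Let lapv x : Omega x -> has_laplacian v x.
Proof.
have [_ [_ C2] _ _ _] := hv; move=> Ox i; have [d1 [_ /(_ i)[d2 _]]] := C2 i.
split; last exact: d2.
by apply: filterS (open_nbhs_nbhs (conj oO Ox)) => y; exact: d1.
Qed.

Lemma eigenmode_solution : expR (- lam * alpha) = lambda ->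
  dezin_solution rho alpha beta Omega lambda (fun _ _ => 0) (fun x t => v x * T t).
Proof.
move=> lamE; have [cv _ Ev vb _] := hv.
have lapw x t : Omega x -> has_laplacian (fun y => v y * T t) x /\
    laplacian (fun y => v y * T t) x = - lam * (v x * T t).
  move=> Ox; have := laplacian_lin (T t) 0 (lapv Ox) (lapv Ox) => /=.
  rewrite (_ : (fun y => _) = (fun y => v y * T t)); last by apply/funext => y; rewrite mul0r addr0
    mulrC.
  move=> [h1 ->]; split=> //; rewrite mul0r addr0 -[laplacian v x]opprK Ev//.
  by rewrite mulrN mulNr mulrCA (mulrC (T t)).
have capw x (t : R) : 0 < t <= beta -> has_caputo rho (fun s => v x * T s) t /\
    caputo rho (fun s => v x * T s) t = - lam * (v x * T t).
  move=> tb; have [h1 h2] := capT tb; have /andP[_ tb'] := tb.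
  have := caputo_lin (v x) 0 beta0 acT acT tb' h1 h1 => /=.
  rewrite (_ : (fun y => _) = (fun s => v x * T s)); last by apply/funext => y; rewrite mul0r addr0.
  by move=> [h3 ->]; split=> //; rewrite mul0r addr0 h2 mulrCA.
have derw x (t : R) : t < 0 -> is_derive t 1 (fun s => v x * T s) (lam * (v x * T t)).
  move=> t0; rewrite mulrCA Tneg//; have := derT t0; exact: is_deriveZ.
have cw : {within closure Omega `*` `[- alpha, beta], continuous (fun p => v p.1 * T p.2)}.
  exact: within_continuousM.
have cnz : {within closure Omega `*` nonzero_times alpha beta, continuous (fun p => v p.1 * T p.2)}.
  apply: continuous_subspaceW cw => -[x t] [/= Ox tn]; split => //=; rewrite in_itv/=.
  by case: tn; rewrite /= in_itv/= => /andP[t1 t2]; apply/andP; split;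
    rewrite ?(ltW t1)// ?t2// ?(le_trans (ltW t2))// ?ltW// (lt_trans _ t1)// oppr_lt0.
have sc (A : set ('rV[R]_N * R)) q (f : 'rV[R]_N * R -> R) : {within A, continuous (fun p => v p.1
  * T p.2)} ->
    (forall p, A p -> f p = q * (v p.1 * T p.2)) -> {within A, continuous f}.
  by move=> cA fE; apply: (within_continuous_lin (p := q) (q := 0) cA cA) => p /fE ->; rewrite
    mul0r addr0.
split.
  split.
  - exact: cw.
  - move=> x Ox; have := abs_continuous_lin (v x) 0 acT acT.
    by rewrite (_ : (fun y => _) = (fun s => v x * T s))//; apply/funext => y; rewrite mul0r addr0.
  - split; first by move=> x t Ox _; have [] := lapw x t Ox.
    exists (fun p => - lam * (v p.1 * T p.2)); first exact: (sc _ (- lam) _ cnz).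
    by move=> x t Ox _; have [_ ->] := lapw x t Ox.
  - split; first by move=> x t _ /(capw x)[].
    apply: (sc _ (- lam)); last by move=> [x t] [_ /=]; rewrite in_itv/= => /(capw x)[].
    by apply: continuous_subspaceW cnz => -[x t] [Ox tb]; split=> //; right.
  - split; first by move=> x t _ /andP[_ t0]; have [] := derw x t t0.
    apply: (sc _ lam).
      by apply: continuous_subspaceW cnz => -[x t] [Ox tb]; split=> //; left.
    move=> [x t] [_ /=]; rewrite in_itv/= => /andP[_ t0].
    by have [_] := derw x t t0; rewrite derive1E.
split.
- by move=> x t Ox tb; have [_ ->] := capw x t tb; have [_ ->] := lapw x t Ox; rewrite subrr.
- move=> x t Ox /andP[_ t0]; have [_] := derw x t t0; rewrite -derive1E => ->.
  by have [_ ->] := lapw x t Ox; rewrite mulNr subrr.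
- by move=> x t bx _; rewrite vb// mul0r.
- move=> x Ox; exists (v x).
  have : T t @[t --> 0] --> T 0.
    have I0 : nbhs (0 : R) `[- alpha, beta]%classic.
      have : (0 : R) \in `]- alpha, beta[ by rewrite in_itv/= oppr_lt0 alpha0.
      move=> /near_in_itvoo; apply: filterS => s; rewrite /= !in_itv/= => /andP[h1 h2].
      by rewrite !ltW.
    have /subspace_continuousP/(_ 0) := cT; rewrite within_interior//; apply.
    exact: nbhs_singleton.
  rewrite T0 => cT0.
  have : v x * T t @[t --> 0] --> v x by rewrite -[X in _ --> X]mulr1; apply: cvgMr.
  by split; [exact: cvg_at_right_filter|exact: cvg_at_left_filter].
- by move=> x Ox; rewrite T0 Tneg ?oppr_lt0// mulrN -mulNr lamE mulr1 mulrC.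
Qed.

Lemma dezin_nonuniqueness F : (exists u, dezin_solution rho alpha beta Omega lambda F u) ->
  expR (- lam * alpha) = lambda -> ~ dezin_unique rho alpha beta Omega lambda F.
Proof.
move=> [u hu] lamE H; have [_ _ _ _ [x Ox vx]] := hv.
have hw : dezin_solution rho alpha beta Omega lambda F (fun x t => 1 * u x t + 1 * (v x * T t)).
  by apply: (dezin_solution_lin beta0 hu (eigenmode_solution lamE)) => y t; rewrite mul1r mulr0
    addr0.
have t0 : - alpha <= 0 <= beta by rewrite oppr_le0 !ltW.
have := H _ _ hu hw x 0 (subset_closure Ox) t0.
rewrite !mul1r T0 mulr1 -[LHS]addr0 => /addrI/esym/eqP; exact/negP.
Qed.

End nonuniqueness.
Theorem theorem3p1 (R : realType) (N : nat) (hN : (0 < N)%N)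
    (rho alpha beta lambda : R)
    (hrho : 0 < rho < 1) (halpha : 0 < alpha) (hbeta : 0 < beta)
    (hlambda : lambda != 0)
    (Omega : set 'rV[R]_N) (hOmega : bounded_domain Omega)
    (m : nat) (hm : (0 < m)%N) (hsmooth : Ck_boundary m Omega)
    (v : nat -> 'rV[R]_N -> R) (lam : nat -> R)
    (hlam0 : forall k, 0 < lam k)
    (hlam : forall k, lam k <= lam k.+1)
    (hv : forall k, dirichlet_eigenfunction Omega (lam k) (v k))
    (hcomplete : complete_orthonormal_system Omega v)
    (F : 'rV[R]_N -> R -> R)
    (hF : {within Omega `*` nonzero_times alpha beta,
             continuous (fun p : 'rV[R]_N * R => F p.1 p.2)})
    (hsol : exists u, dezin_solution rho alpha beta Omega lambda F u) :
  dezin_unique rho alpha beta Omega lambda F <->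
  (forall k, expR (- lam k * alpha) - lambda != 0).
Proof.
have [oO cO neO bO] := hOmega; have /andP[rho0 rho1] := hrho.
split=> [uniq k|delta]; last exact: (@dezin_uniqueness R N rho alpha beta lambda Omega v lam).
apply/eqP => /eqP; rewrite subr_eq0 => /eqP lamE.
exact: (dezin_nonuniqueness hrho halpha hbeta oO (hv k) hsol lamE).
Qed.
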